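(* Let $N\ge2$, let $K>0$ be a constant, and let $W(x)=K|x|^2+U(x)$, where either $U=V$ is the fundamental solution of $-\Delta$, or $U=V_s$ is the fundamental solution of $(-\Delta)^s$ for some $s\in(0,1)$. Assume that $W$ is non-negative (so that $W:\mathbb{R}^N\to[0,+\infty]$, with $W(0)=+\infty$, is lower semicontinuous and in $L^1_{loc}(\mathbb{R}^N)$). Then there exists a unique (up to translation) $d_2$-local minimizer $\mu_0\in\mathcal{P}_2(\mathbb{R}^N)$ of $E$, which is also the unique (up to translation) global minimizer of $E$ in $\mathcal{P}_2(\mathbb{R}^N)$. Furthermore, $\mu_0$ is compactly supported and radially symmetric (about its center of mass).
   Context: $\mathcal{P}(\mathbb{R}^N)$ is the set of Borel probability measures on $\mathbb{R}^N$ and $\mathcal{P}_2(\mathbb{R}^N)$ the subset of those with finite second moment. $E[\mu]=\frac12\iint W(x-y)\,d\mu(x)d\mu(y)\in[0,\infty]$. $d_2$ is the 2-Wasserstein distance: $d_2^2(\mu,\nu)=\inf_{\pi\in\Pi(\mu,\nu)}\iint|x-y|^2d\pi(x,y)$, where $\Pi(\mu,\nu)$ is the set of Borel probability measures on $\mathbb{R}^N\times\mathbb{R}^N$ with marginals $\mu,\nu$. $\mu$ is a $d_2$-local minimizer of $E$ if $E[\mu]<\infty$ and there is $\varepsilon>0$ with $E[\mu]\le E[\nu]$ for all $\nu$ with $d_2(\mu,\nu)<\varepsilon$. $V(x)=\frac{1}{N(N-2)\omega_N}|x|^{2-N}$ if $N\ge3$ and $V(x)=\frac1{2\pi}\log\frac1{|x|}$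 if $N=2$, with $\omega_N$ the volume of the unit ball, so that $-\Delta V=\delta_0$. $V_s(x)=c_{N,s}|x|^{-(N-2s)}$, with $c_{N,s}>0$ such that $(-\Delta)^sV_s=\delta_0$, where $(-\Delta)^s$ has Fourier symbol $|\xi|^{2s}$. *)

(* Defs.v *)
From HB Require Import structures.
From mathcomp Require Import all_boot all_order all_algebra.
From mathcomp Require Import all_classical all_reals all_analysis.
From mathcomp Require Import measurable_realfun.

Set Implicit Arguments.
Unset Strict Implicit.
Unset Printing Implicit Defensive.

Import Order.TTheory GRing.Theory Num.Theory.
Import numFieldNormedType.Exports.

Local Open Scope classical_set_scope.
Local Open Scope ring_scope.

(* The library topology on 'rV[R]_n comes from the sup norm, hence is the
   Euclidean one; products of these spaces carry the product sigma-algebra,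
   which is the Borel one by second countability. *)
HB.instance Definition _ (R : realType) (n : nat) :=
  @isMeasurable.Build (sigma_display (@open 'rV[R]_n)) 'rV[R]_n
    <<s @open 'rV[R]_n >>
    (@sigma_algebra0 _ setT (@open 'rV[R]_n))
    (@sigma_algebraC _ (@open 'rV[R]_n))
    (@sigma_algebra_bigcup _ setT (@open 'rV[R]_n)).

Section lebesgue_rV.
Variable R : realType.

Lemma open_rV_measurable n (A : set 'rV[R]_n) : open A -> measurable A.
Proof. by move=> oA; exact: sub_sigma_algebra. Qed.

Lemma open_rV_boxes n (A : set 'rV[R]_n) : open A ->
  A = \bigcup_(q : 'rV[rat]_n * nat)
        [set x | ball (map_mx ratr q.1 : 'rV[R]_n) q.2.+1%:R^-1 `<=` A /\
                 forall i, `|ratr (q.1 0 i) - x 0 i| < q.2.+1%:R^-1].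
Proof.
move=> oA; apply/seteqP; split=> [x Ax|x [q _ [+ hx]]]; last first.
  by apply; split=> [|i j]; rewrite ?invr_gt0// (ord1 i) mxE; exact: hx.
have /nbhs_ballP[e /= e0 eA] : nbhs x A by exact: open_nbhs_nbhs.
pose k := Num.truncn (2 / e).
have k0 : 0 < k.+1%:R^-1 :> R by rewrite invr_gt0 ltr0n.
have ke : k.+1%:R^-1 < e / 2.
  by rewrite -[ltRHS]invf_div ltf_pV2 ?posrE ?ltr0n ?divr_gt0// truncnS_gt.
have /choice[q hq] (i : 'I_n) : exists q : rat, `|ratr q - x 0 i| < k.+1%:R^-1.
  have [|q] := @rat_in_itvoo R (x 0 i - k.+1%:R^-1) (x 0 i + k.+1%:R^-1).
    by rewrite ltrD2l gtrN.
  by rewrite in_itv/= => qx; exists q; rewrite ltr_distl.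
exists (\row_i q i, k) => //; split => [y [_ hy]|i]; last by rewrite mxE.
apply: eA; split => // i j; rewrite (ord1 i) /ball/=.
rewrite [e]splitr -(subrKA (ratr (q j))).
rewrite (le_lt_trans (ler_normD _ _))// ltrD//.
  by rewrite distrC (lt_trans (hq _)).
by move: (hy 0 j); rewrite !mxE /ball/= => /lt_trans; exact.
Qed.

Lemma measurable_fun_rV d (T : measurableType d) n (f : T -> 'rV[R]_n) :
  (forall i, measurable_fun setT (fun t => f t 0 i)) -> measurable_fun setT f.
Proof.
move=> mf; apply: (measurability (@open 'rV[R]_n)) => //.
move=> _ [A oA <-]; rewrite setTI (open_rV_boxes oA) preimage_bigcup.
apply: countable_bigcupT_measurable => // q.
have [qA|qA] := pselect (ball (map_mx ratr q.1 : 'rV[R]_n) q.2.+1%:R^-1 `<=` A);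
    last first.
  by rewrite (_ : _ @^-1` _ = set0)// -subset0 => t [].
rewrite (_ : _ @^-1` _ = \bigcap_(i : 'I_n)
    [set t | `|ratr (q.1 0 i) - f t 0 i| < q.2.+1%:R^-1]); last first.
  by apply/seteqP; split=> [t [_ h] i _|t h]; [exact: h|split=> // i; exact: h].
apply: fin_bigcap_measurable => // i _.
rewrite (_ : [set t | _] = (fun t => f t 0 i) @^-1`
    `](ratr (q.1 0 i) - q.2.+1%:R^-1), (ratr (q.1 0 i) + q.2.+1%:R^-1)[%classic).
  by rewrite -[X in measurable X]setTI; exact: mf.
by apply/seteqP; split=> t /=; rewrite in_itv/= distrC ltr_distl.
Qed.

Definition cons_rV n (p : measurableTypeR R * 'rV[R]_n) : 'rV[R]_n.+1 :=
  row_mx (p.1 : R)%:M p.2.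

Lemma measurable_coord_rV n (i : 'I_n) :
  measurable_fun setT (fun x : 'rV[R]_n => x 0 i).
Proof.
apply: (measurability _ (RGenOpens.measurableE R)) => //.
move=> _ [_ [x [y ->]] <-]; rewrite setTI; apply: open_rV_measurable.
apply: open_comp => [z _|]; last exact: interval_open.
exact: coord_continuous.
Qed.

Lemma measurable_cons_rV n : measurable_fun setT (@cons_rV n).
Proof.
apply: measurable_fun_rV => i; rewrite /cons_rV.
case: (split_ordP (i : 'I_(1 + n))) => j ->.
  rewrite (_ : (fun t => _) = fst); first exact: measurable_fst.
  by apply/funext => t; rewrite [LHS]row_mxEl (ord1 j) mxE eqxx.
rewrite (_ : (fun t => _) = (fun x : 'rV[R]_n => x 0 j) \o snd).
  by apply: measurableT_comp; [exact: measurable_coord_rV|exact: measurable_snd].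
by apply/funext => t; rewrite [LHS]row_mxEr.
Qed.

Section step.
Variables (n : nat) (m : {sigma_finite_measure set 'rV[R]_n -> \bar R}).

Definition lebesgue_rVS : set 'rV[R]_n.+1 -> \bar R :=
  pushforward (lebesgue_measure \x m)%E (@cons_rV n).

HB.instance Definition _ := Measure.copy lebesgue_rVS
  (@measure_function_pushforward__canonical__measure_function_Measure
     _ _ _ _ _ (lebesgue_measure \x m)%E _ (@measurable_cons_rV n)).

Let lebesgue_rVS_sigma_finite : sigma_finite setT lebesgue_rVS.
Proof.
pose g (x : 'rV[R]_n.+1) : measurableTypeR R * 'rV[R]_n :=
  (x 0 0, rsubmx (x : 'rV[R]_(1 + n))).
have mg : measurable_fun setT g.
  apply/measurable_fun_pairP; split; first exact: measurable_coord_rV.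
  apply: measurable_fun_rV => i.
  rewrite (_ : (fun t => _) = fun x : 'rV[R]_n.+1 => x 0 (rshift 1 i)).
    exact: measurable_coord_rV.
  by apply/funext => x; rewrite mxE.
have gK : cancel (@cons_rV n) g.
  move=> [x y]; rewrite /g /cons_rV row_mxKr; congr (_, _).
  have e : cons_rV (x, y) 0 (lshift n (0 : 'I_1)) = x by rewrite [LHS]row_mxEl mxE eqxx.
  by rewrite -[RHS]e; congr (cons_rV _ _ _); exact/val_inj.
have /sigma_finiteP[F [TF ndF Foo]] := sigma_finiteT (@lebesgue_measure R).
have /sigma_finiteP[G [TG ndG Goo]] := sigma_finiteT m.
exists (fun k => g @^-1` (F k `*` G k)).
  rewrite -preimage_bigcup (_ : \bigcup_k _ = setT) ?preimage_setT//.
  rewrite -setXTT TF TG; apply/seteqP; split=> [x [k _ [Fx Gx]]|x].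
    by split; exists k.
  move=> [[i _ Fx] [j _ Gx]]; exists (maxn i j) => //; split.
    by move: Fx; exact/subsetPset/ndF/leq_maxl.
  by move: Gx; exact/subsetPset/ndG/leq_maxr.
move=> k; have [mF Fk] := Foo k; have [mG Gk] := Goo k; split.
  by rewrite -[X in measurable X]setTI; apply: mg => //; exact: measurableX.
rewrite /lebesgue_rVS /pushforward -comp_preimage.
rewrite (_ : g \o _ = id); last by apply/funext => x; exact: gK.
by rewrite preimage_id product_measure1E// lte_mul_pinfty// ge0_fin_numE.
Qed.

HB.instance Definition _ := Measure_isSigmaFinite.Build _ _ _ lebesgue_rVS
  lebesgue_rVS_sigma_finite.

End step.

Fixpoint lebesgue_rV n : {sigma_finite_measure set 'rV[R]_n -> \bar R} :=
  match n with
  | 0 => \d_(0 : 'rV[R]_0)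
  | n'.+1 => lebesgue_rVS (lebesgue_rV n')
  end.

End lebesgue_rV.

Section euclidean.
Variables (R : realType) (n : nat).
Implicit Types x y : 'rV[R]_n.

Definition dotrV x y : R := \sum_(i < n) x 0 i * y 0 i.

(* The library norm `|x| on 'rV[R]_n is the sup norm. *)
Definition enorm x : R := Num.sqrt (dotrV x x).

Definition unit_ball_volume : R :=
  fine (lebesgue_rV R n [set x : 'rV[R]_n | enorm x < 1]).

End euclidean.

Section fractional_laplacian.
Variables (R : realType) (n : nat).
Implicit Types (phi : 'rV[R]_n -> R) (U : 'rV[R]_n -> \bar R).

Local Notation leb := (lebesgue_rV R n).

Definition partial_derive (i : 'I_n) phi : 'rV[R]_n -> R :=
  fun x => 'D_(delta_mx 0 i) phi x.

Definition smooth phi := forall (s : seq 'I_n) (x : 'rV[R]_n),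
  differentiable (foldr partial_derive phi s) x.

Definition test_function phi :=
  smooth phi /\ compact (closure [set x | phi x != 0]).

(* Real and imaginary parts of the Fourier transform
   \int phi(y) exp(- i y.xi) dy of a real-valued function. *)
Definition fourier_re phi (xi : 'rV[R]_n) : R :=
  \int[leb]_y (phi y * cos (dotrV y xi)).

Definition fourier_im phi (xi : 'rV[R]_n) : R :=
  - \int[leb]_y (phi y * sin (dotrV y xi)).

(* Inverse Fourier transform of |xi|^(2 s) times the Fourier transform of phi;
   for real phi, only the real part of the integrand contributes. *)
Definition fractional_laplacian (s : R) phi (x : 'rV[R]_n) : R :=
  (2 * pi) ^- n *
  \int[leb]_xi (enorm xi `^ (2 * s) *
    (fourier_re phi xi * cos (dotrV x xi) -
     fourier_im phi xi * sin (dotrV x xi))).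

(* (- Laplacian)^s U is the Dirac mass at 0 in the sense of distributions;
   (- Laplacian)^s is symmetric. *)
Definition fractional_laplacian_eq_dirac0 (s : R) U :=
  forall phi, test_function phi ->
    (\int[leb]_x (U x * (fractional_laplacian s phi x)%:E) = (phi 0)%:E)%E.

End fractional_laplacian.

Section kernels.
Variables (R : realType) (n : nat).

Definition newtonian (x : 'rV[R]_n) : \bar R :=
  if x == 0 then +oo%E
  else if n == 2%N then ((2 * pi)^-1 * ln (enorm x)^-1)%:E
  else ((n%:R * (n%:R - 2) * unit_ball_volume R n)^-1 *
        enorm x `^ (2 - n%:R))%:E.

Definition riesz (c s : R) (x : 'rV[R]_n) : \bar R :=
  if x == 0 then +oo%E else (c * enorm x `^ (- (n%:R - 2 * s)))%:E.

(* The constant c_{n,s} is the one for which the Riesz kernel is the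
   fundamental solution of (- Laplacian)^s. *)
Definition is_riesz_fundamental_solution (s : R) (U : 'rV[R]_n -> \bar R) :=
  exists2 c : R, 0 < c & U = riesz c s /\ fractional_laplacian_eq_dirac0 s U.

Definition quadratic_plus (K : R) (U : 'rV[R]_n -> \bar R) (x : 'rV[R]_n) :=
  ((K * enorm x ^+ 2)%:E + U x)%E.

End kernels.

Section energy.
Variables (R : realType) (n : nat).
Local Notation Pr := (probability 'rV[R]_n R).
Implicit Types (mu nu : Pr) (W : 'rV[R]_n -> \bar R).

Definition finite_second_moment mu :=
  (\int[mu]_x (enorm x ^+ 2)%:E < +oo)%E.

Definition energy W mu : \bar R :=
  ((2^-1)%:E * \int[mu]_y \int[mu]_x W (x - y)%R)%E.

Definition coupling mu nu (P : probability ('rV[R]_n * 'rV[R]_n)%type R) :=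
  (forall A, measurable A -> P (A `*` setT) = mu A) /\
  (forall B, measurable B -> P (setT `*` B) = nu B).

Definition wasserstein2 mu nu : \bar R :=
  (ereal_inf [set \int[P]_z (enorm (z.1 - z.2) ^+ 2)%:E | P in coupling mu nu]
     `^ 2^-1)%E.

Definition d2_local_minimizer W mu :=
  (energy W mu < +oo)%E /\
  exists2 e : R, 0 < e & forall nu : Pr,
    (wasserstein2 mu nu < e%:E -> energy W mu <= energy W nu)%E.

Definition global_minimizer_P2 W mu := forall nu : Pr,
  finite_second_moment nu -> (energy W mu <= energy W nu)%E.

Definition is_translate mu nu := exists a : 'rV[R]_n,
  forall A, measurable A -> nu A = pushforward mu (fun x => x + a) A.

Definition measure_support mu : set 'rV[R]_n :=
  [set x | forall A, open A -> A x -> (0 < mu A)%E].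

Definition center_of_mass mu : 'rV[R]_n := \row_i \int[mu]_x x 0 i.

Definition radially_symmetric_about (m : 'rV[R]_n) mu :=
  forall Q : 'M[R]_n, Q *m Q^T = 1%:M ->
  forall A, measurable A ->
    pushforward mu (fun x => m + (x - m) *m Q) A = mu A.

End energy.

(* Main.v *)
From HB Require Import structures.
From mathcomp Require Import all_boot all_order all_algebra.
From mathcomp Require Import all_classical all_reals all_analysis.
From mathcomp Require Import measurable_realfun ring lra zify.
Require Import Defs.

Set Implicit Arguments.
Unset Strict Implicit.
Unset Printing Implicit Defensive.

Import Order.TTheory GRing.Theory Num.Theory.
Import numFieldNormedType.Exports.

Local Open Scope classical_set_scope.
Local Open Scope ring_scope.

(* Up to an affine function of |z|^2, the kernel W(z) is a superposition
   \int w(u) exp(- e^u |z|^2) du of Gaussians with w > 0: for the powers of |z|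
   this is the integral representation of the Gamma function, for the logarithm
   it is a Frullani integral. A Gaussian is a convolution square, so the Gaussian
   energy of mu - nu is the squared L^2 norm of the difference of the Gaussian
   potentials, and these potentials, for all widths, determine the measure.
   Hence E is strictly convex along the segment joining two measures with the
   same center of mass (the affine part of W cancels there). This gives the
   uniqueness of minimizers and, since the segment is d_2-continuous at its
   endpoints, the global minimality of d_2-local minimizers.

   For existence, a measure on a cube is the law of Phi(q), with Phi a
   space-filling curve and q a monotone function on ]0, 1[. By Helly's theorem
   and Fatou's lemma E has a minimizer on every cube. The Euler-Lagrange
   inequality and the coercivity of W bound the diameter of the support of this
   minimizer independently of the cube, and a translation brings all of them into
   one fixed cube; truncation then shows that the minimizer on that cube is global. *)

(** Energies may be infinite, and [W] is non-negative only as a whole, so terms cannot be subtracted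
    freely. Strict convexity is therefore an identity in the extended reals, 2 I(mu, nu) + D = I(mu,
    mu) + I(nu, nu) with D >= 0, where I is [mutual W]; first and second variations are read off
    from it. Exchanging the integral over u with those over the points needs a non-negative
    integrand. For powers of |z| this is automatic. For the logarithm the Frullani integrand has the
    sign of 1 - |z|^2; since exp(- e^u rho) is convex in rho, subtracting its tangent line at rho =
    1 makes it non-negative, at the price of an affine function of |z|^2. This is where the affine
    coefficients in [mix_dens] come from. The space-filling curve realizes all measures on a cube as
    laws of random variables on one fixed probability space. Almost everywhere convergence of these
    variables then replaces weak convergence, and lower semicontinuity of the energy is Fatou's
    lemma applied to each of the two integrals. *)

Section probability_builders.
Context {d} {T : measurableType d} {R : realType}.
Local Open Scope ereal_scope.

(** [mnormalize] turns any measure into a probability, falling back on [P0] for total mass 0 or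
    infinity; at total mass 1 it changes nothing. *)
Lemma probability_of_measure (m : {measure set T -> \bar R}) (P0 : probability T R) :
  m setT = 1 -> exists P : probability T R, forall A, P A = m A.
Proof.
move=> m1; exists (mnormalize m P0) => A.
by rewrite /= /mnormalize m1 onee_eq0/= invr1 mule1.
Qed.

Lemma probability_map {d'} {T' : measurableType d'} (f : T -> T')
    (mu : probability T R) : measurable_fun setT f ->
  exists P : probability T' R,
    (forall A, P A = mu (f @^-1` A)) /\
    (forall g, measurable_fun setT g -> (forall x, 0 <= g x) ->
       \int[P]_x g x = \int[mu]_x g (f x)).
Proof.
move=> mf; pose X : {mfun T >-> T'} := HB.pack f (isMeasurableFun.Build _ _ _ _ f mf).
exists (distribution mu X); split => // g mg g0.
by rewrite /distribution (ge0_integral_pushforward mf) ?preimage_setT//.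
Qed.

Lemma probability_mix (l : R) (mu nu : probability T R) : (0 <= l <= 1)%R ->
  exists P : probability T R,
    (forall A, P A = (1 - l)%:E * mu A + l%:E * nu A) /\
    (forall g, measurable_fun setT g -> (forall x, 0 <= g x) ->
       \int[P]_x g x = (1 - l)%:E * \int[mu]_x g x + l%:E * \int[nu]_x g x).
Proof.
move=> /andP[l0 l1].
have l1' : (0 <= 1 - l)%R by rewrite subr_ge0.
pose m := measure_add (mscale (NngNum l1') mu) (mscale (NngNum l0) nu).
have mE A : m A = (1 - l)%:E * mu A + l%:E * nu A.
  by rewrite /m measure_addE.
have [|P PE] := @probability_of_measure m mu.
  by rewrite -[LHS]/(m setT) mE !probability_setT !mule1 -EFinD subrK.
exists P; split => [A|g mg g0]; first by rewrite PE -mE.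
rewrite (eq_measure_integral m) => [|A _ _]; last exact: PE.
by rewrite ge0_integral_measure_add// !ge0_integral_mscale.
Qed.

Lemma ge0_integral_mrestr (mu : {measure set T -> \bar R}) (A : set T)
    (mA : measurable A) (g : T -> \bar R) :
  measurable_fun setT g -> (forall x, 0 <= g x) ->
  \int[mrestr mu mA]_x g x = \int[mu]_(x in A) g x.
Proof.
move=> mg g0.
rewrite -(setUv A) ge0_integral_setU//=; last 3 first.
- exact: measurableC.
- by rewrite setUv.
- by rewrite disj_set2E setICr.
rewrite (eq_measure_integral mu) => [|B mB BA]; last by rewrite -[LHS]/(mu (B `&` A)) setIidl.
rewrite [X in _ + X](eq_measure_integral mzero) => [|B mB BA].
  by rewrite integral_measure_zero adde0.
rewrite -[LHS]/(mu (B `&` A)) (_ : B `&` A = set0) ?measure0//.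
exact/disjoints_subset.
Qed.

Lemma probability_restr (mu : probability T R) (A : set T) :
  measurable A -> 0 < mu A ->
  exists P : probability T R,
    (forall B, P B = ((fine (mu A))^-1)%:E * mu (B `&` A)) /\
    (forall g, measurable_fun setT g -> (forall x, 0 <= g x) ->
       \int[P]_x g x = ((fine (mu A))^-1)%:E * \int[mu]_(x in A) g x).
Proof.
move=> mA A0.
have fA : mu A \is a fin_num by exact: fin_num_measure.
have i0 : (0 <= (fine (mu A))^-1)%R by rewrite invr_ge0 fine_ge0.
pose m := mscale (NngNum i0) (mrestr mu mA).
have [|P PE] := @probability_of_measure m mu.
  rewrite -[LHS]/(((fine (mu A))^-1)%:E * mu (setT `&` A)) setTI -{2}(fineK fA) -EFinM mulVf//.
  by rewrite gt_eqF// fine_gt0// A0 -ge0_fin_numE.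
exists P; split => [B|g mg g0]; first by rewrite PE.
rewrite (eq_measure_integral m) => [|B _ _]; last exact: PE.
by rewrite ge0_integral_mscale// ge0_integral_mrestr.
Qed.

End probability_builders.

(** * Measurability and Euclidean geometry of row vectors *)

Section rV_measurability.
Context {R : realType} {n : nat}.
Local Notation V := 'rV[R]_n.

Lemma measurable_fun_coord d (T : measurableType d) (f : T -> V) (i : 'I_n) :
  measurable_fun setT f -> measurable_fun setT (fun t => f t 0 i).
Proof.
by move=> mf; apply: (measurableT_comp (measurable_coord_rV i)).
Qed.

Lemma measurable_funB_rV d (T : measurableType d) (f g : T -> V) :
  measurable_fun setT f -> measurable_fun setT g ->
  measurable_fun setT (fun t => f t - g t).
Proof.
move=> mf mg; apply: measurable_fun_rV => i.
under eq_fun do rewrite !mxE.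
by apply: measurable_funB; apply: measurable_fun_coord.
Qed.

Lemma measurable_funD_rV d (T : measurableType d) (f g : T -> V) :
  measurable_fun setT f -> measurable_fun setT g ->
  measurable_fun setT (fun t => f t + g t).
Proof.
move=> mf mg; apply: measurable_fun_rV => i.
under eq_fun do rewrite !mxE.
by apply: measurable_funD; apply: measurable_fun_coord.
Qed.

Lemma measurable_fun_mulmx d (T : measurableType d) (f : T -> V) (Q : 'M[R]_n) :
  measurable_fun setT f -> measurable_fun setT (fun t => f t *m Q).
Proof.
move=> mf; apply: measurable_fun_rV => i.
under eq_fun do rewrite !mxE.
apply: measurable_sum => j.
by apply: measurable_funM => //; exact: measurable_fun_coord.
Qed.

Lemma measurable_subrV :
  measurable_fun setT (fun z : V * V => z.1 - z.2).
Proof. by apply: measurable_funB_rV. Qed.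

Lemma measurable_dotrV : measurable_fun setT (fun z : V => dotrV z z).
Proof.
rewrite /dotrV; apply: measurable_sum => i.
by apply: measurable_funM; apply: measurable_fun_coord.
Qed.

Lemma dotrV_ge0 (x : V) : 0 <= dotrV x x.
Proof. by apply: sumr_ge0 => i _; rewrite -expr2 sqr_ge0. Qed.

Lemma enorm_sqr (x : V) : enorm x ^+ 2 = dotrV x x.
Proof. by rewrite sqr_sqrtr// dotrV_ge0. Qed.

Lemma enorm_ge0 (x : V) : 0 <= enorm x.
Proof. exact: sqrtr_ge0. Qed.

Lemma measurable_enorm : measurable_fun setT (@enorm R n).
Proof.
apply: (measurableT_comp _ measurable_dotrV).
by apply: continuous_measurable_fun; exact: sqrt_continuous.
Qed.

Lemma dotrV_eq0 (x : V) : (dotrV x x == 0) = (x == 0).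
Proof.
apply/idP/eqP => [|->]; last by rewrite /dotrV big1// => i _; rewrite mxE mul0r.
rewrite psumr_eq0 => [/allP h|i _]; last by rewrite -expr2 sqr_ge0.
apply/rowP => i; rewrite mxE; apply/eqP.
by have := h i (mem_index_enum _); rewrite -expr2 sqrf_eq0.
Qed.

Lemma dotrVN (x : V) : dotrV (- x) (- x) = dotrV x x.
Proof. by apply: eq_bigr => i _; rewrite mxE mulrNN. Qed.

Lemma dotrV_mulmx (x : V) (Q : 'M[R]_n) : Q *m Q^T = 1%:M ->
  dotrV (x *m Q) (x *m Q) = dotrV x x.
Proof.
have dE (y : V) : dotrV y y = (y *m y^T) 0 0.
  by rewrite mxE; apply: eq_bigr => i _; rewrite mxE.
by move=> QQ; rewrite !dE trmx_mul mulmxA -(mulmxA x) QQ mulmx1.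
Qed.

Lemma coord_le_enorm (x : V) i : `|x 0 i| <= enorm x.
Proof.
rewrite -(ler_pXn2r (n := 2))// ?nnegrE ?enorm_ge0// enorm_sqr real_normK ?num_real//.
by rewrite /dotrV (bigD1 i)//= -expr2 lerDl sumr_ge0// => j _; rewrite -expr2 sqr_ge0.
Qed.

End rV_measurability.

Section product.
Context {R : realType}.
Local Notation leb := (@lebesgue_measure R).

Lemma cons_rV0 n (p : measurableTypeR R * 'rV[R]_n) : cons_rV p 0 ord0 = p.1.
Proof.
rewrite /cons_rV (_ : ord0 = lshift n (0 : 'I_1)); last exact: val_inj.
by rewrite [LHS]row_mxEl mxE.
Qed.

Lemma cons_rV_lift n (p : measurableTypeR R * 'rV[R]_n) (i : 'I_n) :
  cons_rV p 0 (lift ord0 i) = p.2 0 i.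
Proof.
rewrite /cons_rV (_ : lift ord0 i = rshift 1 i); last exact: val_inj.
by rewrite [LHS]row_mxEr.
Qed.

Local Open Scope ereal_scope.

Lemma measurable_prod_coord n (f : 'I_n -> R -> \bar R) :
  (forall i, measurable_fun setT (f i)) ->
  measurable_fun setT (fun z : 'rV[R]_n => \prod_(i < n) f i (z 0%R i)).
Proof.
move=> mf.
(* Replacing the enumeration of the indices by an arbitrary list makes list induction possible. *)
have [r rE] : exists r, r = index_enum 'I_n by exists (index_enum 'I_n).
rewrite -rE {rE}; elim: r => [|i r IH].
  by under eq_fun do rewrite big_nil; exact: measurable_cst.
under eq_fun do rewrite big_cons; apply: emeasurable_funM => //.
by apply: (measurableT_comp (mf i)); exact: measurable_coord_rV.
Qed.

(** [lebesgue_rV] is built by adding one coordinate at a time, so Tonelli splits off the first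
    factor and induction does the rest. The recursive construction is unfolded only here. *)
Lemma integral_lebesgue_rV_prod n (f : 'I_n -> R -> \bar R) :
  (forall i, measurable_fun setT (f i)) -> (forall i x, 0 <= f i x) ->
  \int[lebesgue_rV R n]_z \prod_(i < n) f i (z 0%R i) =
  \prod_(i < n) \int[leb]_x f i x.
Proof.
elim: n f => [|n IH] f mf f0.
  rewrite big_ord0; under eq_integral do rewrite big_ord0.
  by rewrite integral_cst//= diracT mule1.
rewrite /= /lebesgue_rVS (ge0_integral_pushforward (@measurable_cons_rV R n))//; last 2 first.
  exact: measurable_prod_coord.
  by move=> x _; exact: prode_ge0.
rewrite preimage_setT.
under eq_integral => p _.
  rewrite /= big_ord_recl cons_rV0.
  under eq_bigr do rewrite cons_rV_lift.
  over.
rewrite fubini_tonelli1 /=; last 2 first.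
- apply: emeasurable_funM.
    exact: (measurableT_comp (mf ord0) measurable_fst).
  exact: (measurableT_comp (measurable_prod_coord
    (fun i => mf (lift ord0 i))) measurable_snd).
- by move=> p; rewrite mule_ge0//; exact: prode_ge0.
rewrite /fubini_F/=.
under eq_integral => x _.
  rewrite ge0_integralZl//; last 2 first.
    exact: (measurable_prod_coord (fun i => mf (lift ord0 i))).
    by move=> z _; exact: prode_ge0.
  rewrite (IH (fun i => f (lift ord0 i)))//.
  over.
rewrite ge0_integralZr// ?big_ord_recl//.
  exact: mf.
by apply: prode_ge0 => i _; exact: integral_ge0.
Qed.

End product.

(** * Gaussian energies *)

Section gauss_kernel.
Context {R : realType}.
Local Notation leb := (@lebesgue_measure R).

Definition gauss1 (a u : R) : R := expR (- (a * u ^+ 2)).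

Lemma gauss1_ge0 a u : 0 <= gauss1 a u. Proof. exact: expR_ge0. Qed.

Lemma measurable_gauss1 a : measurable_fun setT (gauss1 a).
Proof.
apply: measurableT_comp => //; apply: measurableT_comp => //.
apply: measurable_funM => //; exact: measurable_funX.
Qed.

Lemma integral_gauss1 (a m : R) : 0 < a ->
  (\int[leb]_z (gauss1 a (m - z))%:E = (Num.sqrt (pi / a))%:E)%E.
Proof.
(* With variance 1 / (2 a) the normal density, of total mass 1, is [gauss1 a] up to its peak
   value. *)
move=> a0; pose s := Num.sqrt (a *+ 2)^-1.
have s2 : s ^+ 2 = (a *+ 2)^-1 by rewrite sqr_sqrtr// invr_ge0 mulrn_wge0// ltW.
have s0 : s != 0 by rewrite gt_eqF// sqrtr_gt0 invr_gt0 mulrn_wgt0.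
have p0 : 0 < normal_peak s by exact: normal_peak_gt0.
have E z : normal_pdf m s z = normal_peak s * gauss1 a (m - z).
  rewrite normal_pdfE//; congr (_ * _); congr expR.
  by rewrite s2 -sqrrN opprB; field; rewrite lt0r_neq0.
have := integral_normal_pdf m s.
under eq_integral do rewrite E EFinM.
rewrite ge0_integralZl//; last 3 first.
- apply/measurable_EFinP; apply: measurableT_comp; first exact: measurable_gauss1.
  exact: measurable_funB.
- by move=> z _; rewrite lee_fin gauss1_ge0.
- by rewrite lee_fin ltW.
move=> h.
have -> : Num.sqrt (pi / a) = (normal_peak s)^-1.
  by rewrite /normal_peak invrK s2; congr Num.sqrt; field; rewrite lt0r_neq0.
rewrite -[RHS]mule1 -h muleA -EFinM mulVf ?mul1e//.
by rewrite lt0r_neq0.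
Qed.

(** Half of the exponent pays for the decay in [d]; the other half remains as an integrable
    Gaussian. *)
Lemma gauss1_tail (a d u : R) : 0 < a -> 0 <= d -> d <= `|u| ->
  gauss1 a u <= expR (- (a * d ^+ 2 / 2)) * gauss1 (a / 2) u.
Proof.
move=> a0 d0 du; rewrite /gauss1 -expRD ler_expR.
have : d ^+ 2 <= u ^+ 2 by rewrite -[leRHS]real_normK ?num_real// ler_pXn2r// nnegrE.
nra.
Qed.

End gauss_kernel.

Section gauss_rV.
Context {R : realType} {n : nat}.
Local Notation V := 'rV[R]_n.
Local Notation leb := (lebesgue_rV R n).
Implicit Types mu nu : probability V R.

Definition gaussV (t : R) (x : V) : R := expR (- (t * dotrV x x)).

Lemma gaussV_prod t x : gaussV t x = \prod_(i < n) gauss1 t (x 0 i).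
Proof.
rewrite /gaussV /gauss1 /dotrV mulr_sumr -sumrN expR_sum.
by apply: eq_bigr => i _; rewrite expr2.
Qed.

Lemma gaussV_ge0 t x : 0 <= gaussV t x. Proof. exact: expR_ge0. Qed.

Lemma gaussV_le1 t x : 0 <= t -> gaussV t x <= 1.
Proof. by move=> t0; rewrite -expR0 ler_expR oppr_le0 mulr_ge0// dotrV_ge0. Qed.

Lemma measurable_gaussV t : measurable_fun setT (gaussV t).
Proof.
apply: measurableT_comp => //; apply: measurableT_comp => //.
by apply: measurable_funM => //; exact: measurable_dotrV.
Qed.

Lemma measurable_gaussV_sub t : measurable_fun setT
  (fun z : V * V => (gaussV t (z.1 - z.2))%:E).
Proof.
apply/measurable_EFinP; apply: (measurableT_comp (measurable_gaussV t)).
exact: measurable_subrV.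
Qed.

Lemma integral_prod_itv t (A : 'I_n -> set R) (x : V) :
  (forall i, measurable (A i)) ->
  (\int[leb]_(z in [set z : V | forall i, A i (z 0%R i)]) (gaussV t (x - z))%:E =
   \prod_(i < n) \int[lebesgue_measure]_(v in A i) (gauss1 t (x 0%R i - v))%:E)%E.
Proof.
move=> mA.
rewrite integral_mkcond.
transitivity (\int[leb]_z \prod_(i < n)
    (((fun v => (gauss1 t (x 0%R i - v))%:E) \_ (A i)) (z 0%R i)))%E.
  apply: eq_integral => z _; rewrite patchE; case: ifPn => [|zA].
    rewrite inE => /= zA; rewrite gaussV_prod -prodEFin; apply: eq_bigr => i _.
    by rewrite patchE mem_set// !mxE.
  have [i iA] : exists i, ~ A i (z 0 i).
    by apply/existsNP => h; move/negP: zA; apply; rewrite inE.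
  rewrite (bigD1 i)//= patchE memNset ?mul0e//.
rewrite (@integral_lebesgue_rV_prod R n
    (fun i => (fun v => (gauss1 t (x 0%R i - v))%:E) \_ (A i))); last 2 first.
- move=> i; apply/(measurable_restrictT _ (mA i)).
  apply: measurable_funTS; apply/measurable_EFinP.
  by apply: (measurableT_comp (measurable_gauss1 t)); exact: measurable_funB.
- move=> i v; rewrite patchE; case: ifP => // _.
  by rewrite lee_fin gauss1_ge0.
by apply: eq_bigr => i _; rewrite -integral_mkcond.
Qed.

Lemma integral_gaussV t (x : V) : 0 < t ->
  (\int[leb]_z (gaussV t (x - z))%:E = (Num.sqrt (pi / t) ^+ n)%:E)%E.
Proof.
move=> t0; have := @integral_prod_itv t (fun=> setT) x (fun=> measurableT).
rewrite (_ : [set z | _] = setT); last by apply/seteqP; split.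
move=> ->; under eq_bigr do rewrite integral_gauss1//.
by rewrite prodEFin prodr_const card_ord.
Qed.

(** Parallelogram identity: 2 |x - z|^2 + 2 |y - z|^2 = |x - y|^2 + 4 |(x + y) / 2 - z|^2.
    Integrating in z leaves a constant times [gaussV t (x - y)]. *)
Lemma gaussVM t (x y z : V) :
  gaussV (2 * t) (x - z) * gaussV (2 * t) (y - z) =
  gaussV t (x - y) * gaussV (4 * t) (2^-1 *: (x + y) - z).
Proof.
rewrite /gaussV -!expRD; congr expR.
rewrite -!opprD; congr (- _); rewrite /dotrV !mulr_sumr -!big_split/=.
by apply: eq_bigr => i _; rewrite !mxE; field.
Qed.

End gauss_rV.

Section gauss_potential.
Context {R : realType} {n : nat}.
Local Notation V := 'rV[R]_n.
Local Notation leb := (lebesgue_rV R n).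
Implicit Types mu nu : probability V R.
Local Open Scope ereal_scope.

(** The parameter is [2 * t] because two Gaussians of parameter [2 * t] convolve to a multiple of
    the one of parameter [t]. *)
Definition gauss_potential t mu (z : V) : \bar R :=
  \int[mu]_x (gaussV (2 * t) (x - z))%:E.

Definition gauss_energy t mu nu : \bar R :=
  \int[mu]_y \int[nu]_x (gaussV t (x - y))%:E.

(** The integral of [gaussV (4 * t)], the factor that [gaussVM] leaves after integration in z. *)
Definition gauss_cst (t : R) : R := Num.sqrt (pi / (4 * t)) ^+ n.

Lemma gauss_cst_gt0 t : (0 < t)%R -> (0 < gauss_cst t)%R.
Proof.
by move=> t0; rewrite exprn_gt0// sqrtr_gt0 divr_gt0 ?pi_gt0// mulr_gt0.
Qed.

Lemma gauss_potential_ge0 t mu z : 0 <= gauss_potential t mu z.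
Proof. by apply: integral_ge0 => x _; rewrite lee_fin gaussV_ge0. Qed.

Lemma gauss_potential_le1 t mu z : (0 <= t)%R -> gauss_potential t mu z <= 1.
Proof.
move=> t0; rewrite -[leRHS](@probability_setT _ _ _ mu) -[leRHS]mul1e -integral_cst//.
apply: ge0_le_integral => //=.
- by move=> x _; rewrite lee_fin gaussV_ge0.
- apply/measurable_EFinP; apply: (measurableT_comp (measurable_gaussV _)).
  exact: measurable_funB_rV.
- by move=> x _; rewrite lee_fin gaussV_le1// mulr_ge0.
Qed.

Lemma gauss_potential_fin t mu z : (0 <= t)%R ->
  gauss_potential t mu z \is a fin_num.
Proof.
move=> t0; rewrite ge0_fin_numE ?gauss_potential_ge0//.
by rewrite (le_lt_trans (gauss_potential_le1 _ _ t0))// ltry.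
Qed.

Lemma gauss_energy_ge0 t mu nu : 0 <= gauss_energy t mu nu.
Proof.
by apply: integral_ge0 => y _; apply: integral_ge0 => x _; rewrite lee_fin gaussV_ge0.
Qed.

Lemma measurable_gauss_potential t mu : measurable_fun setT (gauss_potential t mu).
Proof.
apply: (measurable_fun_fubini_tonelli_F (m2 := mu)
  (fun p : V * V => (gaussV (2 * t) (p.2 - p.1))%:E)).
  apply/measurable_EFinP; apply: (measurableT_comp (measurable_gaussV _)).
  exact: measurable_funB_rV.
by move=> p; rewrite lee_fin gaussV_ge0.
Qed.

Lemma gauss_energy_potential t mu nu :
  gauss_energy t mu nu = \int[mu]_y gauss_potential (t / 2)%R nu y.
Proof. by apply: eq_integral => y _; rewrite /gauss_potential mulrC divfK. Qed.

Lemma gauss_energy_le1 t mu nu : (0 <= t)%R -> gauss_energy t mu nu <= 1.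
Proof.
move=> t0; rewrite -[leRHS](@probability_setT _ _ _ mu) -[leRHS]mul1e -integral_cst//.
rewrite gauss_energy_potential.
apply: ge0_le_integral => //=.
- by move=> y _; rewrite gauss_potential_ge0.
- exact: measurable_gauss_potential.
- by move=> y _; rewrite gauss_potential_le1// divr_ge0.
Qed.

Lemma gauss_energy_fin t mu nu : (0 <= t)%R -> gauss_energy t mu nu \is a fin_num.
Proof.
move=> t0; rewrite ge0_fin_numE ?gauss_energy_ge0//.
by rewrite (le_lt_trans (gauss_energy_le1 _ _ t0))// ltry.
Qed.

(* Gaussians reproduce under convolution, so the interaction energy of a
   Gaussian kernel is an L^2 inner product of potentials. *)
Lemma gauss_energyE t mu nu : (0 < t)%R ->
  (gauss_cst t)%:E * gauss_energy t mu nu =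
  \int[leb]_z (gauss_potential t mu z * gauss_potential t nu z).
Proof.
move=> t0; have t0' : (0 <= t)%R by exact: ltW.
have mg (x : V) : measurable_fun setT (fun z : V => (gaussV (2 * t) (x - z))%:E).
  apply/measurable_EFinP; apply: (measurableT_comp (measurable_gaussV _)).
  exact: measurable_funB_rV.
have mg' (z : V) : measurable_fun setT (fun x : V => (gaussV (2 * t) (x - z))%:E).
  apply/measurable_EFinP; apply: (measurableT_comp (measurable_gaussV _)).
  exact: measurable_funB_rV.
have g0 x : 0 <= (gaussV (2 * t) (x : V))%:E by rewrite lee_fin gaussV_ge0.
have c0 := ltW (gauss_cst_gt0 t0).
have E1 (y : V) : (gauss_cst t)%:E * \int[nu]_x (gaussV t (x - y))%:E =
    \int[leb]_z ((gaussV (2 * t) (y - z))%:E * gauss_potential t nu z).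
  rewrite -ge0_integralZl//; last 2 first.
  - apply/measurable_EFinP; apply: (measurableT_comp (measurable_gaussV _)).
    exact: measurable_funB_rV.
  - by move=> x _; rewrite lee_fin gaussV_ge0.
  transitivity (\int[nu]_x \int[leb]_z
      ((gaussV (2 * t) (x - z))%:E * (gaussV (2 * t) (y - z))%:E)).
    apply: eq_integral => x _.
    under [RHS]eq_integral do rewrite -EFinM gaussVM EFinM.
    rewrite ge0_integralZl//; last 3 first.
    - apply/measurable_EFinP; apply: (measurableT_comp (measurable_gaussV _)).
      exact: measurable_funB_rV.
    - by move=> z _; rewrite lee_fin gaussV_ge0.
    - by rewrite lee_fin gaussV_ge0.
    by rewrite integral_gaussV ?mulr_gt0// muleC.
  rewrite (fubini_tonelli (m1 := nu) (m2 := leb) (fun p : V * V =>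
    (gaussV (2 * t) (p.1 - p.2))%:E * (gaussV (2 * t) (y - p.2))%:E)); last 2 first.
  - apply: emeasurable_funM; apply/measurable_EFinP;
    apply: (measurableT_comp (measurable_gaussV _)); exact: measurable_funB_rV.
  - by move=> p; rewrite mule_ge0.
  apply: eq_integral => z _ /=.
  by rewrite ge0_integralZr// muleC.
rewrite gauss_energy_potential -ge0_integralZl//; last 2 first.
- exact: measurable_gauss_potential.
- by move=> y _; exact: gauss_potential_ge0.
transitivity (\int[mu]_y \int[leb]_z
    ((gaussV (2 * t) (y - z))%:E * gauss_potential t nu z)).
  by apply: eq_integral => y _; rewrite -E1 /gauss_potential mulrC divfK.
rewrite (fubini_tonelli (m1 := mu) (m2 := leb) (fun p : V * V =>
    (gaussV (2 * t) (p.1 - p.2))%:E * gauss_potential t nu p.2)); last 2 first.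
- apply: emeasurable_funM.
    apply/measurable_EFinP; apply: (measurableT_comp (measurable_gaussV _)).
    exact: measurable_funB_rV.
  exact: (measurableT_comp (measurable_gauss_potential t nu) measurable_snd).
- by move=> p; rewrite mule_ge0 ?gauss_potential_ge0.
apply: eq_integral => z _ /=; rewrite ge0_integralZr//.
exact: gauss_potential_ge0.
Qed.

(** The squared L^2 distance of the potentials, normalized as in [gauss_energyE]. For t >= 0 the
    potentials are at most 1, so [fine] loses nothing. *)
Definition gauss_defect t mu nu : \bar R := ((gauss_cst t)^-1)%:E *
  \int[leb]_z ((fine (gauss_potential t mu z) - fine (gauss_potential t nu z)) ^+ 2)%:E.

Lemma gauss_defect_ge0 t mu nu : (0 < t)%R -> 0 <= gauss_defect t mu nu.
Proof.
move=> t0; apply: mule_ge0.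
  by rewrite lee_fin invr_ge0 ltW// gauss_cst_gt0.
by apply: integral_ge0 => z _; rewrite lee_fin sqr_ge0.
Qed.

(** The integrated square of a difference, expanded with the cross term moved to the left, so that
    every integral is of a non-negative function. *)
Lemma gauss_energy_sum t mu nu : (0 < t)%R ->
  2%:E * gauss_energy t mu nu + gauss_defect t mu nu =
  gauss_energy t mu mu + gauss_energy t nu nu.
Proof.
move=> t0; have t0' : (0 <= t)%R by exact: ltW.
have c0 := gauss_cst_gt0 t0.
have mP m : measurable_fun setT (fine \o gauss_potential t m).
  by apply: measurableT_comp => //; exact: measurable_gauss_potential.
pose P m := fine \o gauss_potential t m.
have PE m z : gauss_potential t m z = (P m z)%:E by rewrite fineK ?gauss_potential_fin.
have P0 m z : (0 <= P m z)%R by rewrite fine_ge0 ?gauss_potential_ge0.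
have EE m m' : gauss_energy t m m' =
    ((gauss_cst t)^-1)%:E * \int[leb]_z (P m z * P m' z)%:E.
  under eq_integral do rewrite EFinM -!PE.
  by rewrite -gauss_energyE// muleA -EFinM mulVf ?mul1e// gt_eqF.
rewrite !EE /gauss_defect -/(P mu) -/(P nu) muleCA.
have I0 m m' : 0 <= \int[leb]_z (P m z * P m' z)%:E.
  by apply: integral_ge0 => z _; rewrite lee_fin mulr_ge0.
have D0 : 0 <= \int[leb]_z ((P mu z - P nu z) ^+ 2)%:E.
  by apply: integral_ge0 => z _; rewrite lee_fin sqr_ge0.
rewrite -!ge0_muleDr// ?mule_ge0//.
congr (_ * _).
rewrite -ge0_integralZl//; last 2 first.
- by apply/measurable_EFinP; apply: measurable_funM; exact: mP.
- by move=> z _; rewrite lee_fin mulr_ge0.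
rewrite -!ge0_integralD//=.
- apply: eq_integral => z _ /=; rewrite -!EFinM -!EFinD; congr EFin; rewrite /P/=; ring.
all: try by [move=> z _; rewrite lee_fin ?mulr_ge0 ?sqr_ge0|
  move=> z _; rewrite -EFinM lee_fin ?mulr_ge0 ?sqr_ge0].
all: try (apply: emeasurable_funM => //).
all: try apply/measurable_EFinP.
all: try (by apply: measurable_funM; exact: mP).
- by move=> z _; rewrite lee_fin sqr_ge0.
- by apply: measurable_funX; apply: measurable_funB; exact: mP.
Qed.

Lemma gauss_defect_eq0 t mu nu : (0 < t)%R -> gauss_defect t mu nu = 0 ->
  {ae leb, forall z, gauss_potential t mu z = gauss_potential t nu z}.
Proof.
move=> t0 /eqP; have t0' : (0 <= t)%R by exact: ltW.
rewrite mule_eq0 eqe invr_eq0 gt_eqF ?gauss_cst_gt0//= => /eqP h.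
have mP m : measurable_fun setT (fine \o gauss_potential t m).
  by apply: measurableT_comp => //; exact: measurable_gauss_potential.
pose g z := (((fine \o gauss_potential t mu) z - (fine \o gauss_potential t nu) z) ^+ 2)%:E.
have mg : measurable_fun setT g.
  by apply/measurable_EFinP; apply: measurable_funX; apply: measurable_funB; exact: mP.
have : \int[leb]_z `|g z| = 0.
  by rewrite -[RHS]h; apply: eq_integral => z _; rewrite gee0_abs// lee_fin sqr_ge0.
move=> /(ae_eq_integral_abs leb measurableT mg).
apply: filterS => z /(_ Logic.I) /eqP.
rewrite eqe sqrf_eq0 subr_eq0 => /eqP/= e.
by rewrite -(fineK (gauss_potential_fin mu z t0')) e fineK// gauss_potential_fin.
Qed.

End gauss_potential.

(** * Open boxes as a generating pi-system *)

Section open_boxes.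
Context {R : realType} {n : nat}.
Local Notation V := 'rV[R]_n.

Definition obox (a b : V) : set V := [set x | forall i, a 0 i < x 0 i < b 0 i].

Lemma measurable_coordwise (A : 'I_n -> set R) : (forall i, measurable (A i)) ->
  measurable [set x : V | forall i, A i (x 0 i)].
Proof.
move=> mA; rewrite (_ : [set x | _] =
    \bigcap_(i : 'I_n) ((fun x : V => x 0 i) @^-1` A i)).
  apply: fin_bigcap_measurable => // i _.
  by rewrite -[X in measurable X]setTI; exact: measurable_coord_rV.
by apply/seteqP; split => [x xA i _|x xA i]; [exact: xA|exact: xA].
Qed.

Lemma oboxE a b : obox a b = [set x | forall i, `](a 0 i), (b 0 i)[%classic (x 0 i)].
Proof. by apply/seteqP; split => x /= h i; have := h i; rewrite in_itv/=. Qed.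

Lemma measurable_obox a b : measurable (obox a b).
Proof.
rewrite oboxE.
exact: (measurable_coordwise (A := fun i => `](a 0 i), (b 0 i)[%classic)).
Qed.

Lemma oboxI : setI_closed [set A | exists a b, A = obox a b].
Proof.
move=> _ _ [a [b ->]] [a' [b' ->]].
exists (\row_i Num.max (a 0 i) (a' 0 i)), (\row_i Num.min (b 0 i) (b' 0 i)).
apply/seteqP; split => x.
  move=> [h h'] i; rewrite !mxE gt_max lt_min.
  by have /andP[-> ->] := h i; have /andP[-> ->] := h' i.
move=> h; split => i; have := h i; rewrite !mxE gt_max lt_min.
  by move=> /andP[/andP[-> _] /andP[-> _]].
by move=> /andP[/andP[_ ->] /andP[_ ->]].
Qed.

Lemma obox_generate : @measurable _ V = <<s [set A | exists a b, A = obox a b] >>.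
Proof.
apply/seteqP; split; last first.
  apply: smallest_sub; first by split=> // [A|]; [exact: measurableD|exact: bigcupT_measurable].
  by move=> _ [a [b ->]]; exact: measurable_obox.
apply: smallest_sub; first exact: smallest_sigma_algebra.
move=> A oA; rewrite (open_rV_boxes oA).
have [s0 sC sU] := smallest_sigma_algebra setT [set A : set V | exists a b, A = obox a b].
set F := (X in \bigcup_q X q).
(* The centers are rational, so the union is countable: it is indexed by the codes of the pairs, and
   a number that codes nothing contributes the empty set. *)
rewrite (_ : \bigcup_q F q = \bigcup_k (if unpickle k is Some q then F q else set0)).
  apply: sU => k; case: (unpickle k) => [q|//].
  have [C|nC] := pselect (ball (map_mx ratr q.1 : V) q.2.+1%:R^-1 `<=` A); last first.
    by rewrite (_ : F q = set0)//; apply/seteqP; split => // x [].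
  apply: sub_sigma_algebra.
  exists (map_mx ratr q.1 - const_mx q.2.+1%:R^-1), (map_mx ratr q.1 + const_mx q.2.+1%:R^-1).
  apply/seteqP; split => x.
    by move=> [_ h] i; have := h i; rewrite !mxE distrC ltr_distl.
  move=> h; split => // i; have := h i; rewrite !mxE distrC ltr_distl//.
apply/seteqP; split => x [q _ Fx].
  by exists (pickle q) => //; rewrite pickleK.
by move: Fx; case: (unpickle q) => [p|//] Fx; exists p.
Qed.

Lemma probability_eq_obox (mu nu : probability V R) :
  (forall a b, mu (obox a b) = nu (obox a b)) ->
  forall A, measurable A -> mu A = nu A.
Proof.
move=> h A mA.
apply: (measure_unique [set A | exists a b, A = obox a b]
  (fun k => obox (const_mx (- k%:R)) (const_mx k%:R))) => //.
- exact: obox_generate.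
- exact: oboxI.
- by move=> k; exists (const_mx (- k%:R)), (const_mx k%:R).
- apply/seteqP; split => // x _.
  exists (Num.truncn (enorm x)).+1 => // i; rewrite !mxE -ltr_norml.
  by rewrite (le_lt_trans (coord_le_enorm x i))// truncnS_gt.
- by move=> _ [a [b ->]]; exact: h.
- by move=> k; rewrite (le_lt_trans (probability_le1 _ _)) ?ltry//; exact: measurable_obox.
Qed.

(** An open box is the increasing union of the boxes shrunk by 1 / (k + 1), so continuity from below
    removes the margin [d]. *)
Lemma le_obox_shrink (mu nu : probability V R) :
  (forall d a b, 0 < d ->
    (mu (obox (a + const_mx d) (b - const_mx d)) <= nu (obox a b))%E) ->
  forall a b, (mu (obox a b) <= nu (obox a b))%E.
Proof.
move=> h a b; pose d (k : nat) : R := k.+1%:R^-1.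
pose B k := obox (a + const_mx (d k)) (b - const_mx (d k)).
have BE : obox a b = \bigcup_k B k.
  apply/seteqP; split => x; last first.
    move=> [k _ xk] i; have /andP[] := xk i; rewrite !mxE => h1 h2.
    have d0 : 0 < d k by rewrite invr_gt0.
    by rewrite (lt_trans _ h1) ?ltrDl// (lt_trans h2)// gtrDl oppr_lt0.
  move=> xab.
  have /choice[e eP] (i : 'I_n) : exists k, forall j, (k <= j)%N ->
      a 0 i + d j < x 0 i < b 0 i - d j.
    have /andP[h1 h2] := xab i.
    pose m := Num.min (x 0 i - a 0 i) (b 0 i - x 0 i).
    have m0 : 0 < m by rewrite lt_min !subr_gt0 h1.
    exists (Num.truncn m^-1) => j kj.
    have : d j < m.
      rewrite /d -[ltRHS]invrK ltf_pV2 ?posrE ?invr_gt0//.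
      by rewrite (lt_le_trans (truncnS_gt _))// ler_nat.
    by rewrite lt_min => /andP[h3 h4]; apply/andP; split; lra.
  exists (\max_i e i) => // i; rewrite !mxE; apply: eP.
  exact: leq_bigmax.
have cvgB : (mu \o B) k @[k --> \oo] --> mu (\bigcup_k B k).
  apply: nondecreasing_cvg_mu.
  - by move=> k; exact: measurable_obox.
  - by apply: bigcup_measurable => k _; exact: measurable_obox.
  - move=> k j kj; apply/subsetPset => x xk i; have /andP[] := xk i; rewrite !mxE.
    have : d j <= d k by rewrite /d lef_pV2 ?posrE// ler_nat.
    by move=> *; apply/andP; split; lra.
rewrite {1}BE; apply: (cvge_to_le cvgB).
by near=> k; apply: h; rewrite invr_gt0.
Unshelve. all: by end_near. Qed.

End open_boxes.

(** * Gaussian potentials determine the measure *)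

Section identification.
Context {R : realType}.
Local Notation leb1 := (@lebesgue_measure R).

Definition gauss_itv (s a b u : R) : \bar R :=
  (\int[leb1]_(v in `]a, b[) (gauss1 s (u - v))%:E)%E.

(** Bounds the fraction of the mass of a one-dimensional Gaussian at distance at least [d] from its
    center. The factor sqrt 2 is the ratio of the total masses for the parameters [s / 2] and
    [s]. *)
Definition gauss_err (s d : R) : R := Num.sqrt 2 * expR (- (s * d ^+ 2 / 2)).

Lemma measurable_gauss1_sub s (u : R) :
  measurable_fun setT (fun v : R => (gauss1 s (u - v))%:E).
Proof.
apply/measurable_EFinP; apply: (measurableT_comp (measurable_gauss1 s)).
exact: measurable_funB.
Qed.

Lemma integral_gauss1_tail (s d u : R) (A : set R) : 0 < s -> 0 <= d ->
  measurable A -> (forall v, A v -> d <= `|u - v|) ->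
  (\int[leb1]_(v in A) (gauss1 s (u - v))%:E <=
   (gauss_err s d * Num.sqrt (pi / s))%:E)%E.
Proof.
move=> s0 d0 mA Ad.
apply: (@le_trans _ _ (\int[leb1]_(v in A)
  ((expR (- (s * d ^+ 2 / 2)))%:E * (gauss1 (s / 2) (u - v))%:E)))%E.
  apply: ge0_le_integral => //.
  - by move=> v _; rewrite lee_fin gauss1_ge0.
  - by apply: measurable_funTS; exact: measurable_gauss1_sub.
  - apply: measurable_funTS; apply: emeasurable_funM; first exact: measurable_cst.
    exact: measurable_gauss1_sub.
  - by move=> v Av; rewrite -EFinM lee_fin gauss1_tail//; exact: Ad.
rewrite ge0_integralZl//; last 2 first.
- by apply: measurable_funTS; exact: measurable_gauss1_sub.
- by move=> v _; rewrite lee_fin gauss1_ge0.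
have -> : gauss_err s d * Num.sqrt (pi / s) =
    expR (- (s * d ^+ 2 / 2)) * Num.sqrt (pi / (s / 2)).
  rewrite /gauss_err mulrAC mulrC; congr (_ * _).
  by rewrite -sqrtrM//; congr Num.sqrt; field; rewrite lt0r_neq0.
rewrite EFinM lee_wpmul2l ?lee_fin ?expR_ge0// -(integral_gauss1 u)//; last by rewrite divr_gt0.
apply: ge0_subset_integral => //; first exact: measurable_gauss1_sub.
by move=> v _; rewrite lee_fin gauss1_ge0.
Qed.

Lemma gauss_itv_ge0 s a b u : (0 <= gauss_itv s a b u)%E.
Proof. by apply: integral_ge0 => v _; rewrite lee_fin gauss1_ge0. Qed.

Lemma gauss_itv_le s a b u : 0 < s -> (gauss_itv s a b u <= (Num.sqrt (pi / s))%:E)%E.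
Proof.
move=> s0; rewrite -(integral_gauss1 u)//.
apply: ge0_subset_integral => //; first exact: measurable_gauss1_sub.
by move=> v _; rewrite lee_fin gauss1_ge0.
Qed.

Lemma gauss_itv_out s d a b u : 0 < s -> 0 <= d -> u <= a - d \/ b + d <= u ->
  (gauss_itv s a b u <= (gauss_err s d * Num.sqrt (pi / s))%:E)%E.
Proof.
move=> s0 d0 h; apply: integral_gauss1_tail => // v /=; rewrite in_itv/= => /andP[av vb].
case: h => h; last by rewrite (le_trans _ (ler_norm _))//; lra.
by rewrite distrC (le_trans _ (ler_norm _))//; lra.
Qed.

Lemma gauss_itv_in s d a b u : 0 < s -> 0 <= d -> a + d <= u <= b - d ->
  (((1 - gauss_err s d) * Num.sqrt (pi / s))%:E <= gauss_itv s a b u)%E.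
Proof.
move=> s0 d0 /andP[au ub]; rewrite mulrBl mul1r EFinB leeBlDr//.
rewrite -{1}(integral_gauss1 u)// -(setUv `]a, b[%classic) ge0_integral_setU//; last 4 first.
- exact: measurableC.
- by rewrite setUv; exact: measurable_gauss1_sub.
- by move=> v _; rewrite lee_fin gauss1_ge0.
- by rewrite disj_set2E setICr.
rewrite leeD2l//; apply: integral_gauss1_tail => //; first exact: measurableC.
move=> v /=; rewrite in_itv/= => /negP; rewrite negb_and -!leNgt => /orP[va|bv].
  by rewrite (le_trans _ (ler_norm _))//; lra.
by rewrite distrC (le_trans _ (ler_norm _))//; lra.
Qed.

Context {n : nat}.
Local Notation V := 'rV[R]_n.
Local Notation leb := (lebesgue_rV R n).
Implicit Types mu nu : probability V R.

Definition gauss_box s (a b x : V) : \bar R :=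
  (\int[leb]_(z in obox a b) (gaussV s (x - z))%:E)%E.

Lemma gauss_boxE s a b x :
  gauss_box s a b x = (\prod_(i < n) gauss_itv s (a 0%R i) (b 0%R i) (x 0%R i))%E.
Proof.
rewrite /gauss_box oboxE.
exact: (integral_prod_itv s (A := fun i => `](a 0 i), (b 0 i)[%classic)).
Qed.

Lemma gauss_box_fin s a b x : 0 < s -> exists h : 'I_n -> R,
  gauss_box s a b x = (\prod_(i < n) h i)%:E /\
  forall i, 0 <= h i <= Num.sqrt (pi / s) /\
    (h i)%:E = gauss_itv s (a 0 i) (b 0 i) (x 0 i).
Proof.
move=> s0; exists (fun i => fine (gauss_itv s (a 0 i) (b 0 i) (x 0 i))).
have F i : gauss_itv s (a 0 i) (b 0 i) (x 0 i) \is a fin_num.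
  by rewrite ge0_fin_numE ?gauss_itv_ge0// (le_lt_trans (gauss_itv_le _ _ _ s0))// ltry.
split; first by rewrite gauss_boxE -prodEFin; apply: eq_bigr => i _; rewrite fineK.
move=> i; rewrite fineK//; split => //; apply/andP; split.
  by rewrite fine_ge0 ?gauss_itv_ge0.
by rewrite -lee_fin fineK// gauss_itv_le.
Qed.

Lemma gauss_box_ge0 s a b x : (0 <= gauss_box s a b x)%E.
Proof. by apply: integral_ge0 => z _; rewrite lee_fin gaussV_ge0. Qed.

Lemma gauss_box_le s a b x : 0 < s ->
  (gauss_box s a b x <= (Num.sqrt (pi / s) ^+ n)%:E)%E.
Proof.
move=> s0; have [h [-> hP]] := gauss_box_fin a b x s0; rewrite lee_fin.
rewrite -[X in _ ^+ X](card_ord n) -prodr_const; apply: ler_prod => i _.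
by case: (hP i).
Qed.

(** One coordinate off by [d] makes its own factor small; each other factor is at most the full
    one-dimensional integral. *)
Lemma gauss_box_out s d a b x : 0 < s -> 0 <= d ->
  ~ obox (a - const_mx d) (b + const_mx d) x ->
  (gauss_box s a b x <= (gauss_err s d * Num.sqrt (pi / s) ^+ n)%:E)%E.
Proof.
move=> s0 d0 /existsNP[i xi].
have [h [-> hP]] := gauss_box_fin a b x s0; rewrite lee_fin.
rewrite -[X in _ ^+ X](card_ord n) -prodr_const (bigD1 i)//= [in leRHS](bigD1 i)//=.
have [/andP[h0 h1] hE] := hP i.
rewrite mulrA ler_pM//.
- by apply: prodr_ge0 => j _; case: (hP j) => /andP[].
- rewrite -lee_fin hE gauss_itv_out//.
  move/negP: xi; rewrite !mxE negb_and -!leNgt => /orP[]; [by left|by right].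
- by apply: ler_prod => j _; case: (hP j).
Qed.

Lemma gauss_box_in s d a b x : 0 < s -> 0 <= d -> gauss_err s d <= 1 ->
  obox (a + const_mx d) (b - const_mx d) x ->
  (((1 - gauss_err s d) ^+ n * Num.sqrt (pi / s) ^+ n)%:E <= gauss_box s a b x)%E.
Proof.
move=> s0 d0 e1 xi.
have [h [-> hP]] := gauss_box_fin a b x s0; rewrite lee_fin.
rewrite -exprMn -[X in _ ^+ X](card_ord n) -prodr_const; apply: ler_prod => i _.
rewrite mulr_ge0 ?subr_ge0//= -lee_fin (hP i).2 gauss_itv_in//.
by have := xi i; rewrite !mxE => /andP[? ?]; apply/andP; split; exact: ltW.
Qed.

Lemma measurable_indic_snd (a b : V) :
  measurable_fun setT (fun p : V * V => (\1_(obox a b) p.2 : R)%:E).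
Proof.
have m1 : measurable_fun setT (\1_(obox a b) : V -> R).
  by apply: measurable_indic; exact: measurable_obox.
by apply/measurable_EFinP; exact: (measurableT_comp m1 measurable_snd).
Qed.

Lemma measurable_gauss_box s a b : measurable_fun setT (gauss_box s a b).
Proof.
rewrite (_ : gauss_box s a b = fun x : V => (\int[leb]_z
   ((gaussV s (x - z))%:E * (\1_(obox a b) z)%:E))%E); last first.
  apply/funext => x; rewrite /gauss_box integral_mkcond; apply: eq_integral => z _.
  by rewrite patchE indicE; case: ifPn => zab; rewrite ?mule1 ?mule0.
apply: (measurable_fun_fubini_tonelli_F (m2 := leb)
  (fun p : V * V => ((gaussV s (p.1 - p.2))%:E * (\1_(obox a b) p.2)%:E)%E)).
  apply: emeasurable_funM; first exact: measurable_gaussV_sub.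
  exact: measurable_indic_snd.
by move=> p; rewrite mule_ge0// lee_fin gaussV_ge0.
Qed.

Lemma integral_gauss_box t a b mu :
  (\int[mu]_x gauss_box (2 * t) a b x =
   \int[leb]_(z in obox a b) gauss_potential t mu z)%E.
Proof.
have mab : measurable (obox a b) by exact: measurable_obox.
transitivity (\int[mu]_x \int[leb]_z
   ((gaussV (2 * t) (x - z))%:E * (\1_(obox a b) z)%:E))%E.
  apply: eq_integral => x _; rewrite /gauss_box integral_mkcond; apply: eq_integral => z _.
  by rewrite patchE indicE; case: ifPn => zab; rewrite ?mule1 ?mule0.
rewrite (fubini_tonelli (m1 := mu) (m2 := leb)
  (fun p : V * V => ((gaussV (2 * t) (p.1 - p.2))%:E * (\1_(obox a b) p.2)%:E)%E)); last 2 first.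
- apply: emeasurable_funM; first exact: measurable_gaussV_sub.
  exact: measurable_indic_snd.
- by move=> p; rewrite mule_ge0// lee_fin gaussV_ge0.
rewrite [RHS]integral_mkcond; apply: eq_integral => z _ /=.
rewrite ge0_integralZr//.
- by rewrite patchE indicE; case: ifPn => zab; rewrite ?mule1 ?mule0.
- apply/measurable_EFinP; apply: (measurableT_comp (measurable_gaussV _)).
  exact: measurable_funB_rV.
- by move=> x _; rewrite lee_fin gaussV_ge0.
Qed.

Lemma gauss_err_small (e d : R) : 0 < e -> 0 < d ->
  exists2 M, 0 < M & forall s, M <= s -> gauss_err s d <= e.
Proof.
(* From exp x >= 1 + x and sqrt 2 <= 2 it suffices that 2 <= e (1 + s d^2 / 2), which holds once s e
   d^2 >= 4. *)
move=> e0 d0; exists (4 / (e * d ^+ 2)); first by rewrite divr_gt0// mulr_gt0// exprn_gt0.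
move=> s Ms.
have s0 : 0 < s by rewrite (lt_le_trans _ Ms)// divr_gt0// mulr_gt0// exprn_gt0.
have d2 : 0 < d ^+ 2 by rewrite exprn_gt0.
have sd : 0 < s * d ^+ 2 / 2 by rewrite divr_gt0// mulr_gt0.
have h4 : 4 <= s * (e * d ^+ 2) by rewrite -ler_pdivrMr// mulr_gt0.
rewrite /gauss_err expRN ler_pdivrMr ?expR_gt0//.
have s2 : Num.sqrt 2 <= 2 :> R.
  by rewrite -[leRHS]ger0_norm// -sqrtr_sqr ler_sqrt ?exprn_ge0//; lra.
apply: (le_trans s2); apply: (@le_trans _ _ (e * (1 + s * d ^+ 2 / 2))).
  rewrite (_ : e * _ = e + s * (e * d ^+ 2) / 2); last by field.
  by move: (s * _) h4 => p ?; lra.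
by rewrite ler_pM2l// expR_ge1Dx.
Qed.

Lemma bernoulli_inequality m (k : R) : 0 < k -> k <= 1 -> 1 - m%:R * k <= (1 - k) ^+ m.
Proof.
move=> k0 k1; elim: m => [|m IH]; first by rewrite mul0r subr0 expr0.
rewrite exprS -natr1; apply: (@le_trans _ _ ((1 - k) * (1 - m%:R * k))).
  rewrite -subr_ge0 (_ : _ - _ = m%:R * k ^+ 2); last by ring.
  by rewrite mulr_ge0// sqr_ge0.
by rewrite ler_wpM2l// subr_ge0.
Qed.

(* The integral of the potential over a box is, up to a normalization, the
   measure of the box, with an error that vanishes with the width of the
   Gaussian. *)
Lemma gauss_potential_inj mu nu :
  (forall M, exists t, [/\ M <= t, 0 < t & {ae leb, forall z,
     gauss_potential t mu z = gauss_potential t nu z}]) ->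
  forall A, measurable A -> mu A = nu A.
Proof.
move=> H.
suff W (m m' : probability V R) : (forall M, exists t, [/\ M <= t, 0 < t & {ae leb, forall z,
     gauss_potential t m z = gauss_potential t m' z}]) ->
    forall a b, (m (obox a b) <= m' (obox a b))%E.
  apply: probability_eq_obox => a b; apply/eqP; rewrite eq_le W//= W// => M.
  have [t [? ? h]] := H M; exists t; split => //.
  by apply: filterS h => z ->.
move=> {mu nu H} H; apply: le_obox_shrink => d a b d0.
(* Half of the margin separates the inner box from an intermediate one, the other half the
   intermediate box from the outer one; the potentials are integrated over the intermediate box. *)
pose e := d / 2; have e0 : 0 < e by rewrite divr_gt0.
rewrite -(_ : (a + const_mx e) + const_mx e = a + const_mx d); last first.
  by apply/rowP => i; rewrite !mxE /e; lra.
rewrite -(_ : (b - const_mx e) - const_mx e = b - const_mx d); last first.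
  by apply/rowP => i; rewrite !mxE /e; lra.
rewrite -{2}(_ : (a + const_mx e) - const_mx e = a); last by rewrite addrK.
rewrite -{2}(_ : (b - const_mx e) + const_mx e = b); last by rewrite subrK.
clearbody e.
move: (a + const_mx e) (b - const_mx e) => {d0 d}{}a {}b.
set Bi := obox (a + _) _; set Bo := obox (a - _) _.
have mBi : measurable Bi by exact: measurable_obox.
have mBo : measurable Bo by exact: measurable_obox.
have main (k : R) : 0 < k -> k <= 1 -> (1 - k) ^+ n * fine (m Bi) <= fine (m' Bo) + k.
  move=> k0 k1; have [M M0 HM] := gauss_err_small k0 e0.
  have [t [Mt t0 hae]] := H M.
  pose s := 2 * t.
  have s0 : 0 < s by rewrite mulr_gt0.
  have es : gauss_err s e <= k by apply: HM; rewrite /s; lra.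
  pose c := Num.sqrt (pi / s) ^+ n.
  have c0 : 0 < c by rewrite exprn_gt0// sqrtr_gt0 divr_gt0// pi_gt0.
  have E : (\int[m]_x gauss_box s a b x = \int[m']_x gauss_box s a b x)%E.
    rewrite !integral_gauss_box; apply: ge0_ae_eq_integral.
    - exact: measurable_obox.
    - by apply: measurable_funTS; exact: measurable_gauss_potential.
    - by apply: measurable_funTS; exact: measurable_gauss_potential.
    - by move=> z _; exact: gauss_potential_ge0.
    - by move=> z _; exact: gauss_potential_ge0.
    - by apply: filterS hae => z -> .
  have h1 : (((1 - k) ^+ n * c)%:E * m Bi <= \int[m]_x gauss_box s a b x)%E.
    apply: (@le_trans _ _ (\int[m]_(x in Bi) gauss_box s a b x)%E); last first.
      apply: ge0_subset_integral => //; first exact: measurable_gauss_box.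
      by move=> x _; exact: gauss_box_ge0.
    rewrite -integral_cst//; apply: ge0_le_integral => //.
    - by move=> x _; rewrite lee_fin mulr_ge0 ?exprn_ge0 ?subr_ge0// ltW.
    - by apply: measurable_funTS; exact: measurable_gauss_box.
    - move=> x xB; apply: le_trans (gauss_box_in s0 (ltW e0) (le_trans es k1) xB).
      rewrite lee_fin ler_pM2r//; apply: lerXn2r; rewrite ?nnegrE ?subr_ge0//.
        exact: le_trans es k1.
      lra.
  have h2 : (\int[m']_x gauss_box s a b x <= c%:E * m' Bo + (k * c)%:E)%E.
    rewrite -(setUv Bo) ge0_integral_setU//; last 4 first.
    - exact: measurableC.
    - by rewrite setUv; exact: measurable_gauss_box.
    - by move=> x _; exact: gauss_box_ge0.
    - by rewrite disj_set2E setICr.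
    apply: leeD.
      rewrite -integral_cst//; apply: ge0_le_integral => //.
      - by move=> x _; exact: gauss_box_ge0.
      - by apply: measurable_funTS; exact: measurable_gauss_box.
      - by move=> x _; exact: gauss_box_le.
    have mC : measurable (~` Bo) by exact: measurableC.
    apply: (@le_trans _ _ ((k * c)%:E * m' (~` Bo))%E); last first.
      rewrite -[leRHS]mule1 lee_wpmul2l ?probability_le1// lee_fin mulr_ge0// ltW//.
    rewrite -integral_cst//; apply: ge0_le_integral => //.
    - by move=> x _; exact: gauss_box_ge0.
    - by apply: measurable_funTS; exact: measurable_gauss_box.
    - move=> x xB; apply: (le_trans (gauss_box_out s0 (ltW e0) xB)).
      by rewrite lee_fin ler_pM2r.
  rewrite E in h1; have := le_trans h1 h2.
  rewrite -(fineK (fin_num_measure m _ mBi)) -(fineK (fin_num_measure m' _ mBo)).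
  rewrite -!EFinM -EFinD lee_fin.
  rewrite mulrAC (mulrC c) -mulrDl ler_pM2r//.
rewrite -(fineK (fin_num_measure m _ mBi)) -(fineK (fin_num_measure m' _ mBo)) lee_fin.
have mi1 : fine (m Bi) <= 1 by rewrite -lee_fin fineK ?fin_num_measure// probability_le1.
have mi0 : 0 <= fine (m Bi) by rewrite fine_ge0.
apply/ler_addgt0Pr => q q0.
(* The total error is at most (n + 1) k: n k is lost in (1 - k)^n by Bernoulli's inequality, and k
   comes from the Gaussian tails outside the outer box. *)
pose k := Num.min 1 (q / n.+1%:R).
have k0 : 0 < k by rewrite lt_min ltr01 divr_gt0.
have k1 : k <= 1 by rewrite ge_min lexx.
have kq : n.+1%:R * k <= q by rewrite mulrC -ler_pdivlMr// ge_min lexx orbT.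
apply: (@le_trans _ _ (fine (m' Bo) + n.+1%:R * k)); last by rewrite lerD2l.
have := main k k0 k1; have := bernoulli_inequality n k0 k1.
rewrite -natr1; move: ((1 - k) ^+ n) (n%:R) (ler0n R n) => p N N0 h1 h2.
have h3 : (1 - p) * fine (m Bi) <= N * k * fine (m Bi) by rewrite ler_wpM2r//; lra.
have h4 : N * k * fine (m Bi) <= N * k by rewrite ler_piMr// mulr_ge0// ltW.
by move: h2 h3; rewrite mulrBl; lra.
Qed.

End identification.

(** * Mixtures of Gaussians *)

Section quadratic_moments.
Context {R : realType} {n : nat}.
Local Notation V := 'rV[R]_n.
Implicit Types mu nu : probability V R.

Definition moment2 mu : R := \int[mu]_x dotrV x x.

Lemma dotrVC (x y : V) : dotrV x y = dotrV y x.
Proof. by apply: eq_bigr => i _; rewrite mulrC. Qed.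

Lemma dotrV_scale (x y : V) (a : R) : dotrV (a *: x) y = a * dotrV x y.
Proof. by rewrite mulr_sumr; apply: eq_bigr => i _; rewrite mxE mulrA. Qed.

Lemma dotrVBB (x y : V) :
  dotrV (x - y) (x - y) = dotrV x x + dotrV (- 2 *: y) x + dotrV y y.
Proof.
rewrite /dotrV -!big_split/=; apply: eq_bigr => i _; rewrite !mxE; ring.
Qed.

Lemma integrable_dotrV mu : finite_second_moment mu ->
  mu.-integrable setT (fun x => (dotrV x x)%:E).
Proof.
move=> h; apply/integrableP; split.
  by apply/measurable_EFinP; exact: measurable_dotrV.
apply: le_lt_trans h; rewrite le_eqVlt; apply/orP; left; apply/eqP.
by apply: eq_integral => x _; rewrite enorm_sqr gee0_abs// lee_fin dotrV_ge0.
Qed.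

Lemma integrable_coord mu i : finite_second_moment mu ->
  mu.-integrable setT (fun x : V => (x 0 i)%:E).
Proof.
move=> h; apply: (@le_integrable _ _ _ mu _ _ _ (fun x : V => (1 + dotrV x x)%:E)) => //.
- by apply/measurable_EFinP; exact: measurable_coord_rV.
- move=> x _; rewrite lee_fin [leRHS]ger0_norm ?addr_ge0 ?dotrV_ge0//.
  have := coord_le_enorm x i; have := enorm_sqr x.
  move: (enorm x) (`|x 0 i|) (dotrV x x) => a b c <- ba.
  by have := sqr_ge0 (a - 1); nra.
- under eq_fun do rewrite EFinD.
  apply: integrableD => //; last exact: integrable_dotrV.
  exact: finite_measure_integrable_cst.
Qed.

Lemma integrable_affine mu (c : V) (c0 : R) : finite_second_moment mu ->
  mu.-integrable setT (fun x : V => (dotrV c x + c0)%:E).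
Proof.
move=> h; under eq_fun do rewrite EFinD /dotrV -sumEFin.
apply: integrableD => //; last exact: finite_measure_integrable_cst.
apply: integrable_sum => // i _; under eq_fun do rewrite EFinM.
by apply: integrableZl => //; exact: integrable_coord.
Qed.

Lemma integral_affine mu (c : V) (c0 : R) : finite_second_moment mu ->
  (\int[mu]_x (dotrV c x + c0)%:E = (dotrV c (center_of_mass mu) + c0)%:E)%E.
Proof.
move=> h.
have i2 i : mu.-integrable setT (fun x : V => (c 0 i * x 0 i)%:E).
  by under eq_fun do rewrite EFinM; apply: integrableZl => //; exact: integrable_coord.
have i3 : mu.-integrable setT (fun x : V => (dotrV c x)%:E).
  by rewrite /dotrV; under eq_fun do rewrite -sumEFin; apply: integrable_sum.
have i0 : mu.-integrable setT (fun=> c0%:E) by exact: finite_measure_integrable_cst.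
under eq_integral do rewrite EFinD.
rewrite integralD// integral_cst// [X in (c0%:E * X)%E]probability_setT mule1 EFinD.
congr (_ + _)%E; rewrite /dotrV -sumEFin; under eq_integral do rewrite -sumEFin.
rewrite integral_sum//; apply: eq_bigr => i _.
under eq_integral do rewrite EFinM.
rewrite integralZl//; last exact: integrable_coord.
by rewrite mxE /Rintegral EFinM fineK//; apply: integrable_fin_num => //; exact: integrable_coord.
Qed.

Lemma integral_quadratic mu (c : V) (c0 : R) : finite_second_moment mu ->
  (\int[mu]_x (dotrV x x + dotrV c x + c0)%:E =
   (moment2 mu + dotrV c (center_of_mass mu) + c0)%:E)%E.
Proof.
move=> h; have i1 := integrable_dotrV h; have i2 := integrable_affine c c0 h.
under eq_integral do rewrite -addrA EFinD.
have E : (\int[mu]_x (dotrV x x)%:E = (moment2 mu)%:E)%E.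
  by rewrite /moment2 /Rintegral fineK//; exact: integrable_fin_num.
by rewrite integralD// E integral_affine// -EFinD addrA.
Qed.

(** The double integral of |x - y|^2 (see [integral_dist2]), in a closed form that makes [dist2_sum]
    plain algebra. *)
Definition dist2 mu nu : R :=
  moment2 mu + moment2 nu - 2 * dotrV (center_of_mass mu) (center_of_mass nu).

Lemma integral_dist2 mu nu : finite_second_moment mu -> finite_second_moment nu ->
  (\int[mu]_y \int[nu]_x (dotrV (x - y) (x - y))%:E = (dist2 mu nu)%:E)%E.
Proof.
move=> hmu hnu.
transitivity (\int[mu]_y (dotrV y y + dotrV (- 2 *: center_of_mass nu) y + moment2 nu)%:E)%E.
  apply: eq_integral => y _.
  under eq_integral do rewrite dotrVBB.
  rewrite integral_quadratic//; congr EFin.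
  rewrite (dotrV_scale y) (dotrV_scale (center_of_mass nu)).
  rewrite [dotrV _ (center_of_mass nu)]dotrVC; ring.
by rewrite integral_quadratic// dotrV_scale /dist2 [dotrV (center_of_mass nu) _]dotrVC; congr EFin; ring.
Qed.

Lemma dist2_sum mu nu : center_of_mass mu = center_of_mass nu ->
  2 * dist2 mu nu = dist2 mu mu + dist2 nu nu.
Proof. by rewrite /dist2 => ->; ring. Qed.

End quadratic_moments.

Section gauss_mixture.
Context {R : realType} {n : nat}.
Local Notation V := 'rV[R]_n.
Local Notation leb1 := (@lebesgue_measure R).
Implicit Types mu nu : probability V R.
Local Open Scope ereal_scope.

Definition probability_prod {d1 d2} {T1 : measurableType d1} {T2 : measurableType d2}
    (P1 : probability T1 R) (P2 : probability T2 R) :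
  probability (T1 * T2)%type R := P1 \x P2.

Definition mutual (W : V -> \bar R) mu nu : \bar R :=
  \int[mu]_y \int[nu]_x W (x - y)%R.

Lemma measurable_sub_swap (W : V -> \bar R) : measurable_fun setT W ->
  measurable_fun setT (fun z : V * V => W (z.2 - z.1)%R).
Proof. by move=> mW; apply: (measurableT_comp mW); exact: measurable_funB_rV. Qed.

Lemma mutual_prod (W : V -> \bar R) mu nu : measurable_fun setT W ->
  (forall x, 0 <= W x) ->
  mutual W mu nu = \int[mu \x nu]_z W (z.2 - z.1)%R.
Proof.
move=> mW W0; rewrite fubini_tonelli1//; exact: measurable_sub_swap.
Qed.

Lemma mutual_ge0 (W : V -> \bar R) mu nu : (forall x, 0 <= W x) -> 0 <= mutual W mu nu.
Proof. by move=> W0; apply: integral_ge0 => y _; exact: integral_ge0. Qed.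

(** [p] and [q] add, for each u, an affine function of rho that keeps the density non-negative; only
    the Gaussian part will contribute to the convexity defect. *)
Definition mix_dens (w p q : R -> R) (u rho : R) : R :=
  (w u * expR (- (expR u * rho)) + p u * rho + q u)%R.

Definition gauss_mixture (W : V -> \bar R) := exists w p q : R -> R, exists A B : R,
  [/\ measurable_fun setT w, measurable_fun setT p & measurable_fun setT q] /\
  [/\ (forall u, (0 < w u)%R), (forall u rho, (0 <= rho)%R -> (0 <= mix_dens w p q u rho)%R)
    & forall z, W z = \int[leb1]_u (mix_dens w p q u (dotrV z z))%:E +
                      (A * dotrV z z + B)%:E].

(** Adding |g| on both sides makes all integrands non-negative; its integral is finite, hence can be
    cancelled. *)
Lemma ge0_integrable_integralD d (T : measurableType d) (m : {measure set T -> \bar R})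
    (f : T -> \bar R) (g : T -> R) : measurable_fun setT f -> (forall x, 0 <= f x) ->
  m.-integrable setT (EFin \o g) -> (forall x, 0 <= f x + (g x)%:E) ->
  \int[m]_x (f x + (g x)%:E) = \int[m]_x f x + \int[m]_x (g x)%:E.
Proof.
move=> mf f0 ig fg0.
have mg : measurable_fun setT g by apply/measurable_EFinP; exact: measurable_int ig.
have mn : measurable_fun setT (fun x => `|g x|%:E).
  by apply/measurable_EFinP; exact: measurableT_comp.
have iN : m.-integrable setT (fun x => `|g x|%:E) by exact: integrable_norm.
have nf : \int[m]_x `|g x|%:E \is a fin_num by exact: integrable_fin_num.
rewrite -[LHS](addeK _ nf) -[RHS](addeK _ nf); congr (_ - _).
rewrite -[RHS]addeA -[X in _ = _ + X]integralD// -!ge0_integralD//.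
- by apply: eq_integral => x _; rewrite -addeA.
- by move=> x _; rewrite -EFinD lee_fin; have := ler_norm (- g x); rewrite normrN; lra.
- apply: emeasurable_funD => //; exact/measurable_EFinP.
- apply: emeasurable_funD => //; exact/measurable_EFinP.
Qed.

Lemma ereal_affine_shift (x y z d : \bar R) (a b c : R) :
  2%:E * z + d = x + y -> (2 * c = a + b)%R ->
  2%:E * (z + c%:E) + d = (x + a%:E) + (y + b%:E).
Proof.
move=> h hc; rewrite muleDr// ?fin_num_adde_defl// -EFinM hc addeAC h EFinD.
by rewrite addeACA.
Qed.

Section fixed.
Context (w p q : R -> R) (A B : R) (W : V -> \bar R).
Context (mw : measurable_fun setT w) (mp : measurable_fun setT p)
  (mq : measurable_fun setT q) (w0 : forall u, (0 < w u)%R)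
  (d0 : forall u rho, (0 <= rho)%R -> (0 <= mix_dens w p q u rho)%R)
  (WE : forall z, W z = \int[leb1]_u (mix_dens w p q u (dotrV z z))%:E +
                      (A * dotrV z z + B)%:E)
  (W0 : forall z, 0 <= W z).

Let rho (z : V * V) : R := dotrV (z.2 - z.1)%R (z.2 - z.1)%R.

Let mrho : measurable_fun setT rho.
Proof. by apply: (measurableT_comp measurable_dotrV); exact: measurable_funB_rV. Qed.

Let dens (u : R) (z : V * V) : \bar R := (mix_dens w p q u (rho z))%:E.

Let mdens : measurable_fun setT (fun t : (V * V) * R => dens t.2 t.1).
Proof.
apply/measurable_EFinP; apply: measurable_funD; first apply: measurable_funD.
- apply: measurable_funM; first exact: (measurableT_comp mw measurable_snd).
  apply: measurableT_comp => //; apply: measurableT_comp => //.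
  apply: measurable_funM; last exact: (measurableT_comp mrho measurable_fst).
  by apply: measurableT_comp => //; exact: measurable_snd.
- apply: measurable_funM; first exact: (measurableT_comp mp measurable_snd).
  exact: (measurableT_comp mrho measurable_fst).
- exact: (measurableT_comp mq measurable_snd).
Qed.

Let dens_ge0 u z : 0 <= dens u z.
Proof. by rewrite lee_fin d0// dotrV_ge0. Qed.

(** The integral of [mix_dens] at fixed u over the product of mu and nu, as [integral_dens]
    shows. *)
Definition mix_slice mu nu (u : R) : R :=
  (w u * fine (gauss_energy (expR u) mu nu) + p u * dist2 mu nu + q u)%R.

Let integrable_rho mu nu : finite_second_moment mu -> finite_second_moment nu ->
  (mu \x nu).-integrable setT (EFin \o rho).
Proof.
move=> hm hn; apply/integrableP; split; first exact/measurable_EFinP.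
under eq_integral do rewrite gee0_abs ?lee_fin ?dotrV_ge0//.
rewrite fubini_tonelli1//; first by rewrite /fubini_F/= integral_dist2// ltry.
  exact/measurable_EFinP.
by move=> z; rewrite lee_fin dotrV_ge0.
Qed.

Let integral_rho mu nu : finite_second_moment mu -> finite_second_moment nu ->
  \int[mu \x nu]_z (rho z)%:E = (dist2 mu nu)%:E.
Proof.
move=> hm hn; rewrite fubini_tonelli1//; first by rewrite /fubini_F/= integral_dist2.
  exact/measurable_EFinP.
by move=> z; rewrite lee_fin dotrV_ge0.
Qed.

Let prodT mu nu : (mu \x nu) setT = 1.
Proof.
rewrite -setXTT; transitivity (mu setT * nu setT); last by rewrite !probability_setT mule1.
exact: product_measure1E.
Qed.

Let integrable_cst1 mu nu (c : R) : (mu \x nu).-integrable setT (fun=> c%:E).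
Proof.
apply/integrableP; split; first exact: measurable_cst.
by rewrite integral_cst//= prodT mule1 ltry.
Qed.

Let integral_dens mu nu u : finite_second_moment mu -> finite_second_moment nu ->
  \int[mu \x nu]_z dens u z = (mix_slice mu nu u)%:E.
Proof.
move=> hm hn.
have ig : (mu \x nu).-integrable setT (fun z : V * V => (expR (- (expR u * rho z)))%:E).
  have mg : measurable_fun setT (fun z : V * V => (expR (- (expR u * rho z)))%:E).
    apply/measurable_EFinP; apply: measurableT_comp => //; apply: measurableT_comp => //.
    exact: measurable_funM.
  apply: (le_integrable _ mg _ (integrable_cst1 mu nu 1)) => // z _.
  rewrite lee_fin ger0_norm ?expR_ge0// normr1.
  by rewrite -expR0 ler_expR oppr_le0 mulr_ge0 ?expR_ge0// dotrV_ge0.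
have iw : (mu \x nu).-integrable setT (fun z : V * V => (w u * expR (- (expR u * rho z)))%:E).
  by under eq_fun do rewrite EFinM; exact: integrableZl.
have ir : (mu \x nu).-integrable setT (fun z : V * V => (p u * rho z)%:E).
  by under eq_fun do rewrite EFinM; apply: integrableZl => //; exact: integrable_rho.
rewrite /dens /mix_dens; under eq_integral do rewrite EFinD EFinD.
have ic := integrable_cst1 mu nu (q u).
rewrite integralD//; last by apply: integrableD.
rewrite integralD// integral_cst// [X in _ * X]prodT mule1 /mix_slice 2!EFinD.
congr (_ + _ + _).
  under eq_integral do rewrite EFinM.
  rewrite integralZl// EFinM; congr (_ * _).
  rewrite fineK ?gauss_energy_fin ?expR_ge0//.
  have [mg _] := integrableP _ _ _ ig.
  by rewrite (fubini_tonelli1 _ mg).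
under eq_integral do rewrite EFinM.
by rewrite integralZl ?integral_rho// integrable_rho.
Qed.

(** Non-negativity of [mix_dens] lets Tonelli exchange u with the pair of points. The affine
    remainder has no sign, but finite second moments make it integrable. *)
Lemma mutual_slice mu nu : finite_second_moment mu -> finite_second_moment nu ->
  measurable_fun setT W ->
  mutual W mu nu = \int[leb1]_u (mix_slice mu nu u)%:E + (A * dist2 mu nu + B)%:E.
Proof.
move=> hm hn mW; rewrite mutual_prod//.
have irho := integrable_rho hm hn.
have iA : (mu \x nu).-integrable setT (fun z => (A * rho z)%:E).
  by under eq_fun do rewrite EFinM; exact: integrableZl.
have ic := integrable_cst1 mu nu B.
have iAB : (mu \x nu).-integrable setT (fun z => (A * rho z + B)%:E).
  by under eq_fun do rewrite EFinD; exact: integrableD.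
transitivity (\int[mu \x nu]_z (\int[leb1]_u dens u z + (A * rho z + B)%:E)).
  by apply: eq_integral => z _; rewrite WE.
rewrite ge0_integrable_integralD//; last 3 first.
- exact: (measurable_fun_fubini_tonelli_F (m2 := leb1) (fun t : (V * V) * R => dens t.2 t.1)).
- by move=> z; apply: integral_ge0 => u _; exact: dens_ge0.
- by move=> z; rewrite -/(rho z) -WE.
congr (_ + _).
  rewrite (fubini_tonelli (m1 := probability_prod mu nu) (m2 := leb1) (fun t : (V * V) * R => dens t.2 t.1))//.
  by apply: eq_integral => u _; exact: integral_dens.
under eq_integral do rewrite EFinD.
rewrite integralD// integral_cst// [X in _ * X]prodT mule1 EFinD; congr (_ + _).
under eq_integral do rewrite EFinM.
by rewrite integralZl ?integral_rho.
Qed.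

Let measurable_slice mu nu : finite_second_moment mu -> finite_second_moment nu ->
  measurable_fun setT (mix_slice mu nu).
Proof.
move=> hm hn; apply/measurable_EFinP.
rewrite (_ : _ \o _ = fun u => \int[mu \x nu]_z dens u z); last first.
  by apply/funext => u; rewrite integral_dens.
exact: (measurable_fun_fubini_tonelli_G (m1 := probability_prod mu nu)
  (fun t : (V * V) * R => dens t.2 t.1)).
Qed.

Let slice_ge0 mu nu u : finite_second_moment mu -> finite_second_moment nu ->
  (0 <= mix_slice mu nu u)%R.
Proof.
by move=> hm hn; rewrite -lee_fin -integral_dens//; apply: integral_ge0 => z _; exact: dens_ge0.
Qed.

Lemma slice_sum mu nu u : center_of_mass mu = center_of_mass nu ->
  (2 * mix_slice mu nu u + w u * fine (gauss_defect (expR u) mu nu) =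
  mix_slice mu mu u + mix_slice nu nu u)%R /\ gauss_defect (expR u) mu nu \is a fin_num.
Proof.
move=> e; have := dist2_sum e.
have := gauss_energy_sum mu nu (expR_gt0 u).
have F (m m' : probability V R) : gauss_energy (expR u) m m' \is a fin_num by rewrite gauss_energy_fin ?expR_ge0.
rewrite -(fineK (F mu nu)) -(fineK (F mu mu)) -(fineK (F nu nu)) -EFinM -EFinD.
move: (gauss_defect _ _ _) => D h1 h2.
have fD : D \is a fin_num by move: h1; case: D.
split => //; move: h1; rewrite -(fineK fD) -EFinD => -[h1].
rewrite /mix_slice.
transitivity (w u * (2 * fine (gauss_energy (expR u) mu nu) + fine D) +
  p u * (2 * dist2 mu nu) + 2 * q u)%R; first by rewrite fineK//; ring.
by rewrite h1 h2; ring.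
Qed.

(* D is the integral over u of w(u) times the defect of the Gaussian
   exp(- e^u |z|^2). *)
Lemma mutual_sum mu nu : measurable_fun setT W ->
  finite_second_moment mu -> finite_second_moment nu ->
  center_of_mass mu = center_of_mass nu ->
  exists D, [/\ 0 <= D, 2%:E * mutual W mu nu + D = mutual W mu mu + mutual W nu nu &
    D = 0 -> forall S, measurable S -> mu S = nu S].
Proof.
move=> mW hm hn e.
pose D u := (mix_slice mu mu u + mix_slice nu nu u - 2 * mix_slice mu nu u)%R.
have DE u : D u = (w u * fine (gauss_defect (expR u) mu nu))%R.
  by rewrite /D -(slice_sum u e).1; ring.
have D0 u : (0 <= D u)%R.
  by rewrite DE mulr_ge0 ?(ltW (w0 u))// fine_ge0// gauss_defect_ge0// expR_gt0.
have mD : measurable_fun setT D.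
  apply: measurable_funB; first by apply: measurable_funD; exact: measurable_slice.
  by apply: measurable_funM => //; exact: measurable_slice.
exists (\int[leb1]_u (D u)%:E); split.
- by apply: integral_ge0 => u _; rewrite lee_fin.
- rewrite !mutual_slice//.
  have h : 2%:E * \int[leb1]_u (mix_slice mu nu u)%:E + \int[leb1]_u (D u)%:E =
      \int[leb1]_u (mix_slice mu mu u)%:E + \int[leb1]_u (mix_slice nu nu u)%:E.
    have ms (m m' : probability V R) : finite_second_moment m -> finite_second_moment m' ->
        measurable_fun setT (fun u => (mix_slice m m' u)%:E).
      by move=> *; apply/measurable_EFinP; exact: measurable_slice.
    have s0 (m m' : probability V R) : finite_second_moment m -> finite_second_moment m' ->
       forall u, 0 <= (mix_slice m m' u)%:E.
      by move=> *; rewrite lee_fin slice_ge0.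
    rewrite -ge0_integralZl//; last 2 first.
    + exact: ms.
    + by move=> u _; exact: s0.
    rewrite -!ge0_integralD//.
    + by apply: eq_integral => u _; rewrite -!EFinM -!EFinD; congr EFin; rewrite /D; ring.
    + by move=> u _; exact: s0.
    + exact: ms.
    + by move=> u _; exact: s0.
    + exact: ms.
    + by move=> u _; rewrite mule_ge0// s0.
    + by apply: emeasurable_funM => //; exact: ms.
    + by move=> u _; rewrite lee_fin.
    + exact/measurable_EFinP.
  have hd := dist2_sum e.
  by apply: ereal_affine_shift => //; rewrite mulrDr mulrCA hd; ring.
move=> ID; apply: gauss_potential_inj => M.
have aeD : {ae leb1, forall u, D u = 0%R}.
  have : \int[leb1]_u `|(D u)%:E| = 0.
    by rewrite -[RHS]ID; apply: eq_integral => u _; rewrite gee0_abs// lee_fin.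
  have mD' : measurable_fun setT (fun u => (D u)%:E) by exact/measurable_EFinP.
  move=> /(ae_eq_integral_abs leb1 measurableT mD').
  by apply: filterS => u /(_ Logic.I) [].
(* For u >= a the parameter exp u is at least M, the maximum with 1 keeping the logarithm
   meaningful. The interval from a to a + 1 has length 1, so it is not inside the null set and
   contains a u of zero defect. *)
pose a := ln (Num.max M 1)%R.
have [u [au Du]] : exists u, (a <= u)%R /\ D u = 0%R.
  apply/not_existsP => hno; case: aeD => N [mN N0 subN].
  have : leb1 `[a, (a + 1)%R] <= leb1 N.
    apply: le_measure; rewrite ?inE// => u /=; rewrite in_itv/= => /andP[au _].
    by apply: subN => /= Du; apply: (hno u).
  by rewrite N0 lebesgue_measure_itv/= lte_fin ltrDl ltr01 -EFinD addrAC subrr add0r lee_fin ler10.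
exists (expR u); split.
- apply: (@le_trans _ _ (Num.max M 1)%R); first by rewrite le_max lexx.
  rewrite -[leLHS]lnK ?ler_expR// posrE.
  by rewrite (@lt_le_trans _ _ 1%R)// le_max lexx orbT.
- exact: expR_gt0.
apply: gauss_defect_eq0; first exact: expR_gt0.
have := DE u; rewrite Du => /esym/eqP; rewrite mulf_eq0 gt_eqF ?w0//= => /eqP Dz.
by rewrite -(fineK (slice_sum u e).2) Dz.
Qed.

End fixed.

End gauss_mixture.

(** * Integral representations of powers and of the logarithm *)

Section exponential_integrals.
Context {R : realType}.
Local Notation leb1 := (@lebesgue_measure R).
Local Open Scope ereal_scope.

Lemma FTC2_is_derive (F f : R -> R) (x y : R) : (x < y)%R ->
  (forall r, (x <= r <= y)%R -> derivable F r 1%R /\ 'D_1%R F r = f r) ->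
  (forall r, (x <= r <= y)%R -> {for r, continuous f}) ->
  \int[leb1]_(r in `[x, y]) (f r)%:E = (F y - F x)%:E.
Proof.
move=> xy dF cf.
have cF r : (x <= r <= y)%R -> {for r, continuous F}.
  move=> xr; apply: differentiable_continuous; apply/derivable1_diffP.
  by have [] := dF r xr.
rewrite (continuous_FTC2 xy (F := F)) ?EFinB//.
- apply: continuous_in_subspaceT => r; rewrite inE/= in_itv/=; exact: cf.
- split.
  + move=> r; rewrite in_itv/= => /andP[xr ry].
    by have [] := dF r; first by rewrite !ltW.
  + by apply: cvg_at_right_filter; apply: cF; rewrite lexx ltW.
  + by apply: cvg_at_left_filter; apply: cF; rewrite lexx ltW.
- move=> r; rewrite in_itv/= => /andP[xr ry].
  have xr' : (x <= r <= y)%R by rewrite !ltW.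
  by rewrite derive1E (dF r xr').2.
Qed.

(** Half-open intervals determine Lebesgue measure, so it equals its image under a translation. *)
Lemma integral_lebesgue_shift (f : R -> \bar R) (c : R) :
  measurable_fun setT f -> (forall x, 0 <= f x) ->
  \int[leb1]_x f (x + c)%R = \int[leb1]_x f x.
Proof.
move=> mf f0.
have mc : measurable_fun setT ((fun x => x + c)%R : measurableTypeR R -> measurableTypeR R).
  exact: measurable_funD.
have h := ge0_integral_pushforward mc leb1 measurableT mf (fun x _ => f0 x).
rewrite preimage_setT in h; rewrite -[LHS]h.
apply: eq_measure_integral => A mA _; apply/esym.
apply: lebesgue_measure_unique => // _ [[a b]] _ <-.
rewrite -[RHS]/(leb1 ((fun x => x + c)%R @^-1` `]a, b]%classic)) (_ : _ @^-1` _ = `](a - c)%R, (b - c)%R]%classic); last first.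
  by apply/seteqP; split => x /=; rewrite !in_itv/= ltrBlDr lerBrDr.
by rewrite !lebesgue_measure_itv/= !lte_fin ltrD2r -!EFinB; case: ifP => // _; congr EFin; ring.
Qed.

Lemma integral_lebesgue_opp (f : R -> \bar R) :
  measurable_fun setT f -> (forall x, 0 <= f x) ->
  \int[leb1]_x f (- x)%R = \int[leb1]_x f x.
Proof.
move=> mf f0.
have mc : measurable_fun setT (-%R : measurableTypeR R -> measurableTypeR R).
  by [].

have h := ge0_integral_pushforward mc leb1 measurableT mf (fun x _ => f0 x).
rewrite preimage_setT in h; rewrite -[LHS]h.
by apply: eq_measure_integral => A mA _; exact: lebesgue_measureN.
Qed.

(** Up to the factor 1 / b the integrand is dominated by the exponential density plus its mirror
    image, each of total mass 1. *)
Lemma integral_exp_abs (b : R) : (0 < b)%R ->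
  \int[leb1]_u (expR (- (b * `|u|)))%:E < +oo.
Proof.
move=> b0.
pose e (u : R) := (exponential_pdf b u)%:E.
have p0 u : (0 <= exponential_pdf b u)%R by apply: exponential_pdf_ge0; exact: ltW.
have e0 u : 0 <= e u by rewrite lee_fin.
have me : measurable_fun setT e by apply/measurable_EFinP; exact: measurable_exponential_pdf.
have me' : measurable_fun setT (fun u : R => e (- u)%R) by apply: (measurableT_comp me).
apply: (@le_lt_trans _ _ (\int[leb1]_u (b^-1%:E * (e u + e (- u)%R)))).
  apply: ge0_le_integral => //.
  - apply/measurable_EFinP; apply: measurableT_comp => //; apply: measurableT_comp => //.
    by apply: measurable_funM => //; exact: measurableT_comp.
  - by apply: emeasurable_funM => //; exact: emeasurable_funD.
  - move=> u _; rewrite /e -EFinD -EFinM lee_fin [leRHS]mulrC ler_pdivlMr// [leLHS]mulrC.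
    have [u0|u0] := leP 0%R u.
      rewrite [exponential_pdf b u]exponential_pdfE//.
      by rewrite ger0_norm// mulNr ler_wpDr.
    have nu0 : (0 <= - u)%R by rewrite oppr_ge0 ltW.
    rewrite [exponential_pdf b (- u)%R]exponential_pdfE//.
    by rewrite ltr0_norm// mulNr ler_wpDl.
rewrite ge0_integralZl//; last 3 first.
- exact: emeasurable_funD.
- by move=> u _; rewrite adde_ge0.
- by rewrite lee_fin invr_ge0 ltW.
rewrite ge0_integralD// integral_lebesgue_opp// integral_exponential_pdf//.
by rewrite -EFinD -EFinM ltry.
Qed.

(** Integrand of Euler's integral for Gamma(a) after the substitution t = e^u; hence [gamma_cst a]
    is Gamma(a). *)
Definition gamma_int (a u : R) : R := (expR (a * u) * expR (- expR u))%R.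

Definition gamma_cst (a : R) : R := fine (\int[leb1]_u (gamma_int a u)%:E).

Lemma measurable_gamma_int a : measurable_fun setT (gamma_int a).
Proof.
apply: measurable_funM; apply: measurableT_comp => //.
exact: measurableT_comp.
Qed.

Lemma gamma_int_ge0 a u : (0 <= gamma_int a u)%R.
Proof. by rewrite mulr_ge0// expR_ge0. Qed.

Lemma gamma_cstE a : (0 < a)%R ->
  \int[leb1]_u (gamma_int a u)%:E = (gamma_cst a)%:E.
Proof.
move=> a0; rewrite /gamma_cst fineK// ge0_fin_numE; last first.
  by apply: integral_ge0 => u _; rewrite lee_fin gamma_int_ge0.
(* The maximum of 2 a u - e^u, reached at u = ln (2 a). For u >= 0 it gives a u - e^u <= C - a u, an
   integrable decay. *)
pose C := (2 * a * (ln (2 * a) - 1))%R.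
have me : measurable_fun setT (fun u : R => (expR (- (a * `|u|)))%:E).
  apply/measurable_EFinP; apply: measurableT_comp => //; apply: measurableT_comp => //.
  by apply: measurable_funM => //; exact: measurableT_comp.
apply: (@le_lt_trans _ _ (\int[leb1]_u ((expR (Num.max 0 C))%:E * (expR (- (a * `|u|)))%:E))).
  apply: ge0_le_integral => //.
  - by move=> u _; rewrite lee_fin gamma_int_ge0.
  - by apply/measurable_EFinP; exact: measurable_gamma_int.
  - exact: emeasurable_funM.
  - move=> u _; rewrite -EFinM lee_fin /gamma_int -!expRD ler_expR.
    have [u0|u0] := leP 0%R u; last first.
      rewrite ltr0_norm// mulrN opprK addrC lerD2r.
      by rewrite (@le_trans _ _ 0%R) ?oppr_le0 ?expR_ge0// le_max lexx.
    rewrite ger0_norm// -lerBlDr opprK.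
    apply: (@le_trans _ _ C); last by rewrite le_max lexx orbT.
    have := expR_ge1Dx (u - ln (2 * a)).
    rewrite expRB lnK ?posrE ?mulr_gt0// ler_pdivlMr ?mulr_gt0// /C => h.
    by lra.
rewrite ge0_integralZl//.
rewrite lte_mul_pinfty// ?lee_fin ?expR_ge0//; exact: integral_exp_abs.
Qed.

Lemma gamma_cst_gt0 a : (0 < a)%R -> (0 < gamma_cst a)%R.
Proof.
move=> a0; rewrite -lte_fin -gamma_cstE//.
apply: (@lt_le_trans _ _ (\int[leb1]_(u in `[0%R, 1%R]) (expR (- expR 1))%:E)).
  by rewrite integral_cst//= lebesgue_measure_itv/= lte_fin ltr01 -EFinB -EFinM lte_fin subr0 mulr1 expR_gt0.
apply: (@le_trans _ _ (\int[leb1]_(u in `[0%R, 1%R]) (gamma_int a u)%:E)).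
  apply: ge0_le_integral => //.
  - by apply: measurable_funTS; apply/measurable_EFinP; exact: measurable_gamma_int.
  - move=> u /=; rewrite in_itv/= => /andP[u0 u1].
    rewrite lee_fin /gamma_int -[leLHS]mul1r ler_pM ?expR_ge0//.
      by rewrite -expR0 ler_expR mulr_ge0// ltW.
    by rewrite ler_expR lerN2 ler_expR.
apply: ge0_subset_integral => //.
  by apply/measurable_EFinP; exact: measurable_gamma_int.
by move=> u _; rewrite lee_fin gamma_int_ge0.
Qed.

(* The translation [u |-> u - ln rho] of the variable of integration. *)
Lemma integral_gamma_scale (a rho : R) : (0 < a)%R -> (0 < rho)%R ->
  \int[leb1]_u (expR (a * u) * expR (- (expR u * rho)))%:E =
  (gamma_cst a * rho `^ (- a))%:E.
Proof.
move=> a0 r0.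
have mg : measurable_fun setT (fun u => (gamma_int a u)%:E).
  by apply/measurable_EFinP; exact: measurable_gamma_int.
have E u : (expR (a * u) * expR (- (expR u * rho)) =
    rho `^ (- a) * gamma_int a (u + ln rho))%R.
  rewrite /gamma_int /powR gt_eqF// [expR (u + _)%R]expRD lnK ?posrE// -!expRD.
  by congr expR; ring.
under eq_integral do rewrite E EFinM.
rewrite ge0_integralZl//; last 3 first.
- apply: (measurableT_comp mg); exact: measurable_funD.
- by move=> u _; rewrite lee_fin gamma_int_ge0.
- by rewrite lee_fin powR_ge0.
rewrite (integral_lebesgue_shift (f := fun u => (gamma_int a u)%:E))//; last first.
  by move=> u; rewrite lee_fin gamma_int_ge0.
by rewrite gamma_cstE// -EFinM mulrC.
Qed.

Lemma measurable_gamma_scaled (a rho : R) : measurable_fun setT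
  (fun u => (expR (a * u) * expR (- (expR u * rho)))%:E).
Proof.
apply/measurable_EFinP; apply: measurable_funM.
  by apply: measurableT_comp => //; exact: measurable_funM.
apply: measurableT_comp => //; apply: measurableT_comp => //.
by apply: measurable_funM.
Qed.

Lemma integral_gamma_scale0 (a : R) : (0 < a)%R ->
  \int[leb1]_u (expR (a * u) * expR (- (expR u * 0)))%:E = +oo.
Proof.
move=> a0; apply/eqP; rewrite -leye_eq.
apply: (@le_trans _ _ (\int[leb1]_(u in `[0%R, +oo[) 1)).
  by rewrite integral_cst//= mul1e lebesgue_measure_itv/= ltry.
apply: (@le_trans _ _ (\int[leb1]_(u in `[0%R, +oo[)
    (expR (a * u) * expR (- (expR u * 0)))%:E)).
  apply: ge0_le_integral => //.
  - apply: measurable_funTS; exact: measurable_gamma_scaled.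
  - move=> u /=; rewrite in_itv/= andbT => u0.
    by rewrite mulr0 oppr0 expR0 mulr1 lee_fin -expR0 ler_expR mulr_ge0// ltW.
apply: ge0_subset_integral => //.
- exact: measurable_gamma_scaled.
Qed.

End exponential_integrals.

Section log_integral.
Context {R : realType}.
Local Notation leb1 := (@lebesgue_measure R).
Local Open Scope ereal_scope.

Lemma measurable_expR_expR (x : R) :
  measurable_fun setT (fun u : R => expR (- (expR u * x))%R).
Proof.
apply: measurableT_comp => //; apply: measurableT_comp => //.
by apply: measurable_funM.
Qed.

Lemma frullani_slice (t x y : R) : (x < y)%R ->
  (expR (- (t * x)) - expR (- (t * y)))%:E =
  \int[leb1]_(r in `[x, y]) (t * expR (- (t * r)))%:E.
Proof.
move=> xy; rewrite (@FTC2_is_derive _ (fun r => - expR (- (t * r)))%R (fun r => t * expR (- (t * r)))%R _ _ xy)//.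
- by congr EFin; ring.
- move=> r _.
  have [] // : is_derive r 1%R (fun r => - expR (- (t * r)))%R (t * expR (- (t * r)))%R.
  by apply: is_derive_eq; rewrite /GRing.scale/=; ring.
- move=> r _; apply: cvgM; first exact: cvg_cst.
  apply: (cvg_comp _ expR); last exact: continuous_expR.
  by apply: cvgN; apply: cvgM; [exact: cvg_cst|exact: cvg_id].
Qed.

(** The difference is an integral over r between x and y. After Tonelli the inner integral over u is
    Gamma(1) / r, and 1 / r integrates to a logarithm. Gamma(1) is carried as a symbol and divided
    out in [gauss_mixture_log]. *)
Lemma frullani (x y : R) : (0 < x)%R -> (x <= y)%R ->
  \int[leb1]_u (expR (- (expR u * x)) - expR (- (expR u * y)))%:E =
  (gamma_cst 1 * (ln y - ln x))%:E :> \bar R.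
Proof.
move=> x0; rewrite le_eqVlt => /predU1P[<-|xy].
  by under eq_integral do rewrite subrr; rewrite integral0 subrr mulr0.
have mf : measurable_fun setT (fun p : R * R =>
    (expR p.1 * expR (- (expR p.1 * p.2)))%:E * (\1_(`[x, y]%classic) p.2 : R)%:E).
  apply: emeasurable_funM; apply/measurable_EFinP.
    have m1 : measurable_fun setT (fun p : R * R => expR p.1).
      by apply: measurableT_comp => //; exact: measurable_fst.
    apply: measurable_funM => //; apply: measurableT_comp => //.
    by apply: measurableT_comp => //; apply: measurable_funM => //; exact: measurable_snd.
  have m1 : measurable_fun setT (\1_(`[x, y]%classic) : R -> R) by apply: measurable_indic.
  exact: (measurableT_comp m1 measurable_snd).
transitivity (\int[leb1]_u \int[leb1]_r
    ((expR u * expR (- (expR u * r)))%:E * (\1_(`[x, y]%classic) r : R)%:E)).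
  apply: eq_integral => u _; rewrite (frullani_slice _ xy).
  rewrite integral_mkcond; apply: eq_integral => r _.
  by rewrite patchE indicE; case: ifPn => rxy; rewrite ?mule1 ?mule0.
rewrite (fubini_tonelli (m1 := leb1) (m2 := leb1) (fun p : R * R =>
  (expR p.1 * expR (- (expR p.1 * p.2)))%:E * (\1_(`[x, y]%classic) p.2 : R)%:E))//.
transitivity (\int[leb1]_(r in `[x, y]) (gamma_cst 1 * r^-1)%:E).
  rewrite [RHS]integral_mkcond; apply: eq_integral => r _ /=.
  rewrite ge0_integralZr//; last first.
    apply/measurable_EFinP; apply: measurable_funM => //.
    exact: measurable_expR_expR.
  rewrite patchE indicE; case: ifPn => rxy; rewrite ?mule1 ?mule0//.
  have r0 : (0 < r)%R.
    by move: rxy; rewrite inE/= in_itv/= => /andP[xr _]; exact: lt_le_trans xr.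
  under eq_integral => u _ do rewrite -{1}[u]mul1r.
  by rewrite integral_gamma_scale// powR_inv1// ltW.
rewrite (@FTC2_is_derive _ (fun r => gamma_cst 1 * ln r)%R (fun r => gamma_cst 1 * r^-1)%R _ _ xy)//.
- by rewrite mulrBr.
- move=> r /andP[xr _]; have r0 : (0 < r)%R by exact: lt_le_trans xr.
  have h := is_derive1_ln r0.
  have [] // : is_derive r 1%R (fun r => gamma_cst 1 * ln r)%R (gamma_cst 1 * r^-1)%R.
  by apply: is_derive_eq; rewrite /GRing.scale/= ?addr0 ?mulr0 ?add0r.
- move=> r /andP[xr _]; have r0 : (0 < r)%R by exact: lt_le_trans xr.
  by apply: cvgM; [exact: cvg_cst|apply: cvgV; [rewrite gt_eqF|exact: cvg_id]].
Qed.

(** exp(- e^u rho) minus its tangent line in rho at rho = 1, hence non-negative by convexity. *)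
Definition log_dens (u rho : R) : R :=
  (expR (- (expR u * rho)) - expR (- expR u) + expR u * (rho - 1) * expR (- expR u))%R.

Lemma log_dens_ge0 u rho : (0 <= log_dens u rho)%R.
Proof.
have -> : log_dens u rho = (expR (- expR u) *
    (expR (- (expR u * (rho - 1))) - (1 + - (expR u * (rho - 1)))))%R.
  rewrite [RHS]mulrBr -expRD (_ : - expR u + _ = - (expR u * rho))%R; last by ring.
  by rewrite /log_dens; ring.
by rewrite mulr_ge0 ?expR_ge0// subr_ge0 expR_ge1Dx.
Qed.

Lemma measurable_log_dens rho : measurable_fun setT (fun u => (log_dens u rho)%:E).
Proof.
apply/measurable_EFinP; apply: measurable_funD.
  apply: measurable_funB; first exact: measurable_expR_expR.
  by do 2 apply: measurableT_comp => //.
apply: measurable_funM; last by do 2 apply: measurableT_comp => //.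
exact: measurable_funM.
Qed.

Lemma integral_log_dens rho : (0 < rho)%R ->
  \int[leb1]_u (log_dens u rho)%:E = (gamma_cst 1 * (rho - 1 - ln rho))%:E.
Proof.
move=> r0.
have m1 : measurable_fun setT (fun u : R => (gamma_int 1 u)%:E).
  by apply/measurable_EFinP; exact: measurable_gamma_int.
have mB x y : measurable_fun setT (fun u : R => (expR (- (expR u * x)) - expR (- (expR u * y)))%:E).
  by apply/measurable_EFinP; apply: measurable_funB; exact: measurable_expR_expR.
have g0 u : 0 <= (gamma_int 1 u : R)%:E by rewrite lee_fin gamma_int_ge0.
have dec x y u : (x <= y)%R -> 0 <= (expR (- (expR u * x)) - expR (- (expR u * y)) : R)%:E.
  by move=> xy; rewrite lee_fin subr_ge0 ler_expR lerN2 ler_wpM2l// expR_ge0.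
have l0 u : 0 <= (log_dens u rho)%:E by rewrite lee_fin log_dens_ge0.
have ml := measurable_log_dens rho.
(* The Frullani integrand and the linear term both change sign at rho = 1; each case puts them on
   the sides of the identity where they are non-negative. *)
have [r1|/ltW r1] := leP rho 1%R.
  have mc : measurable_fun setT (fun u : R => (1 - rho)%:E * (gamma_int 1 u)%:E).
    exact: emeasurable_funM.
  have c0 : 0 <= (1 - rho)%:E by rewrite lee_fin subr_ge0.
  have c1 u : 0 <= (1 - rho)%:E * (gamma_int 1 u)%:E by rewrite mule_ge0.
  have : \int[leb1]_u ((log_dens u rho)%:E + (1 - rho)%:E * (gamma_int 1 u)%:E) =
      \int[leb1]_u (expR (- (expR u * rho)) - expR (- (expR u * 1)))%:E.
    apply: eq_integral => u _; rewrite -EFinM -EFinD; congr EFin.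
    by rewrite /log_dens /gamma_int mul1r mulr1; ring.
  rewrite frullani// ln1 sub0r ge0_integralD//= ge0_integralZl//.
  rewrite gamma_cstE// -EFinM => h.
  rewrite -[LHS](@addeK _ ((1 - rho) * gamma_cst 1)%:E)// h -EFinB; congr EFin; ring.
have c0 : 0 <= (rho - 1)%:E by rewrite lee_fin subr_ge0.
have d0 u := dec 1%R rho u r1.
have : \int[leb1]_u ((log_dens u rho)%:E + (expR (- (expR u * 1)) - expR (- (expR u * rho)))%:E) =
    \int[leb1]_u ((rho - 1)%:E * (gamma_int 1 u)%:E).
  apply: eq_integral => u _; rewrite -EFinM -EFinD; congr EFin.
  by rewrite /log_dens /gamma_int mul1r mulr1; ring.
rewrite ge0_integralD//; last exact: mB.
rewrite frullani// ln1 subr0 ge0_integralZl//.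
rewrite gamma_cstE// -EFinM => h.
by rewrite -[LHS](@addeK _ (gamma_cst 1 * ln rho)%:E)// h -EFinB; congr EFin; ring.
Qed.

Lemma integral_log_dens0 : \int[leb1]_u (log_dens u 0)%:E = +oo.
Proof.
apply/eqP; rewrite -leye_eq.
apply: (@le_trans _ _ (\int[leb1]_(u in `[1%R, +oo[) 4^-1%:E)).
  by rewrite integral_cst//= lebesgue_measure_itv/= ltry /= gt0_muley ?lte_fin ?invr_gt0//.
apply: (@le_trans _ _ (\int[leb1]_(u in `[1%R, +oo[) (log_dens u 0)%:E)).
  apply: ge0_le_integral => //.
  - by apply: measurable_funTS; exact: measurable_log_dens.
  - move=> u /=; rewrite in_itv/= andbT => u1; rewrite lee_fin.
    have t2 : (2 <= expR u)%R by have := expR_ge1Dx u; lra.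
    rewrite /log_dens mulr0 oppr0 expR0 sub0r.
    move: (expR u) t2 => t t2.
    have e0 := expR_gt0 t.
    (* With this bound 1 - (1 + t) e^(-t) >= 1/4 follows from 3/4 (1 + t/2)^2 >= 1 + t, which for t
       >= 2 is sharp exactly at t = 2. *)
    have h : ((1 + t / 2) ^+ 2 <= expR t)%R.
      have -> : expR t = (expR (t / 2) ^+ 2)%R by rewrite expr2 -expRD; congr expR; field.
      by apply: lerXn2r; rewrite ?nnegrE ?expR_ge0 ?expR_ge1Dx//; lra.
    rewrite expRN -subr_ge0.
    rewrite (_ : (_ - _)%R = ((3 / 4 * expR t - 1 - t) / expR t)%R); last first.
      by field; rewrite gt_eqF.
    by apply: divr_ge0; [nra|exact: ltW].
apply: ge0_subset_integral => //; first exact: measurable_log_dens.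
by move=> u _; rewrite lee_fin log_dens_ge0.
Qed.

End log_integral.

Section kernels_as_mixtures.
Context {R : realType} {n : nat}.
Local Notation V := 'rV[R]_n.
Local Notation leb1 := (@lebesgue_measure R).
Local Notation leb := (lebesgue_rV R n).
Local Open Scope ereal_scope.

(** Gamma(a) |z|^(-2 a) in Gaussian form for a > 0; the value +oo at the origin comes out of the
    integral itself. *)
Definition power_kernel (a : R) (z : V) : \bar R :=
  \int[leb1]_u (expR (a * u) * expR (- (expR u * dotrV z z)))%:E.

Lemma power_kernelE (a : R) (z : V) : (0 < a)%R ->
  power_kernel a z =
  if z == 0%R then +oo else (gamma_cst a * enorm z `^ (- (2 * a)))%:E.
Proof.
move=> a0; rewrite /power_kernel; case: ifPn => [/eqP ->|z0].
  by rewrite (_ : dotrV 0%R 0%R = 0%R) ?integral_gamma_scale0//; apply/eqP; rewrite dotrV_eq0.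
have r0 : (0 < dotrV z z)%R by rewrite lt_neqAle dotrV_ge0 eq_sym dotrV_eq0 z0.
rewrite integral_gamma_scale// -mulrN powRrM; congr (_ * _ `^ _)%:E.
by rewrite powR_mulrn ?enorm_ge0// enorm_sqr.
Qed.

Lemma power_kernel_ge0 a z : 0 <= power_kernel a z.
Proof. by apply: integral_ge0 => u _; rewrite lee_fin mulr_ge0// expR_ge0. Qed.

Let measurable_dens a : measurable_fun setT (fun t : V * R =>
  (expR (a * t.2) * expR (- (expR t.2 * dotrV t.1 t.1)))%:E).
Proof.
have m2 : measurable_fun setT (fun t : V * R => expR t.2).
  by apply: measurableT_comp => //; exact: measurable_snd.
have md : measurable_fun setT (fun t : V * R => dotrV t.1 t.1).
  exact: (measurableT_comp measurable_dotrV measurable_fst).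
apply/measurable_EFinP; apply: measurable_funM.
  by apply: measurableT_comp => //; apply: measurable_funM => //; exact: measurable_snd.
apply: measurableT_comp => //; apply: measurableT_comp => //; exact: measurable_funM.
Qed.

Lemma measurable_power_kernel a : measurable_fun setT (power_kernel a).
Proof.
apply: (measurable_fun_fubini_tonelli_F (m2 := leb1) (fun t : V * R =>
  (expR (a * t.2) * expR (- (expR t.2 * dotrV t.1 t.1)))%:E) (measurable_dens a)).
by move=> t; rewrite lee_fin mulr_ge0// expR_ge0.
Qed.

Lemma gauss_mixture_power (W : V -> \bar R) (K k a : R) : (0 < k)%R -> (0 < a)%R ->
  (forall z, W z = (K * dotrV z z)%:E + k%:E * power_kernel a z) ->
  gauss_mixture W.
Proof.
move=> k0 a0 WE.
exists (fun u => k * expR (a * u))%R, (fun=> 0%R), (fun=> 0%R), K, 0%R; split.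
  split => //; apply: measurable_funM => //.
  by apply: measurableT_comp => //; exact: measurable_funM.
split.
- by move=> u; rewrite mulr_gt0// expR_gt0.
- move=> u rho r0; rewrite /mix_dens mul0r !addr0.
  by rewrite !mulr_ge0 ?expR_ge0// ltW.
- move=> z; rewrite WE addr0 addeC; congr (_ + _).
  under [RHS]eq_integral do rewrite /mix_dens mul0r !addr0 -mulrA EFinM.
  rewrite ge0_integralZl//.
  + exact: measurable_gamma_scaled.
  + by rewrite lee_fin ltW.
Qed.

Lemma gauss_mixture_log (W : V -> \bar R) (K k : R) : (0 < k)%R ->
  (forall z, W z = (K * dotrV z z)%:E +
    (if z == 0%R then +oo else (- (k * ln (dotrV z z)))%:E)) ->
  gauss_mixture W.
Proof.
move=> k0 WE; pose g := gamma_cst 1 : R; have g0 : (0 < g)%R by exact: gamma_cst_gt0.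
have kg : (0 < k / g)%R by rewrite divr_gt0.
(* Here [p] and [q] are the coefficients of the tangent line in [log_dens]. Integrated, this line
   leaves k (rho - 1), which the shift of [A] to K - k and [B] = k compensate. *)
exists (fun=> k / g)%R, (fun u => k / g * (expR u * expR (- expR u)))%R,
  (fun u => k / g * (- expR (- expR u) - expR u * expR (- expR u)))%R, (K - k)%R, k.
have me : measurable_fun setT (fun u : R => expR (- expR u)).
  by do 2 apply: measurableT_comp => //.
have E u rho : mix_dens (fun=> k / g)%R (fun u => k / g * (expR u * expR (- expR u)))%R
  (fun u => k / g * (- expR (- expR u) - expR u * expR (- expR u)))%R u rho =
   (k / g * log_dens u rho)%R.
  by rewrite /mix_dens /log_dens; ring.
split.
  split => //.
    by apply: measurable_funM => //; exact: measurable_funM.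
  apply: measurable_funM => //; apply: measurable_funB; first exact: measurableT_comp.
  exact: measurable_funM.
split => //.
- by move=> u rho _; rewrite E mulr_ge0 ?log_dens_ge0// ltW.
- move=> z; rewrite WE.
  under eq_integral do rewrite E EFinM.
  rewrite ge0_integralZl//; last 3 first.
  + exact: measurable_log_dens.
  + by move=> u _; rewrite lee_fin log_dens_ge0.
  + by rewrite lee_fin ltW.
  case: ifPn => [/eqP ->|z0].
    rewrite (_ : dotrV 0%R 0%R = 0%R) ?integral_log_dens0; last by apply/eqP; rewrite dotrV_eq0.
    by rewrite gt0_muley ?lte_fin// addye// addey.
  have r0 : (0 < dotrV z z)%R by rewrite lt_neqAle dotrV_ge0 eq_sym dotrV_eq0 z0.
  rewrite integral_log_dens// -EFinM -!EFinD -/g; congr EFin.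
  by field; rewrite gt_eqF.
Qed.

Lemma lebesgue_rV_box (A : 'I_n -> set R) : (forall i, measurable (A i)) ->
  leb [set z | forall i, A i (z 0%R i)] = \prod_(i < n) leb1 (A i).
Proof.
(* With parameter 0 the Gaussian is the constant 1, so the formula computes a volume. *)
move=> mA; have := integral_prod_itv 0 0%R mA.
under eq_integral do rewrite /gaussV mul0r oppr0 expR0.
rewrite integral_cst//; last exact: measurable_coordwise.
rewrite mul1e => ->; apply: eq_bigr => i _.
under eq_integral do rewrite /gauss1 mul0r oppr0 expR0.
by rewrite integral_cst ?mul1e//; exact: mA.
Qed.

Definition cube (r : R) : set V := [set z | forall i, (- r <= z 0 i <= r)%R].

Lemma cubeE r : cube r = [set z | forall i, `[(- r)%R, r]%classic (z 0%R i)].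
Proof. by apply/seteqP; split => x /= h i; have := h i; rewrite in_itv/=. Qed.

Lemma measurable_cube r : measurable (cube r).
Proof.
rewrite cubeE; exact: (measurable_coordwise (A := fun=> `[(- r)%R, r]%classic)).
Qed.

Lemma finite_second_moment_cube (mu : probability V R) r :
  mu (cube r) = 1 -> finite_second_moment mu.
Proof.
move=> mu1; rewrite /finite_second_moment.
have mc := measurable_cube r.
have mN : measurable (~` cube r) by exact: measurableC.
have mf : measurable_fun setT (fun x : V => (enorm x ^+ 2)%:E).
  by apply/measurable_EFinP; apply: measurable_funX; exact: measurable_enorm.
rewrite (ge0_negligible_integral mN measurableT mf); last 2 first.
- by move=> x _; rewrite lee_fin sqr_ge0.
- by rewrite [LHS]probability_setC// mu1 subee.
rewrite setTD setCK.
apply: (@le_lt_trans _ _ (\int[mu]_(x in cube r) (n%:R * r ^+ 2)%:E)).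
  apply: ge0_le_integral => //.
  - by move=> x _; rewrite lee_fin sqr_ge0.
  - exact: measurable_funTS.
  - move=> x xc; rewrite lee_fin enorm_sqr /dotrV.
    apply: (@le_trans _ _ (\sum_(i < n) r ^+ 2)%R).
      by apply: ler_sum => i _; have /andP[h1 h2] := xc i; nra.
    by rewrite sumr_const card_ord mulr_natl.
by rewrite integral_cst// [X in _ * X]mu1 mule1 ltry.
Qed.

(** The hypothesis says that mu has density at most 1, so its potential is bounded by the full
    Gaussian integral. *)
Lemma gauss_energy_unif (mu : probability V R) t : (0 < t)%R ->
  (forall g, measurable_fun setT g -> (forall x, 0 <= g x) ->
     \int[mu]_x g x <= \int[leb]_x g x) ->
  gauss_energy t mu mu <= (Num.sqrt (pi / t) ^+ n)%:E.
Proof.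
move=> t0 hmu.
rewrite -[leRHS]mule1 -[X in _ <= _ * X](@probability_setT _ _ _ mu) -integral_cst//.
rewrite gauss_energy_potential; apply: ge0_le_integral => //.
- by move=> y _; exact: gauss_potential_ge0.
- exact: measurable_gauss_potential.
move=> y _; rewrite /gauss_potential mulrC divfK//.
apply: (@le_trans _ _ (\int[leb]_x (gaussV t (x - y)%R)%:E)).
  apply: hmu => [|x]; last by rewrite lee_fin gaussV_ge0.
  apply/measurable_EFinP; apply: (measurableT_comp (measurable_gaussV _)).
  exact: measurable_funB_rV.
rewrite -(integral_gaussV y t0) le_eqVlt; apply/orP; left; apply/eqP.
by apply: eq_integral => x _; rewrite /gaussV -dotrVN opprB.
Qed.

(** The uniform measure on [0, 1]^n, a competitor of bounded density inside every cube of half-side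
    at least 1. *)
Lemma unit_cube_probability : exists mu : probability V R,
  mu (cube 1) = 1 /\
  (forall g, measurable_fun setT g -> (forall x, 0 <= g x) ->
     \int[mu]_x g x <= \int[leb]_x g x).
Proof.
pose Q : set V := [set z | forall i, `[0%R, 1%R]%classic (z 0%R i)].
have mQ : measurable Q by exact: (measurable_coordwise (A := fun=> `[0%R, 1%R]%classic)).
have lQ : leb Q = 1.
  rewrite (lebesgue_rV_box (A := fun=> `[0%R, 1%R]%classic))//.
  rewrite big1// => i _; rewrite /= lebesgue_measure_itv/= lte_fin ltr01 -EFinB subr0//.
pose P0 : probability V R := \d_(0%R : V).
have [|P PE] := @probability_of_measure _ V R (mrestr leb mQ) P0.
  by rewrite -[LHS]/(leb (setT `&` Q)) setTI.
exists P; split.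
  rewrite PE -[LHS]/(leb (cube 1 `&` Q)) setIidr// => z zQ i.
  by have := zQ i; rewrite /= in_itv/= => /andP[? ->]; rewrite andbT; lra.
move=> g mg g0; rewrite (eq_measure_integral (mrestr leb mQ)) => [|A _ _]; last exact: PE.
rewrite ge0_integral_mrestr//.
by apply: ge0_subset_integral.
Qed.

(** For u >= 0 the Gaussian energy decays like e^(- n u / 2), leaving the rate n / 2 - a; for u < 0
    it is at most 1, and the prefactor decays at the rate a. *)
Lemma gauss_energy_exp_bound (mu : probability V R) (a : R) :
  (0 < a)%R -> (a < n%:R / 2)%R ->
  (forall g, measurable_fun setT g -> (forall x, 0 <= g x) ->
     \int[mu]_x g x <= \int[leb]_x g x) ->
  exists2 C : R, (0 <= C)%R & forall u,
    (expR (a * u))%:E * gauss_energy (expR u) mu mu <=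
    (C * expR (- (Num.min a (n%:R / 2 - a) * `|u|)))%:E.
Proof.
move=> a0 an hmu; exists (Num.max 1 (Num.sqrt pi ^+ n))%R; first by rewrite le_max ler01.
move=> u; set b := Num.min _ _.
have ba : (b <= a)%R by rewrite ge_min lexx.
have bn : (b <= n%:R / 2 - a)%R by rewrite ge_min lexx orbT.
have [u0|u0] := leP 0%R u.
  apply: (@le_trans _ _ ((expR (a * u))%:E * (Num.sqrt (pi / expR u) ^+ n)%:E)).
    by rewrite lee_wpmul2l ?lee_fin ?expR_ge0// gauss_energy_unif// expR_gt0.
  have sE : (Num.sqrt (pi / expR u) = Num.sqrt pi * expR (- (u / 2)))%R.
    rewrite -expRN sqrtrM ?pi_ge0//; congr (_ * _)%R.
    rewrite (_ : expR (- u) = expR (- (u / 2)) ^+ 2)%R ?sqrtr_sqr ?ger0_norm ?expR_ge0//.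
    by rewrite expr2 -expRD; congr expR; field.
  rewrite -EFinM lee_fin sE exprMn mulrCA; apply: ler_pM.
  - by rewrite exprn_ge0.
  - by rewrite mulr_ge0 ?exprn_ge0// expR_ge0.
  - by rewrite le_max lexx orbT.
  - rewrite -expRM_natr -expRD ler_expR ger0_norm//.
    have : (b * u <= (n%:R / 2 - a) * u)%R by rewrite ler_wpM2r.
    lra.
apply: (@le_trans _ _ (expR (a * u))%:E).
  by rewrite -[leRHS]mule1 lee_wpmul2l ?lee_fin ?expR_ge0// gauss_energy_le1// expR_ge0.
rewrite lee_fin -[leLHS]mul1r ler_pM ?expR_ge0//; first by rewrite le_max lexx.
by rewrite ler_expR ltr0_norm//; nra.
Qed.

(** The condition a < n / 2, local integrability of |z|^(-2 a), gives convergence as u tends to +oo;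
    a > 0 gives it at -oo. *)
Lemma power_kernel_energy (a : R) (mu : probability V R) :
  (0 < a)%R -> (a < n%:R / 2)%R ->
  (forall g, measurable_fun setT g -> (forall x, 0 <= g x) ->
     \int[mu]_x g x <= \int[leb]_x g x) ->
  mutual (power_kernel a) mu mu < +oo.
Proof.
move=> a0 an hmu.
have [C C0 hC] := gauss_energy_exp_bound a0 an hmu.
set b := Num.min _ _ in hC.
have b0 : (0 < b)%R by rewrite lt_min a0 subr_gt0.
have md : measurable_fun setT (fun t : (V * V) * R =>
  (expR (a * t.2) * expR (- (expR t.2 * dotrV (t.1.2 - t.1.1)%R (t.1.2 - t.1.1)%R)))%:E).
  have h : measurable_fun setT (fun t : (V * V) * R => ((t.1.2 - t.1.1)%R : V, t.2)).
    apply/measurable_fun_pairP; split; last exact: measurable_snd.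
    apply: measurable_funB_rV.
      exact: (measurableT_comp measurable_snd measurable_fst).
    exact: (measurableT_comp measurable_fst measurable_fst).
  exact: (measurableT_comp (measurable_dens a) h).
have d0 (t : (V * V) * R) : 0 <=
    (expR (a * t.2) * expR (- (expR t.2 * dotrV (t.1.2 - t.1.1)%R (t.1.2 - t.1.1)%R)))%:E.
  by rewrite lee_fin mulr_ge0// expR_ge0.
have SE (u : R) : \int[mu \x mu]_z (expR (a * u) *
      expR (- (expR u * dotrV (z.2 - z.1)%R (z.2 - z.1)%R)))%:E =
    (expR (a * u))%:E * gauss_energy (expR u) mu mu.
  under eq_integral do rewrite EFinM.
  have mg : measurable_fun setT (fun z : V * V => (gaussV (expR u) (z.2 - z.1)%R)%:E).
    apply/measurable_EFinP; apply: (measurableT_comp (measurable_gaussV _)).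
    exact: measurable_funB_rV.
  rewrite ge0_integralZl//; congr (_ * _).
  by rewrite (fubini_tonelli1 _ mg)// => z; rewrite lee_fin gaussV_ge0.
have me : measurable_fun setT (fun u : R => (expR (- (b * `|u|)))%:E).
  apply/measurable_EFinP; apply: measurableT_comp => //; apply: measurableT_comp => //.
  by apply: measurable_funM => //; exact: measurableT_comp.
have mD : measurable_fun setT (fun u : R => (expR (a * u))%:E * gauss_energy (expR u) mu mu).
  rewrite (_ : (fun u => _) = fun u : R => \int[mu \x mu]_z (expR (a * u) *
      expR (- (expR u * dotrV (z.2 - z.1)%R (z.2 - z.1)%R)))%:E); last first.
    by apply/funext => v; rewrite SE.
  exact: (measurable_fun_fubini_tonelli_G (m1 := probability_prod mu mu) _ md d0).
have DE : \int[mu \x mu]_z power_kernel a (z.2 - z.1)%R =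
    \int[leb1]_u ((expR (a * u))%:E * gauss_energy (expR u) mu mu).
  rewrite (fubini_tonelli (m1 := probability_prod mu mu) (m2 := leb1) _ md d0).
  by apply: eq_integral => u _; rewrite -SE.
rewrite (mutual_prod _ _ (measurable_power_kernel a) (power_kernel_ge0 a)).
rewrite DE.
  apply: (@le_lt_trans _ _ (\int[leb1]_u (C%:E * (expR (- (b * `|u|)))%:E))).
    apply: ge0_le_integral => //.
    - by move=> u _; rewrite mule_ge0 ?lee_fin ?expR_ge0// gauss_energy_ge0.
    - exact: emeasurable_funM.
  rewrite ge0_integralZl//.
  by rewrite lte_mul_pinfty//; exact: integral_exp_abs.
Qed.

End kernels_as_mixtures.

(** * Compactness of the measures on a cube *)

Section geometric_series.
Context {R : realType}.
Context (b : R) (b01 : 0 < b < 1).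

Definition geo_sum (c : nat -> R) (K : nat) : R := \sum_(0 <= k < K) b ^+ k * c k.

Definition geo_lim (c : nat -> R) : R := limn (geo_sum c).

Context (c : nat -> R) (c01 : forall k, 0 <= c k <= 1).

Lemma geo_sum_nd : nondecreasing_seq (geo_sum c).
Proof.
apply/nondecreasing_seqP => K; rewrite /geo_sum big_nat_recr//= lerDl.
by have /andP[c0 _] := c01 K; have /andP[b0 _] := b01; rewrite mulr_ge0// exprn_ge0// ltW.
Qed.

(** The geometric tail is kept exact so that the induction on [M] closes; [geo_sum_le] then drops
    the term b^M. *)
Lemma geo_sum_tail K M : (K <= M)%N -> geo_sum c M <= geo_sum c K + (b ^+ K - b ^+ M) / (1 - b).
Proof.
have /andP[b0 b1] := b01.
move=> /subnK <-; elim: (M - K)%N => [|m IH]; first by rewrite add0n subrr mul0r addr0.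
rewrite !addSn /geo_sum big_nat_recr//= -/(geo_sum c _).
have /andP[c0 c1] := c01 (m + K)%N.
have h : b ^+ (m + K) * c (m + K)%N <= b ^+ (m + K) by rewrite ler_piMr// exprn_ge0// ltW.
apply: (@le_trans _ _ (geo_sum c (m + K) + b ^+ (m + K))); first by rewrite lerD2l.
apply: (@le_trans _ _ (geo_sum c K + (b ^+ K - b ^+ (m + K)) / (1 - b) + b ^+ (m + K))).
  by rewrite lerD2r.
rewrite exprS le_eqVlt; apply/orP; left; apply/eqP.
by rewrite -/(geo_sum c K); field; rewrite subr_eq0 gt_eqF.
Qed.

Lemma geo_sum_le K M : (K <= M)%N -> geo_sum c M <= geo_sum c K + b ^+ K / (1 - b).
Proof.
have /andP[b0 b1] := b01.
move=> /geo_sum_tail /le_trans; apply; rewrite lerD2l ler_pM2r ?invr_gt0 ?subr_gt0//.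
by rewrite lerBlDr lerDl exprn_ge0// ltW.
Qed.

Lemma geo_sum_cvg : geo_sum c @ \oo --> geo_lim c.
Proof.
have /andP[b0 b1] := b01.
apply: nondecreasing_is_cvgn; first exact: geo_sum_nd.
exists (1 - b)^-1 => _ [K _ <-].
have := geo_sum_le (leq0n K).
by rewrite {1}/geo_sum [X in _ <= X + _]big_nil add0r expr0 mul1r.
Qed.

Lemma geo_lim_ge K : geo_sum c K <= geo_lim c.
Proof.
apply: nondecreasing_cvgn_le; first exact: geo_sum_nd.
by apply/cvg_ex; exists (geo_lim c); exact: geo_sum_cvg.
Qed.

Lemma geo_lim_le K : geo_lim c <= geo_sum c K + b ^+ K / (1 - b).
Proof.
apply: (cvgr_to_le geo_sum_cvg); near=> M.
by apply: geo_sum_le; near: M; exact: nbhs_infty_ge.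
Unshelve. all: by end_near. Qed.

End geometric_series.

(** * A continuous reader of digits and Schoenberg's curve *)

Section bump.
Context {R : realType}.

(** A stand-in for Schoenberg's piecewise linear function: 2-periodic, 0 near even integers and 1
    near odd ones. The factor 1 / (2 cos 1) keeps the clamp active while pi times the distance to
    the integer is at most 1. *)
Definition bump (t : R) : R :=
  Num.max 0 (Num.min 1 (2^-1 - cos (pi * t) / (2 * cos 1))).

Lemma bump01 t : 0 <= bump t <= 1.
Proof. by rewrite le_max lexx/= ge_max ler01/= ge_min lexx. Qed.

Lemma continuous_clamp (f : R -> R) (x y : R) : continuous f ->
  continuous (fun t => Num.max x (Num.min y (f t))).
Proof.
move=> cf t.
have h : {for t, continuous ((fun=> y) \min f : R -> R^o)}.
  by apply: continuous_min; [exact: cvg_cst|exact: cf].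
by apply: (@continuous_max R _ (fun=> x) ((fun=> y) \min f) t); first exact: cvg_cst.
Qed.

Lemma continuous_bump : continuous bump.
Proof.
apply: continuous_clamp => t; apply: cvgB; first exact: cvg_cst.
apply: cvgM; last exact: cvg_cst.
apply: (cvg_comp _ cos); last exact: continuous_cos.
by apply: cvgM; [exact: cvg_cst|exact: cvg_id].
Qed.

(** 1/9 is the sum of the 10^(-j) for j >= 1, the largest tail of a decimal with digits 0 and 1; as
    pi / 9 < 1, the clamp is active there. *)
Lemma bump_digit (E : nat) (d r : R) : d = 0 \/ d = 1 -> 0 <= r <= 9^-1 ->
  bump (2 * E%:R + d + r) = d.
Proof.
move=> d01 /andP[r0 r9].
have pi4 : pi <= 4 :> R by have [/andP[_ h] _] := @pihalf_02_cos_pihalf R; lra.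
have pi2 : 2 <= pi :> R by exact: pi_ge2.
have c1 : 0 < cos 1 :> R by exact: cos1_gt0.
have cr : cos 1 <= cos (pi * r).
  have [->|h] := eqVneq (pi * r) 1; first by [].
  rewrite ltW// ltr_cos ?in_itv/=; try by apply/andP; split; nra.
  by rewrite lt_neqAle h/=; nra.
have cE x : cos (x + pi * (2 * E%:R)) = cos x.
  elim: (E) => [|e IH]; first by rewrite mulr0 mulr0 addr0.
  rewrite -[RHS]IH -[RHS]cosD2pi; congr cos; rewrite -natr1; ring.
have h2 : 2^-1 <= cos (pi * r) / (2 * cos 1).
  by rewrite ler_pdivlMr ?mulr_gt0// mulrA mulVf// mul1r.
case: d01 => ->.
  rewrite /bump (_ : pi * _ = pi * r + pi * (2 * E%:R)); last by ring.
  rewrite cE; apply/max_idPl; rewrite ge_min; apply/orP; right.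
  by rewrite subr_le0.
rewrite /bump (_ : pi * _ = (pi * r + pi) + pi * (2 * E%:R)); last by ring.
rewrite cE cosDpi mulNr opprK (_ : Num.min _ _ = 1); last first.
  apply/min_idPl; rewrite -(lerD2l 2^-1) in h2; apply: le_trans h2; lra.
by apply/max_idPr.
Qed.

End bump.

Section code.
Context {R : realType}.

Let b10 : 0 < (10^-1 : R) < 1. Proof. by apply/andP; split; lra. Qed.

Context (a : nat -> R) (a01 : forall m, a m = 0 \/ a m = 1).

Let a_01 m : 0 <= a m <= 1.
Proof. by case: (a01 m) => ->; rewrite lexx ler01. Qed.

(** A decimal with digits 0 and 1. Multiplied by 10^m, its earlier digits form an even integer, 10
    being even, and its later ones at most 1/9, so [bump] returns digit m. *)
Definition code : R := geo_lim 10^-1 a.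

Lemma code02 : 0 <= code <= 2.
Proof.
apply/andP; split.
  by apply: le_trans (geo_lim_ge b10 a_01 0); rewrite /geo_sum big_nil.
apply: (le_trans (geo_lim_le b10 a_01 0)).
rewrite /geo_sum big_nil expr0 (_ : 1 / _ = 10 / 9); last by field.
lra.
Qed.

Lemma geo_sum_even m : exists E : nat, 10 ^+ m * geo_sum 10^-1 a m = 2 * E%:R.
Proof.
elim: m => [|m [E IH]].
  by exists 0%N; rewrite /geo_sum big_nil !mulr0.
rewrite /geo_sum big_nat_recr//= -/(geo_sum _ _ _) exprS mulrDr -mulrA IH.
have -> : 10 * 10 ^+ m * (10^-1 ^+ m * a m) = 10 * a m.
  by rewrite exprVn; field; rewrite expf_neq0.
case: (a01 m) => ->; [exists (10 * E)%N|exists (10 * E + 5)%N].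
  by rewrite natrM; ring.
by rewrite natrD natrM; ring.
Qed.

Lemma bump_code m : bump (10 ^+ m * code) = a m.
Proof.
have [E hE] := geo_sum_even m.
have e10 : 10 ^+ m * 10^-1 ^+ m = 1 :> R by rewrite exprVn mulfV// expf_neq0.
have h1 := geo_lim_ge b10 a_01 m.+1; have h2 := geo_lim_le b10 a_01 m.+1.
have p0 : 0 < 10 ^+ m :> R by rewrite exprn_gt0.
have hS : 10 ^+ m * geo_sum 10^-1 a m.+1 = 2 * E%:R + a m.
  by rewrite /geo_sum big_nat_recr//= -/(geo_sum _ _ _) mulrDr hE mulrA e10 mul1r.
rewrite -[10 ^+ m * code](subrK (2 * E%:R + a m)) addrC; apply: bump_digit => //.
rewrite -hS -mulrBr; apply/andP; split; first by rewrite mulr_ge0 ?subr_ge0// ltW.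
have : 10 ^+ m * (code - geo_sum 10^-1 a m.+1) <= 10 ^+ m * (10^-1 ^+ m.+1 / (1 - 10^-1)).
  by rewrite ler_pM2l// lerBlDl.
rewrite exprS mulrA mulrCA e10 mulr1; move/le_trans; apply.
by rewrite le_eqVlt; apply/orP; left; apply/eqP; field.
Qed.

End code.

Section binary_digits.
Context {R : realType}.

Definition digit (k : nat) (y : R) : R :=
  (Num.floor (2 ^+ k.+1 * y))%:~R - 2 * (Num.floor (2 ^+ k * y))%:~R.

Lemma digit01 k y : digit k y = 0 \/ digit k y = 1.
Proof.
rewrite /digit exprS -mulrA; set z := 2 ^+ k * y.
have /andP[h1 h2] := floor_itv z.
have /andP[h3 h4] := floor_itv (2 * z).
move: (Num.floor z) (Num.floor (2 * z)) h1 h2 h3 h4 => p q.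
rewrite !intrD => h1 h2 h3 h4.
have e : (q - 2 * p)%:~R = q%:~R - 2 * p%:~R :> R by rewrite intrB intrM.
have h5 : -1 < q - 2 * p by rewrite -(ltr_int R) e rmorphN1; lra.
have h6 : q - 2 * p < 2 by rewrite -(ltr_int R) e; lra.
rewrite -e.
have : (q - 2 * p == 0) || (q - 2 * p == 1) by lia.
by case/orP => /eqP ->; [left|right].
Qed.

(** The digits telescope. They are numbered from 0, so digit k has weight 2^(-k-1), hence the factor
    1/2. *)
Lemma geo_sum_digit y K : 0 <= y < 1 ->
  2^-1 * geo_sum 2^-1 (digit ^~ y) K = 2^-1 ^+ K * (Num.floor (2 ^+ K * y))%:~R.
Proof.
move=> y01; elim: K => [|K IH].
  rewrite /geo_sum big_nil mulr0 !expr0 !mul1r (_ : Num.floor y = 0)//.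
  by apply/eqP; rewrite floor_eq add0r.
rewrite /geo_sum big_nat_recr//= -/(geo_sum _ _ _) mulrDr IH /digit exprS.
by rewrite (exprS _ K); field.
Qed.

Lemma geo_lim_digit y : 0 <= y < 1 -> 2^-1 * geo_lim 2^-1 (digit ^~ y) = y.
Proof.
move=> y01.
have b2 : 0 < (2^-1 : R) < 1 by apply/andP; split; lra.
have d01 k : 0 <= digit k y <= 1 by case: (digit01 k y) => ->; rewrite lexx ler01.
have c1 : (fun K => 2^-1 * geo_sum 2^-1 (digit ^~ y) K) @ \oo -->
    2^-1 * geo_lim 2^-1 (digit ^~ y).
  by apply: cvgM; [exact: cvg_cst|exact: geo_sum_cvg].
apply: (cvg_unique _ c1) => //.
apply: (@squeeze_cvgr _ _ _ _ (fun K => y - 2^-1 ^+ K) (fun=> y)).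
- near=> K; rewrite geo_sum_digit//.
  have /andP[h1 h2] := floor_itv (2 ^+ K * y).
  have p0 : 0 < 2^-1 ^+ K :> R by rewrite exprn_gt0// invr_gt0.
  have e : 2^-1 ^+ K * (2 ^+ K * y) = y by rewrite mulrA -exprMn mulVf// expr1n mul1r.
  apply/andP; split; last by rewrite -[leRHS]e ler_pM2l.
  have h : 2^-1 ^+ K * (2 ^+ K * y) <= 2^-1 ^+ K * ((Num.floor (2 ^+ K * y))%:~R + 1).
    by rewrite ler_pM2l// -[1 in leRHS]/(1%:~R) -intrD ltW.
  by rewrite e mulrDr mulr1 in h; rewrite lerBlDr.
- rewrite -[X in _ --> X]subr0; apply: cvgB; first exact: cvg_cst.
  by apply: cvg_expr; rewrite ger0_norm//; lra.
- exact: cvg_cst.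
Unshelve. all: by end_near. Qed.

End binary_digits.

Section space_filling_curve.
Context {R : realType}.

(** The tail bound of [geo_lim_le] does not depend on t, so the limit is uniform. *)
Lemma geo_lim_continuous (b : R) (c : nat -> R -> R) : 0 < b < 1 ->
  (forall k, continuous (c k)) -> (forall k t, 0 <= c k t <= 1) ->
  continuous (fun t => geo_lim b (c ^~ t)).
Proof.
move=> b01 cc c01 t; have /andP[b0 b1] := b01.
have cS K : continuous (fun t => geo_sum b (c ^~ t) K).
  elim: K => [|K IH].
    rewrite (_ : (fun _ => _) = fun=> 0); first exact: cst_continuous.
    by apply/funext => u; rewrite /geo_sum big_nil.
  rewrite (_ : (fun _ => _) = (fun u => geo_sum b (c ^~ u) K + b ^+ K * c K u)).
    by move=> u; apply: cvgD; [exact: IH|apply: cvgM; [exact: cvg_cst|exact: cc]].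
  by apply/funext => u; rewrite /geo_sum big_nat_recr.
apply/cvgrPdist_lt => e e0.
have [K hK] : exists K, b ^+ K / (1 - b) < e / 2.
  have h : (fun K => b ^+ K / (1 - b)) @ \oo --> 0 / (1 - b).
    by apply: cvgM; [apply: cvg_expr; rewrite ger0_norm// ltW|exact: cvg_cst].
  rewrite mul0r in h; have e2 : 0 < e / 2 by rewrite divr_gt0.
  have /cvgrPdist_lt/(_ _ e2)[K _ hK] := h.
  exists K; have := hK K (leqnn K); rewrite sub0r normrN ger0_norm//.
  by rewrite divr_ge0 ?exprn_ge0 ?subr_ge0// ltW.
have e2 : 0 < e / 2 by rewrite divr_gt0.
have /cvgrPdist_lt/(_ _ e2) := cS K t; apply: filterS => t' ht'.
have h1 := geo_lim_ge b01 (c01 ^~ t) K; have h2 := geo_lim_le b01 (c01 ^~ t) K.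
have h3 := geo_lim_ge b01 (c01 ^~ t') K; have h4 := geo_lim_le b01 (c01 ^~ t') K.
move: ht' hK h1 h2 h3 h4; rewrite !ltr_norml.
set x1 := geo_sum _ _ _; set x2 := geo_sum _ _ _; set y1 := geo_lim _ _; set y2 := geo_lim _ _.
set w := b ^+ K / _ => /andP[? ?] *; apply/andP; split; lra.
Qed.

Lemma geo_lim_measurable d (T : measurableType d) (b : R) (c : nat -> T -> R) :
  0 < b < 1 -> (forall k, measurable_fun setT (c k)) -> (forall k t, 0 <= c k t <= 1) ->
  measurable_fun setT (fun t => geo_lim b (c ^~ t)).
Proof.
move=> b01 mc c01.
apply: (measurable_fun_cvg (h := fun K t => geo_sum b (c ^~ t) K)).
- move=> K; rewrite /geo_sum; apply: measurable_sum => k.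
  by apply: measurable_funM.
- by move=> t _; exact: (geo_sum_cvg b01 (c01 ^~ t)).
Qed.

Lemma measurable_digit k : measurable_fun setT (@digit R k).
Proof.
have mf : measurable_fun setT (fun y : R => (Num.floor y)%:~R : R).
  by apply: nondecreasing_measurable => // x y xy; rewrite ler_int le_floor.
apply: measurable_funB.
  by apply: (measurableT_comp mf); exact: measurable_funM.
apply: measurable_funM => //.
by apply: (measurableT_comp mf); exact: measurable_funM.
Qed.

(* Schoenberg's curve: the base-10 digits of [s x] interleave the binary digits
   of the (rescaled) coordinates of [x], and [bump] reads them off continuously. *)
Lemma space_filling_curve n (r : R) : (0 < n)%N -> 0 < r ->
  exists (Phi : R -> 'rV[R]_n) (s : 'rV[R]_n -> R),
    [/\ (forall i, continuous (fun t => Phi t 0 i)), measurable_fun setT s,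
        (forall x, 0 <= s x <= 2), (forall t, cube r (Phi t)) &
        (forall x, cube r x -> Phi (s x) = x)].
Proof.
move=> n0 r0.
have b2 : 0 < (2^-1 : R) < 1 by apply/andP; split; lra.
have b10 : 0 < (10^-1 : R) < 1 by apply/andP; split; lra.
(* Dividing by 4 r instead of 2 r keeps the rescaled coordinate in [0, 1/2], away from 1, where the
   binary expansion breaks down. *)
pose a m (x : 'rV[R]_n) := digit (m %/ n) ((x 0 (Ordinal (ltn_pmod m n0)) + r) / (4 * r)).
have a01 m x : a m x = 0 \/ a m x = 1 by exact: digit01.
pose L (i : 'I_n) (t : R) := geo_lim 2^-1 (fun k => bump (10 ^+ (k * n + i) * t)).
(* The clamp keeps the values in the cube even at parameters that are not codes. *)
pose Phi t : 'rV[R]_n := \row_i Num.max (- r) (Num.min r (4 * r * (2^-1 * L i t) - r)).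
exists Phi, (fun x => code (a ^~ x)); split.
- move=> i; rewrite /Phi; under eq_fun do rewrite mxE.
  apply: continuous_clamp => t; apply: cvgB; last exact: cvg_cst.
  apply: cvgM; first exact: cvg_cst.
  apply: cvgM; first exact: cvg_cst.
  apply: geo_lim_continuous => // [k u|k u]; last exact: bump01.
  apply: (cvg_comp _ bump); last exact: continuous_bump.
  by apply: cvgM; [exact: cvg_cst|exact: cvg_id].
- apply: geo_lim_measurable => // [k|k x]; last by case: (a01 k x) => ->; rewrite lexx ler01.
  apply: (measurableT_comp (measurable_digit _)).
  by apply: measurable_funM => //; apply: measurable_funD => //; exact: measurable_coord_rV.
- by move=> x; apply: code02 => m; exact: a01.
- move=> t i; rewrite mxE le_max lexx/= ge_max ge_min lexx andbT; lra.
- move=> x xr; apply/rowP => i; rewrite mxE.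
  have /andP[x1 x2] := xr i.
  have -> : L i (code (a ^~ x)) = geo_lim 2^-1 (digit ^~ ((x 0 i + r) / (4 * r))).
    rewrite /L; congr geo_lim; apply/funext => k.
    rewrite bump_code; last by move=> m; exact: a01.
    rewrite /a divnMDl// divn_small// addn0; congr (digit _ ((x 0 _ + r) / _)).
    by apply: val_inj; rewrite /= modnMDl modn_small.
  rewrite geo_lim_digit; last first.
    apply/andP; split; first by rewrite divr_ge0//; lra.
    by rewrite ltr_pdivrMr ?mulr_gt0//; lra.
  rewrite (_ : 4 * r * _ - r = x 0 i); last by field; rewrite gt_eqF.
  by rewrite (min_idPr _)// (max_idPr _).
Qed.

End space_filling_curve.

(** * Quantile functions of laws on the line *)

Section quantile.
Context {R : realType}.
Local Notation leb1 := (@lebesgue_measure R).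
Local Notation Rm := (measurableTypeR R).

Lemma probability_eq_rays (m1 m2 : probability Rm R) :
  (forall t : R, m1 `]-oo, t]%classic = m2 `]-oo, t]%classic) ->
  forall A, measurable A -> m1 A = m2 A.
Proof.
move=> h A mA.
have E (m : probability Rm R) (a b : R) : (a < b)%R ->
    (m `]a, b]%classic = m `]-oo, b]%classic - m `]-oo, a]%classic)%E.
  move=> ab; have -> : `]a, b]%classic = `]-oo, b]%classic `\` `]-oo, a]%classic :> set R.
    by rewrite -[RHS]setCK setCD setCitvl setUC -[LHS]setCK setCitv.
  rewrite measureD ?setIidr//; first by apply: subset_itvl; rewrite bnd_simp ltW.
  by rewrite (le_lt_trans (probability_le1 _ _))// ltry.
apply: (@measure_unique _ R Rm (@ocitv R) (fun k : nat => `](- k%:R)%R, k%:R]%classic) _ _ _ _ m1 m2) => //.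
- exact: ocitvI.
- by move=> k; exact: is_ocitv.
- apply/seteqP; split => // x _; exists (Num.truncn `|x|).+1 => //=.
  rewrite in_itv/=; have := truncnS_gt `|x|; rewrite ltr_norml => /andP[-> x1].
  exact: ltW.
- move=> _ [[a b] _ <-]/=; have [ab|ba] := ltP a b; first by rewrite !E// !h.
  by rewrite set_itv_ge ?measure0// bnd_simp -leNgt.
- by move=> k; rewrite (le_lt_trans (probability_le1 _ _))// ltry.
Qed.

(** The quantile transform: [q u] is the infimum of the t with u <= F t, where F is the distribution
    function of [lam]. Then [q u <= t] is equivalent to [u <= F t], so q carries the uniform law to
    [lam]. *)
Lemma quantile_function (P lam : probability Rm R) :
  (forall A, measurable A -> P A = leb1 (A `&` `]0, 1[%classic)) ->
  lam `[0, 2]%classic = 1%E ->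
  exists q : R -> R, [/\ {homo q : x y / x <= y}, (forall u, 0 <= q u <= 2) &
    forall A, measurable A -> lam A = P (q @^-1` A)].
Proof.
move=> PE lam1.
pose F t := fine (lam `]-oo, t]%classic).
have FE t : lam `]-oo, t]%classic = (F t)%:E by rewrite fineK// fin_num_measure.
have Fnd s t : s <= t -> F s <= F t.
  by move=> st; rewrite -lee_fin -!FE; apply: le_measure; rewrite ?inE//; exact: subset_itvl.
have F1 t : F t <= 1 by rewrite -lee_fin -FE probability_le1.
have F0 t : 0 <= F t by rewrite -lee_fin -FE.
have Fneg t : t < 0 -> F t = 0.
  move=> t0; apply/eqP; rewrite eq_le F0 andbT -lee_fin -FE.
  have lamC : lam (~` `[0, 2]%classic) = 0%E by rewrite probability_setC// lam1 subee.
  apply: (@le_trans _ _ (lam (~` `[0, 2]%classic))); last by rewrite lamC.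
  apply: le_measure; rewrite ?inE//; first exact: measurableC.
  move=> x /=; rewrite !in_itv/= => xt /andP[x0 _].
  have h : (0 : R) < 0 by exact: le_lt_trans (le_trans x0 xt) t0.
  by rewrite ltxx in h.
have F2 : F 2 = 1.
  apply/eqP; rewrite eq_le F1/= -lee_fin -FE -lam1; apply: le_measure; rewrite ?inE//.
  by move=> x /=; rewrite !in_itv/= => /andP[].
pose S (u : R) := [set t | 0 <= t <= 2 /\ u <= F t].
have S2 u : u <= 1 -> S u 2 by move=> u1; split; [rewrite lexx ler0n|rewrite F2].
have lbS u : lbound (S u) 0 by move=> t [/andP[]].
have hiS u : u <= 1 -> has_inf (S u).
  by move=> u1; split; [exists 2; exact: S2|exists 0; exact: lbS].
have inf02 u : u <= 1 -> 0 <= inf (S u) <= 2.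
  move=> u1; apply/andP; split.
    by apply: lb_le_inf; [exists 2; exact: S2|exact: lbS].
  by apply: ge_inf; [exists 0; exact: lbS|exact: S2].
have G2 u t : 0 < u -> u <= 1 -> u <= F t -> inf (S u) <= t.
  move=> u0 u1 ut; have [t0|t0] := leP 0 t; last by move: ut; rewrite Fneg//; lra.
  have [t2|t2] := leP t 2; last by have := inf02 u u1; lra.
  by apply: ge_inf; [exists 0; exact: lbS|split => //; rewrite t0].
(* The infimum is attained because F is right-continuous, by continuity of [lam] along decreasing
   rays. *)
have G1 u : u <= 1 -> u <= F (inf (S u)).
  move=> u1; set t := inf (S u).
  pose B (k : nat) : set Rm := `]-oo, (t + k.+1%:R^-1)%R]%classic.
  have cB : (lam \o B) k @[k --> \oo] --> lam (\bigcap_k B k).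
    apply: nonincreasing_cvg_mu.
    - by rewrite -ge0_fin_numE// fin_num_measure//; exact: measurable_itv.
    - by move=> k; exact: measurable_itv.
    - by apply: bigcap_measurable => // k _; exact: measurable_itv.
    - move=> k m km; apply/subsetPset; apply: subset_itvl.
      by rewrite bnd_simp lerD2l lef_pV2 ?posrE// ler_nat.
  rewrite /B -itvNycEbigcap in cB.
  rewrite -lee_fin -FE; apply: (cvge_to_ge cB); near=> k.
  rewrite /= FE lee_fin.
  have [x [_ ux] xt] : exists2 x, S u x & x < t + k.+1%:R^-1.
    by apply: inf_adherent; [rewrite invr_gt0|exact: hiS].
  by apply: (le_trans ux); apply: Fnd; exact: ltW.
(* Outside ]0, 1[, a null set for P, the values 0 and 2 keep q monotone with values in [0, 2]. *)
pose q u := if u <= 0 then 0 else if 1 <= u then 2 else inf (S u).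
have q02 u : 0 <= q u <= 2.
  rewrite /q; case: ifP => [_|_]; first by rewrite lexx ler0n.
  case: ifP => [_|/negbT]; first by rewrite lexx ler0n.
  by rewrite -ltNge => /ltW; exact: inf02.
have qin u : 0 < u < 1 -> q u = inf (S u).
  by move=> /andP[u0 u1]; rewrite /q leNgt u0/= leNgt u1.
have qnd : {homo q : x y / x <= y}.
  move=> x y xy; have [x0|x0] := leP x 0.
    by rewrite {1}/q x0; case/andP: (q02 y).
  have [y1|y1] := leP 1 y.
    have -> : q y = 2 by rewrite /q leNgt (lt_le_trans x0 xy)/= y1.
    by case/andP: (q02 x).
  have x1 : x < 1 by exact: le_lt_trans xy y1.
  rewrite !qin ?x0 ?y1 ?x1 ?(lt_le_trans x0 xy)//.
  by apply: G2 => //; [exact: ltW|apply: (le_trans xy); apply: G1; exact: ltW].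
exists q; split => //.
have mq : measurable_fun setT (q : Rm -> Rm) by exact: nondecreasing_measurable.
have [m [mE _]] := probability_map P mq.
suff h : forall A, measurable A -> lam A = m A by move=> A mA; rewrite h// mE.
apply: probability_eq_rays => t; rewrite mE PE//; last first.
  by rewrite -[X in measurable X]setTI; exact: mq.
rewrite FE.
have -> : q @^-1` `]-oo, t]%classic `&` `]0, 1[%classic = `]0, (F t)]%classic `&` `]0, 1[%classic.
  apply/seteqP; split => u /= [] h; rewrite in_itv/= => /andP[u0 u1]; split; rewrite ?in_itv/= ?u0 ?u1//.
    move: h; rewrite in_itv/= qin ?u0// => qt.
    by apply: (le_trans (G1 u (ltW u1))); exact: Fnd.
  by rewrite qin ?u0//; move: h; rewrite in_itv/= => /andP[_ h]; apply: G2 => //; exact: ltW.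
(* F t may be 1, so the set is squeezed between the open and the half-open interval from 0 to F t,
   both of length F t. *)
apply/eqP; rewrite eq_le; apply/andP; split.
  apply: (@le_trans _ _ (leb1 `]0, (F t)[)).
    rewrite lebesgue_measure_itv/= lte_fin; case: ltP => Ft; first by rewrite -EFinB subr0.
    by rewrite lee_fin.
  apply: le_measure; rewrite ?inE//; first exact: measurableI.
  move=> u /=; rewrite !in_itv/= => /andP[u0 uF]; split; rewrite u0/=; first exact: ltW.
  exact: lt_le_trans uF (F1 t).
apply: (@le_trans _ _ (leb1 `]0, (F t)])).
  by apply: le_measure; rewrite ?inE//; exact: measurableI.
rewrite lebesgue_measure_itv/= lte_fin; case: ltP => Ft; first by rewrite -EFinB subr0.
by rewrite lee_fin.
Unshelve. all: by end_near. Qed.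

End quantile.

(** * Helly's selection theorem *)

Section helly.
Context {R : realType}.

(** Tychonoff's theorem gives a cluster point of the sequence in the product of copies of [0, b].
    This uncountable product is not first countable, so what it yields is approximation at finitely
    many points at a time. *)
Lemma pointwise_cluster (q_ : nat -> R -> R) (b : R) :
  (forall k u, 0 <= q_ k u <= b) ->
  exists q : R -> R, forall (s : seq R) (e : R) (M : nat), 0 < e ->
    exists2 m, (M <= m)%N & forall u, u \in s -> `|q_ m u - q u| < e.
Proof.
move=> q_b.
pose T := prod_topology (fun _ : R => R).
have cpt : compact [set f : T | forall u, `[0, b]%classic (f u)].
  by apply: (@tychonoff R (fun=> R) (fun=> `[0, b]%classic)) => u; exact: segment_compact.
have PF : ProperFilter ((q_ : nat -> T) @ \oo) by exact: fmap_proper_filter.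
have [|q [_ cq]] := cpt _ PF.
  by exists 0%N => // k _ u /=; rewrite in_itv/=; exact: q_b.
exists q => s e M e0.
have nb : nbhs (q : T) [set f : T | forall u, u \in s -> ball (q u) e (f u)].
  elim: s => [|v s IH]; first by apply: filterS filterT => f _ u.
  have h : nbhs (q : T) [set f : T | ball (q v) e (f v)].
    exact: (@proj_continuous R (fun=> R) v q _ (nbhsx_ballx (q v) e e0)).
  have h2 := @filterI _ _ (nbhs_filter (q : T)) _ _ h IH.
  apply: (@filterS _ _ (nbhs_filter (q : T)) _ _ _ h2) => f [fv fs] u.
  by rewrite inE => /predU1P[->|]; [exact: fv|exact: fs].
have hM : ((q_ : nat -> T) @ \oo) [set f : T | exists2 m, (M <= m)%N & f = q_ m].
  by exists M => // m /= Mm; exists m.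
have [f [[m Mm ->] hf]] := cq _ _ hM nb.
by exists m => // u us; rewrite distrC; exact: hf.
Qed.

(** A diagonal choice gives convergence at all rationals, and monotonicity extends it to the
    continuity points of the limit. The indices [f k] need not increase; f k >= k suffices for
    minimizing sequences. *)
Lemma nondecreasing_cvg_countable (q_ : nat -> R -> R) (b : R) :
  (forall k, {homo q_ k : x y / x <= y}) -> (forall k u, 0 <= q_ k u <= b) ->
  exists (q : R -> R) (f : nat -> nat) (D : set R),
    [/\ {homo q : x y / x <= y}, (forall k, (k <= f k)%N), countable D &
      forall u, 0 < u < 1 -> ~ D u -> (fun k => q_ (f k) u) @ \oo --> q u].
Proof.
move=> nd q_b.
have [q hq] := pointwise_cluster q_b.
have qnd : {homo q : x y / x <= y}.
  move=> x y xy; apply/ler_addgt0Pr => e e0.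
  have e2 : 0 < e / 2 by rewrite divr_gt0.
  have [m _ hm] := hq [:: x; y] (e / 2) 0%N e2.
  have := hm x; rewrite !inE eqxx => /(_ isT); rewrite ltr_norml => /andP[h1 h2].
  have := hm y; rewrite !inE eqxx orbT => /(_ isT); rewrite ltr_norml => /andP[h3 h4].
  have := nd m x y xy; lra.
(* The rationals with code below k, at which [q_ (f k)] has to be within 1 / (k + 1) of q. *)
pose rs k : seq R := [seq ratr r | r <- pmap unpickle (iota 0 k)].
have /choice[f hf] (k : nat) : exists m, (k <= m)%N /\
    forall u, u \in rs k -> `|q_ m u - q u| < k.+1%:R^-1.
  have k0 : 0 < k.+1%:R^-1 :> R by rewrite invr_gt0.
  by have [m km hm] := hq (rs k) k.+1%:R^-1 k k0; exists m.
exists q, f, [set x | x \in (`]0, 1[) /\ discontinuity q x]; split => //.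
- by move=> k; case: (hf k).
- by apply: discontinuity_countable => x y _ _; exact: qnd.
have crat (r : rat) : (fun k => q_ (f k) (ratr r)) @ \oo --> q (ratr r).
  apply/cvgrPdist_lt => e e0; near=> k.
  rewrite distrC; apply: (@lt_trans _ _ k.+1%:R^-1).
    apply: (hf k).2; apply: map_f; rewrite mem_pmap; apply/mapP.
    exists (pickle r); last by rewrite pickleK.
    rewrite mem_iota/= add0n; near: k; exact: nbhs_infty_gt.
  near: k; exact: near_infty_natSinv_lt (PosNum e0).
move=> u u01 ndisc.
have cl : cvg (q x @[x --> u^'-]).
  apply: nondecreasing_at_left_is_cvgr.
    by near=> x; move=> y z yx zx yz; exact: qnd.
  by near=> x; exists (q u) => z [y]; rewrite /= in_itv/= => /andP[xy yu] <-; apply: qnd; exact: ltW.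
have cr : cvg (q x @[x --> u^'+]).
  apply: nondecreasing_at_right_is_cvgr.
    by near=> x; move=> y z yx zx yz; exact: qnd.
  by near=> x; exists (q u) => z [y]; rewrite /= in_itv/= => /andP[uy yx] <-; apply: qnd; exact: ltW.
have elr : lim (q x @[x --> u^'-]) = lim (q x @[x --> u^'+]).
  by apply/eqP/negPn/negP => h; apply: ndisc; split; [rewrite in_itv|split].
have hl : lim (q x @[x --> u^'-]) <= q u.
  apply: limr_le => //; near=> x; apply: qnd; near: x; exact: nbhs_left_le.
have hr : q u <= lim (q x @[x --> u^'+]).
  apply: limr_ge => //; near=> x; apply: qnd; near: x; exact: nbhs_right_ge.
have el : lim (q x @[x --> u^'-]) = q u by apply/eqP; rewrite eq_le hl elr hr.
have er : lim (q x @[x --> u^'+]) = q u by rewrite -elr.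
have {}cl : q x @[x --> u^'-] --> q u by rewrite -el.
have {}cr : q x @[x --> u^'+] --> q u by rewrite -er.
apply/cvgrPdist_lt => e e0.
have e2 : 0 < e / 2 by rewrite divr_gt0.
have /andP[u0 u1] := u01.
(* Rationals on both sides of u at which q is within e / 2 of q u; monotonicity traps [q_ (f k) u]
   between its values there. *)
have [r1 [r1u hr1]] : exists r : rat, ratr r < u /\ q u - e / 2 < q (ratr r).
  have /cvgrPdist_lt/(_ _ e2)[d /= d0 hd] := cl.
  have [|r] := @rat_in_itvoo R (u - d) u; first by rewrite gtrBl.
  rewrite in_itv/= => /andP[dr ru]; exists r; split => //.
  have := hd (ratr r); rewrite /ball_/= ger0_norm ?subr_ge0 ?(ltW ru)// ltrBlDr -ltrBlDl.
  by move=> /(_ dr ru); rewrite ltr_norml => /andP[_]; lra.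
have [r2 [r2u hr2]] : exists r : rat, u < ratr r /\ q (ratr r) < q u + e / 2.
  have /cvgrPdist_lt/(_ _ e2)[d /= d0 hd] := cr.
  have [|r] := @rat_in_itvoo R u (u + d); first by rewrite ltrDl.
  rewrite in_itv/= => /andP[ur rd]; exists r; split => //.
  have := hd (ratr r); rewrite /ball_/= ler0_norm ?subr_le0 ?(ltW ur)// opprB ltrBlDl.
  by move=> /(_ rd ur); rewrite ltr_norml => /andP[]; lra.
have /cvgrPdist_lt/(_ _ e2) h1 := crat r1.
have /cvgrPdist_lt/(_ _ e2) h2 := crat r2.
near=> k.
have : `|q (ratr r1) - q_ (f k) (ratr r1)| < e / 2 by near: k.
have : `|q (ratr r2) - q_ (f k) (ratr r2)| < e / 2 by near: k.
rewrite !ltr_norml => /andP[? ?] /andP[? ?].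
have := nd (f k) _ _ (ltW r1u); have := nd (f k) _ _ (ltW r2u).
by move=> ? ?; apply/andP; split; lra.
Unshelve. all: by end_near. Qed.

End helly.

(** * Minimizing sequences on a cube *)

Section compactness.
Context {R : realType}.
Local Notation leb1 := (@lebesgue_measure R).
Local Notation Rm := (measurableTypeR R).
Local Open Scope ereal_scope.

Lemma limn_einf_ge0 (u : nat -> \bar R) : (forall k, 0 <= u k) -> 0 <= limn_einf u.
Proof.
move=> u0; rewrite limn_einf_lim; apply: lime_ge; first exact: is_cvg_einfs.
by near=> k; apply: le_ereal_inf_tmp => _ [m _ <-].
Unshelve. all: by end_near. Qed.

Lemma measurable_limn_einf d (T : measurableType d) (f : nat -> T -> \bar R) :
  (forall k, measurable_fun setT (f k)) ->
  measurable_fun setT (fun x => limn_einf (f ^~ x)).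
Proof.
move=> mf; apply: measurableT_comp => //.
apply: (measurable_fun_limn_esup (f := fun k x => - f k x)) => k.
exact: measurableT_comp.
Qed.

Lemma uniform01 : exists P : probability Rm R,
  forall A, P A = leb1 (A `&` `]0%R, 1%R[%classic).
Proof.
pose m := mrestr leb1 (measurable_itv `]0%R, 1%R[ : measurable (`]0%R, 1%R[%classic : set Rm)).
have [|P PE] := @probability_of_measure _ Rm R m (\d_(0%R : Rm)); last by exists P.
rewrite -[LHS]/(leb1 (setT `&` `]0%R, 1%R[%classic)) setTI lebesgue_measure_itv/=.
by rewrite lte_fin ltr01 -EFinB subr0.
Qed.

Lemma probability_setI d (T : measurableType d) (mu : probability T R) (C A : set T) :
  measurable C -> measurable A -> mu C = 1 -> mu A = mu (A `&` C).
Proof.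
move=> mC mA C1.
have C0 : mu (~` C) = 0 by rewrite probability_setC// C1 subee.
have mN : measurable (~` C) by exact: measurableC.
apply/eqP; rewrite eq_le; apply/andP; split; last first.
  by apply: le_measure; rewrite ?inE//; exact: measurableI.
rewrite -[leRHS]adde0 -[X in _ <= _ + X]C0.
apply: (@le_trans _ _ (mu ((A `&` C) `|` ~` C))).
  apply: le_measure; rewrite ?inE//; first by apply: measurableU => //; exact: measurableI.
  by move=> x Ax; have [Cx|nCx] := pselect (C x); [left|right].
by apply: measureU2 => //; exact: measurableI.
Qed.

Context {n : nat}.
Local Notation V := 'rV[R]_n.

Lemma mutual_map d (T : measurableType d) (P : probability T R) (X : T -> V) (mu : probability V R)
    (W : V -> \bar R) : measurable_fun setT X -> measurable_fun setT W ->
  (forall x, 0 <= W x) -> (forall A, measurable A -> mu A = P (X @^-1` A)) ->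
  mutual W mu mu = \int[P]_v \int[P]_u W (X u - X v)%R.
Proof.
move=> mX mW W0 muE.
have [m [mE mI]] := probability_map P mX.
have I g : measurable_fun setT g -> (forall x, 0 <= g x) -> \int[mu]_x g x = \int[P]_u g (X u).
  move=> mg g0; rewrite -mI//; apply: eq_measure_integral => A mA _.
  by apply: (etrans (muE _ mA)); exact/esym/mE.
have mWs := measurable_sub_swap mW.
rewrite /mutual I.
- apply: eq_integral => v _; rewrite I//.
  by apply: (measurableT_comp mW); exact: measurable_funB_rV.
- exact: (measurable_fun_fubini_tonelli_F (m2 := mu) (fun z : V * V => W (z.2 - z.1)%R)).
- by move=> y; exact: integral_ge0.
Qed.

Lemma cube_compactness (r : R) (W : V -> \bar R) (nu : nat -> probability V R) :
  (0 < n)%N -> (0 < r)%R -> measurable_fun setT W -> (forall x, 0 <= W x) ->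
  (forall (x_ : nat -> V) (x : V), (forall i, (fun k => x_ k 0%R i) @ \oo --> x 0%R i) ->
     W x <= limn_einf (W \o x_)) ->
  (forall k, nu k (cube r) = 1) ->
  exists (mu : probability V R) (f : nat -> nat), [/\ (forall k, (k <= f k)%N),
    mu (cube r) = 1 &
    mutual W mu mu <= limn_einf (fun k => mutual W (nu (f k)) (nu (f k)))].
Proof.
move=> n0 r0 mW W0 Wlsc nur.
have [Phi [s [cPhi ms s02 cubePhi PhiK]]] := space_filling_curve n0 r0.
have [P PE] := uniform01.
have mPhi : measurable_fun setT (Phi : Rm -> V).
  by apply: measurable_fun_rV => i; apply: continuous_measurable_fun; exact: cPhi.
have mcube := @measurable_cube R n r.
have preV (g : Rm -> V) A : measurable_fun setT g -> measurable A -> measurable (g @^-1` A).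
  by move=> mg mA; rewrite -[X in measurable X]setTI; exact: mg.
have /choice[q_ hq] k : exists q : R -> R, [/\ {homo q : x y / (x <= y)%R},
    (forall u, (0 <= q u <= 2)%R) &
    forall A, measurable A -> nu k A = P ((Phi \o q) @^-1` A)].
  (* [lam] is the law of the parameter [s] under [nu k]. Since Phi inverts s on the cube, composing
     Phi with a quantile function of [lam] gives back [nu k]. *)
  have [lam [lamE _]] := probability_map (nu k) (ms : measurable_fun setT (s : V -> Rm)).
  have [||q [qnd q02 qE]] := @quantile_function R P lam.
  - by move=> A _; exact: PE.
  - rewrite lamE (_ : _ @^-1` _ = setT) ?probability_setT//.
    by apply/seteqP; split => // x _; rewrite /= in_itv/=; exact: s02.
  exists q; split => // A mA.
  rewrite comp_preimage -qE; last exact: preV.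
  rewrite lamE (probability_setI mcube mA (nur k)).
  rewrite [RHS](probability_setI mcube _ (nur k)); last first.
    by rewrite -comp_preimage; rewrite -[X in measurable X]setTI; apply: (measurableT_comp mPhi ms).
  congr (nu k _); apply/seteqP; split => x [Ax xr]; split => //=.
    by rewrite PhiK.
  by move: Ax; rewrite /= PhiK.
have [q [f [D [qnd fk cD qcvg]]]] := @nondecreasing_cvg_countable R q_ 2
  (fun k => let: And3 h _ _ := hq k in h) (fun k => let: And3 _ h _ := hq k in h).
pose X : Rm -> V := Phi \o q.
pose X_ k : Rm -> V := Phi \o q_ (f k).
have mX : measurable_fun setT X.
  by apply: (measurableT_comp mPhi); exact: nondecreasing_measurable.
have mX_ k : measurable_fun setT (X_ k).
  apply: (measurableT_comp mPhi); apply: nondecreasing_measurable => //.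
  by case: (hq (f k)).
have [mu [muE _]] := probability_map P mX.
exists mu, f; split => //.
  rewrite muE (_ : X @^-1` _ = setT) ?probability_setT//.
  by apply/seteqP; split => // u _; exact: cubePhi.
rewrite (mutual_map mX mW W0 (fun A _ => muE A)).
have -> : (fun k => mutual W (nu (f k)) (nu (f k))) =
    (fun k => \int[P]_v \int[P]_u W (X_ k u - X_ k v)%R).
  apply/funext => k; apply: mutual_map => //.
  by move=> A mA; case: (hq (f k)) => _ _; exact.
(* Off this P-null set the parameter lies in ]0, 1[ and outside D, so the variables [X_ k] converge
   there. *)
pose N : set Rm := D `|` ~` `]0%R, 1%R[%classic.
have mD : measurable (D : set Rm) by exact: countable_measurable.
have mN : measurable N by apply: measurableU => //; exact: measurableC.
have PN : P N = 0.
  rewrite PE setIUl setICl setU0; apply/eqP; rewrite eq_le measure_ge0 andbT.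
  rewrite -(countable_lebesgue_measure0 cD); apply: le_measure; rewrite ?inE//.
  exact: measurableI.
have aeN (Q : Rm -> Prop) : (forall u, ~ N u -> Q u) -> {ae P, forall u, setT u -> Q u}.
  by move=> h; exists N; split => // u hu; apply: contrapT => nu'; apply: hu => _; exact: h.
have Xcvg u i : ~ N u -> (fun k => X_ k u 0%R i) @ \oo --> X u 0%R i.
  move=> nNu; have [nD u01] : ~ D u /\ (0 < u < 1)%R.
    split=> [Du|]; first by apply: nNu; left.
    by apply: contrapT => h; apply: nNu; right; rewrite /= in_itv.
  have Phii : {for q u, continuous (fun t => Phi t 0%R i)} by exact: cPhi.
  exact: (continuous_cvg _ Phii (qcvg u u01 nD)).
have mWX (Y Z : Rm -> V) : measurable_fun setT Y -> measurable_fun setT Z ->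
    measurable_fun setT (fun t : Rm * Rm => W (Y t.2 - Z t.1)%R).
  move=> mY mZ; apply: (measurableT_comp mW); apply: measurable_funB_rV.
    exact: (measurableT_comp mY measurable_snd).
  exact: (measurableT_comp mZ measurable_fst).
have mWX1 (Y : Rm -> V) (y : V) : measurable_fun setT Y ->
    measurable_fun setT (fun u : Rm => W (Y u - y)%R).
  by move=> mY; apply: (measurableT_comp mW); exact: measurable_funB_rV.
have mI (Y : Rm -> V) : measurable_fun setT Y ->
    measurable_fun setT (fun v : Rm => \int[P]_u W (Y u - Y v)%R).
  by move=> mY; exact: (measurable_fun_fubini_tonelli_F (m2 := P) _ (mWX Y Y mY mY)).
apply: (le_trans _ (fatou P measurableT (f := fun k v => \int[P]_u W (X_ k u - X_ k v)%R) _ _)).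
- apply: ae_ge0_le_integral => //.
  + by move=> v _; exact: integral_ge0.
  + exact: mI.
  + by move=> v _; apply: limn_einf_ge0 => k; exact: integral_ge0.
  + by apply: measurable_limn_einf => k; exact: mI.
  + apply: (aeN) => v nNv.
    apply: (le_trans _ (fatou P measurableT (f := fun k u => W (X_ k u - X_ k v)%R) _ _)).
    * apply: ae_ge0_le_integral => //.
      - exact: mWX1.
      - by move=> u _; exact: limn_einf_ge0.
      - by apply: measurable_limn_einf => k; exact: mWX1.
      - apply: (aeN) => u nNu; apply: (Wlsc (fun k => X_ k u - X_ k v)%R) => i.
        rewrite (_ : (fun k => _) = (fun k => X_ k u 0%R i - X_ k v 0%R i)%R).
          by rewrite !mxE; apply: cvgB; exact: Xcvg.
        by apply/funext => k; rewrite !mxE.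
    * by move=> k; exact: mWX1.
    * by move=> k u _.
- by move=> k; exact: mI.
- by move=> k v _; exact: integral_ge0.
Qed.

End compactness.

(** * Variational arguments *)

Section interaction.
Context {R : realType} {n : nat}.
Local Notation V := 'rV[R]_n.
Implicit Types mu nu P : probability V R.
Context (W : V -> \bar R) (mW : measurable_fun setT W).
Local Open Scope ereal_scope.
Context (W0 : forall x, 0 <= W x).

Definition potential mu (y : V) : \bar R := \int[mu]_x W (x - y)%R.

Lemma potential_ge0 mu y : 0 <= potential mu y.
Proof. exact: integral_ge0. Qed.

Lemma measurable_potential mu : measurable_fun setT (potential mu).
Proof.
have mWs := measurable_sub_swap mW.
exact: (measurable_fun_fubini_tonelli_F (m2 := mu) (fun z : V * V => W (z.2 - z.1)%R)).
Qed.

Lemma measurable_interaction (y : V) : measurable_fun setT (fun x : V => W (x - y)%R).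
Proof. by apply: (measurableT_comp mW); exact: measurable_funB_rV. Qed.

Lemma mutual_potential mu nu : mutual W mu nu = \int[mu]_y potential nu y.
Proof. by []. Qed.

Lemma mutual_isometry mu nu (X : V -> V) : measurable_fun setT X ->
  (forall A, measurable A -> nu A = mu (X @^-1` A)) ->
  (forall x y, W (X x - X y)%R = W (x - y)%R) ->
  mutual W nu nu = mutual W mu mu.
Proof.
move=> mX nuE WX; rewrite (mutual_map mX mW W0 nuE).
by apply: eq_integral => y _; apply: eq_integral => x _.
Qed.

Context (Weven : forall x, W (- x)%R = W x).

Lemma mutualC mu nu : mutual W mu nu = mutual W nu mu.
Proof.
have mWs := measurable_sub_swap mW.
transitivity (\int[nu]_x \int[mu]_y W (x - y)%R).
  exact: (fubini_tonelli (m1 := mu) (m2 := nu) (fun z : V * V => W (z.2 - z.1)%R) mWs).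
by apply: eq_integral => x _; apply: eq_integral => y _; rewrite -Weven opprB.
Qed.

Lemma mix_square (p l : R) (a b c : \bar R) : (0 <= p)%R -> (0 <= l)%R ->
  0 <= a -> 0 <= b -> 0 <= c ->
  p%:E * (p%:E * a + l%:E * b) + l%:E * (p%:E * b + l%:E * c) =
  (p ^+ 2)%:E * a + (2 * (l * p))%:E * b + (l ^+ 2)%:E * c.
Proof.
move=> p0 l0 a0 b0 c0.
have z (r : R) (x : \bar R) : (0 <= r)%R -> 0 <= x -> 0 <= r%:E * x by move=> *; exact: mule_ge0.
rewrite !ge0_muleDr ?z// !muleA -!EFinM -!expr2 addeA; congr (_ + _).
rewrite -addeA; congr (_ + _).
rewrite -ge0_muleDl ?lee_fin ?mulr_ge0// -EFinD; congr (_%:E * _); ring.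
Qed.

Lemma mutual_mix (l : R) mu nu P : (0 <= l <= 1)%R ->
  (forall g, measurable_fun setT g -> (forall x, 0 <= g x) ->
     \int[P]_x g x = (1 - l)%:E * \int[mu]_x g x + l%:E * \int[nu]_x g x) ->
  mutual W P P = ((1 - l) ^+ 2)%:E * mutual W mu mu +
    (2 * (l * (1 - l)))%:E * mutual W nu mu + (l ^+ 2)%:E * mutual W nu nu.
Proof.
move=> /andP[l0 l1] PI; have l1' : (0 <= 1 - l)%R by rewrite subr_ge0.
have pP y : potential P y = (1 - l)%:E * potential mu y + l%:E * potential nu y.
  by apply: PI => //; exact: measurable_interaction.
have mp Q := @measurable_potential Q; have p0 := potential_ge0.
rewrite mutual_potential PI//.
have E (Q : probability V R) : \int[Q]_y potential P y = (1 - l)%:E * mutual W Q mu + l%:E * mutual W Q nu.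
  under eq_integral do rewrite pP.
  have pz (r : R) mu' : (0 <= r)%R -> forall y, setT y -> 0 <= r%:E * potential mu' y.
    by move=> r0 y _; exact: mule_ge0.
  have mz (r : R) mu' : measurable_fun setT (fun y => r%:E * potential mu' y).
    exact: measurable_funeM.
  rewrite (ge0_integralD Q measurableT (pz _ _ l1') (mz _ _) (pz _ _ l0) (mz _ _)).
  by rewrite !ge0_integralZl.
by rewrite !E (mutualC mu nu) mix_square ?mutual_ge0.
Qed.

(** Along the segment from mu to nu the energy has initial slope 2 (M - I), where M is the mutual
    energy and I that of mu; at a minimum it cannot be negative. *)
Lemma first_variation mu nu :
  (forall l P, (0 <= l <= 1)%R ->
     (forall A, P A = (1 - l)%:E * mu A + l%:E * nu A) -> mutual W mu mu <= mutual W P P) ->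
  mutual W mu mu < +oo -> mutual W nu nu < +oo -> mutual W mu mu <= mutual W nu mu.
Proof.
move=> hmin; rewrite -!ge0_fin_numE ?mutual_ge0// => /fineK fI /fineK fJ.
rewrite leNgt; apply/negP => lt.
have /fineK fM : mutual W nu mu \is a fin_num.
  by rewrite ge0_fin_numE ?mutual_ge0// (lt_trans lt)// -fI ltry.
have J0 : (0 <= fine (mutual W nu nu))%R by rewrite fine_ge0// mutual_ge0.
have I0 : (0 <= fine (mutual W mu mu))%R by rewrite fine_ge0// mutual_ge0.
move: lt; rewrite -fM -fI lte_fin => lt.
set I := fine (mutual W mu mu) in fI I0 lt *; set J := fine (mutual W nu nu) in fJ J0.
set M := fine (mutual W nu mu) in fM lt.
pose e : R := (I - M)%R; have e0 : (0 < e)%R by rewrite subr_gt0.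
have d0 : (0 < 2 * e + J)%R by lra.
(* The change of energy is l (l (J - I) - 2 (1 - l) e). As I >= 0, the choice l (2 e + J) = e makes
   it at most - l e. *)
pose l : R := (e / (2 * e + J))%R.
have lE : (l * (2 * e + J) = e)%R by rewrite /l mulfVK// gt_eqF.
have l0 : (0 < l)%R by rewrite divr_gt0.
have l1 : (l <= 1)%R by rewrite ler_pdivrMr//; lra.
have l01 : (0 <= l <= 1)%R by rewrite (ltW l0).
have [P [PA PI]] := probability_mix mu nu l01.
have := hmin l P l01 PA; rewrite (mutual_mix l01 PI) -fI -fJ -fM -!EFinM -!EFinD lee_fin.
apply/negP; rewrite -ltNge.
have -> : M = (I - e)%R by rewrite /e; lra.
suff : (l * (l * (J - I) - 2 * (1 - l) * e) < 0)%R by nra.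
by rewrite pmulr_rlt0//; nra.
Qed.

End interaction.

Section minimizers.
Context {R : realType} {n : nat}.
Local Notation V := 'rV[R]_n.
Implicit Types mu nu P : probability V R.
Context (W : V -> \bar R) (mW : measurable_fun setT W).
Local Open Scope ereal_scope.
Context (W0 : forall x, 0 <= W x).
Context (Weven : forall x, W (- x)%R = W x).

Lemma limn_einf_le_frequently (u : nat -> \bar R) (L : \bar R) :
  (forall (e : R) k, (0 < e)%R -> exists2 m, (k <= m)%N & u m <= L + e%:E) ->
  limn_einf u <= L.
Proof.
move=> h; rewrite limn_einf_lim; apply: lime_le; first exact: is_cvg_einfs.
apply: nearW => k; apply/lee_addgt0Pr => e e0; have [m km um] := h e k e0.
by apply: le_trans um; apply: ereal_inf_lbound; exists m.
Qed.

(** Each of the two integrals brings a factor c, and W >= 0 allows enlarging the domain from A to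
    the whole space. *)
Lemma mutual_restr_le mu P (A : set V) (c : R) : measurable A -> (0 <= c)%R ->
  (forall g, measurable_fun setT g -> (forall x, 0 <= g x) ->
     \int[P]_x g x = c%:E * \int[mu]_(x in A) g x) ->
  mutual W P P <= (c ^+ 2)%:E * mutual W mu mu.
Proof.
move=> mA c0 PI.
have p0 := potential_ge0 W0; have mp (Q : probability V R) := measurable_potential mW W0 Q.
have le_in (g : V -> \bar R) : measurable_fun setT g -> (forall x, 0 <= g x) ->
    \int[P]_x g x <= c%:E * \int[mu]_x g x.
  by move=> mg g0; rewrite PI// lee_wpmul2l ?lee_fin//; exact: ge0_subset_integral.
have pP y : potential W P y <= c%:E * potential W mu y.
  by apply: le_in => //; exact: measurable_interaction.
rewrite expr2 EFinM -muleA !mutual_potential.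
apply: le_trans (le_in _ (mp P) (p0 P)) _; rewrite lee_wpmul2l ?lee_fin//.
rewrite -(ge0_integralZl mu measurableT (mp mu) (fun y _ => p0 mu y))//.
apply: ge0_le_integral => //.
by apply: measurable_funeM; exact: mp.
Qed.

(* Conditioning mu on the complement of the set {potential > I + 1} would
   decrease the energy to first order. *)
Lemma potential_ae_le mu (C : set V) : measurable C -> mu C = 1 ->
  (forall P, P C = 1 -> mutual W mu mu <= mutual W P P) -> mutual W mu mu < +oo ->
  mu [set y | mutual W mu mu + 1 < potential W mu y] = 0.
Proof.
move=> mC muC hmin Ioo.
have p0 := potential_ge0 W0; have mp (Q : probability V R) := measurable_potential mW W0 Q.
have I0 := mutual_ge0 mu mu W0.
have /fineK fI : mutual W mu mu \is a fin_num by rewrite ge0_fin_numE.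
set I := fine _ in fI.
have {}I0 : (0 <= I)%R by rewrite fine_ge0.
set B := [set _ | _].
have mB : measurable B.
  by rewrite -[B]setTI; apply: emeasurable_fun_o_infty => //; exact: mp.
have mG : measurable (~` B) by exact: measurableC.
apply/eqP; rewrite eq_le measure_ge0 andbT leNgt; apply/negP => B0.
have /fineK fB : mu B \is a fin_num by exact: fin_num_measure.
set b := fine _ in fB; have b0 : (0 < b)%R by rewrite -lte_fin fB.
have GE : mu (~` B) = (1 - b)%:E by rewrite [LHS]probability_setC// -fB EFinB.
have split_I : (I%:E = \int[mu]_(y in B) potential W mu y + \int[mu]_(y in ~` B) potential W mu y).
  rewrite fI mutual_potential -(setUv B) ge0_integral_setU//.
  - by rewrite setUv; exact: mp.
  - by rewrite disj_set2E setICr.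
have intB : ((I + 1) * b)%:E <= \int[mu]_(y in B) potential W mu y.
  rewrite EFinM fB EFinD -integral_cst//; apply: ge0_le_integral => //.
  - by move=> y _; rewrite lee_fin addr_ge0.
  - exact: measurable_funTS.
  - by move=> y; rewrite /B/= -fI => /ltW.
have G0 : 0 <= \int[mu]_(y in ~` B) potential W mu y by exact: integral_ge0.
have /fineK fG : \int[mu]_(y in ~` B) potential W mu y \is a fin_num.
  rewrite ge0_fin_numE//; apply: le_lt_trans (ltry I); rewrite split_I.
  by apply: leeDr; exact: integral_ge0.
set g := fine _ in fG.
(* The excess on B forces the mean of the potential over the complement below I, since g <= I (1 -
   b) - b; the first variation towards the conditioned measure says the opposite. The inequality
   also excludes b = 1. *)
have gle : ((I + 1) * b + g <= I)%R.
  by rewrite -lee_fin EFinD [leRHS]split_I fG leeD2r.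
have g0 : (0 <= g)%R by rewrite fine_ge0.
have b1 : (0 < 1 - b)%R.
  have : (0 <= 1 - b)%R by rewrite -lee_fin -GE.
  by rewrite le_eqVlt => /predU1P[h|//]; nra.
have muG : 0 < mu (~` B) by rewrite GE lte_fin.
have [P [PA PI]] := probability_restr mG muG.
have fineG : fine (mu (~` B)) = (1 - b)%R by rewrite GE.
have c0 : (0 <= (1 - b)^-1)%R by rewrite invr_ge0 ltW.
rewrite fineG in PA PI.
have PC : P C = 1.
  rewrite PA setIC -(probability_setI mC mG muC) GE -EFinM mulVf// gt_eqF//.
have Poo : mutual W P P < +oo.
  by apply: le_lt_trans (mutual_restr_le mG c0 PI) _; rewrite -fI -EFinM ltry.
have hl l (Q : probability V R) : (0 <= l <= 1)%R -> (forall A, Q A = (1 - l)%:E * mu A + l%:E * P A) ->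
    mutual W mu mu <= mutual W Q Q.
  by move=> l01 QA; apply: hmin; rewrite QA muC PC !mule1 -EFinD subrK.
have := first_variation mW W0 Weven hl Ioo Poo.
rewrite (mutual_potential W P) PI// -fI -fG -EFinM lee_fin mulrC ler_pdivlMr//.
by apply/negP; rewrite -ltNge; nra.
Qed.

End minimizers.

(** * From minimizers on cubes to a global minimizer *)

Section global_minimizer.
Context {R : realType} {n : nat}.
Local Notation V := 'rV[R]_n.
Implicit Types mu nu P : probability V R.
Context (W : V -> \bar R) (mW : measurable_fun setT W).
Local Open Scope ereal_scope.
Context (W0 : forall x, 0 <= W x).
Context (Weven : forall x, W (- x)%R = W x).
Context (Wlsc : forall (x_ : nat -> V) (x : V),
  (forall i, (fun k => x_ k 0%R i) @ \oo --> x 0%R i) -> W x <= limn_einf (W \o x_)).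

Lemma cube_minimizer (r : R) : (0 < n)%N -> (0 < r)%R ->
  (exists mu, mu (cube r) = 1 /\ mutual W mu mu < +oo) ->
  exists mu, mu (cube r) = 1 /\
    forall nu, nu (cube r) = 1 -> mutual W mu mu <= mutual W nu nu.
Proof.
move=> n0 r0 [mu1 [mu1r I1]].
pose S := [set mutual W nu nu | nu in [set nu : probability V R | nu (cube r) = 1]].
have inf0 : 0 <= ereal_inf S by apply: le_ereal_inf_tmp => _ [nu _ <-]; exact: mutual_ge0.
have inf_fin : ereal_inf S \is a fin_num.
  by rewrite ge0_fin_numE//; apply: le_lt_trans I1; apply: ereal_inf_lbound; exists mu1.
have /choice[nu hnu] (k : nat) : exists nu : probability V R, nu (cube r) = 1 /\
    mutual W nu nu < ereal_inf S + (k.+1%:R^-1)%:E.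
  have [||_ [nu nur <-] lt] := @lb_ereal_inf_adherent _ S (k.+1%:R^-1) => //.
  by exists nu.
have [mu [f [fk mur le]]] :=
  cube_compactness n0 r0 mW W0 Wlsc (fun k => let: conj h _ := hnu k in h).
exists mu; split => // nu' nu'r; apply: (le_trans le).
apply: (@le_trans _ _ (ereal_inf S)); last by apply: ereal_inf_lbound; exists nu'.
apply: limn_einf_le_frequently => e k e0.
exists (maxn k (Num.truncn e^-1)); first exact: leq_maxl.
set m := maxn _ _; have [_ /ltW h] := hnu (f m); apply: (le_trans h).
rewrite leeD2l// lee_fin -[leRHS]invrK lef_pV2 ?posrE ?invr_gt0//.
apply: (le_trans (ltW (truncnS_gt _))); rewrite ler_nat ltnS.
by apply: leq_trans (fk m); exact: leq_maxr.
Qed.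

Context (k C : R).
Context (k0 : (0 < k)%R).
Context (C0 : (0 <= C)%R).
Context (Wcoercive : forall z, (k * dotrV z z)%:E <= W z + C%:E).

Lemma measurable_dist2 (y : V) : measurable_fun setT (fun x : V => (dotrV (x - y) (x - y))%:E).
Proof.
apply/measurable_EFinP.
by apply: (measurableT_comp (measurable_dotrV : measurable_fun setT (fun z : V => _)));
  exact: measurable_funB_rV.
Qed.

Lemma integral_dist2_le mu (y : V) (b : R) : potential W mu y <= b%:E ->
  \int[mu]_x (dotrV (x - y) (x - y))%:E <= ((b + C) / k)%:E.
Proof.
move=> pb; have d0 (x : V) : 0 <= (dotrV (x - y) (x - y))%:E by rewrite lee_fin dotrV_ge0.
have md := measurable_dist2 y; have mWy := measurable_interaction mW y.
have md' : measurable_fun setT (fun x : V => k%:E * (dotrV (x - y) (x - y))%:E).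
  exact: measurable_funeM.
have k0' : 0 <= k%:E by rewrite lee_fin ltW.
rewrite mulrC EFinM lee_pdivlMl// EFinD.
rewrite -(ge0_integralZl mu measurableT md (fun x _ => d0 x) k0').
apply: (@le_trans _ _ (\int[mu]_x (W (x - y)%R + C%:E))).
  apply: ge0_le_integral => //.
  - by move=> x _; exact: mule_ge0.
  - exact: emeasurable_funD.
  - by move=> x _; exact: Wcoercive.
rewrite ge0_integralD// integral_cst// [X in C%:E * X]probability_setT mule1.
exact: leeD2r.
Qed.

Lemma dotrV_sub_le (x y z : V) :
  (dotrV (y - z) (y - z) <= 2 * dotrV (x - y) (x - y) + 2 * dotrV (x - z) (x - z))%R.
Proof.
rewrite /dotrV !mulr_sumr -big_split/=; apply: ler_sum => i _; rewrite !mxE.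
have := sqr_ge0 ((x 0 i - y 0 i) + (x 0 i - z 0 i))%R.
by rewrite expr2; nra.
Qed.

(** By coercivity, points y and z of potential at most I1 + 1 have mean squared distance at most D
    to a mu-random point x. Averaging |y - z|^2 <= 2 |x - y|^2 + 2 |x - z|^2 over x gives 4 D. *)
Lemma minimizer_concentrated mu (S : set V) (I1 : R) : measurable S -> mu S = 1 ->
  (forall P, P S = 1 -> mutual W mu mu <= mutual W P P) -> mutual W mu mu <= I1%:E ->
  exists z, mu [set y | (dotrV (y - z) (y - z) <= 4 * ((I1 + 1 + C) / k))%R] = 1.
Proof.
move=> mS muS hmin I1le.
have Ioo : mutual W mu mu < +oo by apply: le_lt_trans I1le _; exact: ltry.
have B0 := potential_ae_le mW W0 Weven mS muS hmin Ioo.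
set B := [set y | _] in B0.
have mB : measurable B.
  by rewrite -[B]setTI; apply: emeasurable_fun_o_infty => //; exact: measurable_potential.
have G1 : mu (~` B) = 1 by rewrite probability_setC// B0 sube0.
pose D := ((I1 + 1 + C) / k)%R.
have GD y : ~ B y -> \int[mu]_x (dotrV (x - y) (x - y))%:E <= D%:E.
  move=> /negP; rewrite -leNgt => h; apply: integral_dist2_le; apply: (le_trans h).
  by rewrite EFinD leeD2r.
have [z Gz] : exists z, (~` B) z.
  apply/set0P/eqP => h; move: G1; rewrite h measure0 => /eqP.
  by rewrite eq_sym onee_eq0.
have mS' : measurable [set y : V | (dotrV (y - z) (y - z) <= 4 * D)%R].
  have -> : [set y : V | (dotrV (y - z) (y - z) <= 4 * D)%R] =
      setT `&` [set y | (dotrV (y - z) (y - z))%:E <= (4 * D)%:E] by rewrite setTI.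
  by apply: emeasurable_fun_infty_c => //; exact: measurable_dist2.
exists z; apply/eqP; rewrite eq_le probability_le1//= -G1.
apply: le_measure; rewrite ?inE//; first exact: measurableC.
move=> y Gy /=; rewrite -lee_fin.
have d0 (t x : V) : 0 <= (dotrV (x - t) (x - t))%:E by rewrite lee_fin dotrV_ge0.
have md t := measurable_dist2 t.
have -> : (dotrV (y - z) (y - z))%:E = \int[mu]_x (dotrV (y - z) (y - z))%:E.
  by rewrite integral_cst// [X in _ * X]probability_setT mule1.
apply: (@le_trans _ _ (2%:E * \int[mu]_x (dotrV (x - y) (x - y))%:E +
    2%:E * \int[mu]_x (dotrV (x - z) (x - z))%:E)); last first.
  rewrite (_ : (4 * D)%:E = 2%:E * D%:E + 2%:E * D%:E); last first.
    by rewrite -!EFinM -EFinD; congr EFin; lra.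
  by apply: leeD; rewrite lee_wpmul2l// GD.
have m2 t : measurable_fun setT (fun x : V => 2%:E * (dotrV (x - t) (x - t))%:E).
  exact: measurable_funeM.
have p2 t : forall x : V, setT x -> 0 <= 2%:E * (dotrV (x - t) (x - t))%:E.
  by move=> x _; exact: mule_ge0.
rewrite -!(ge0_integralZl mu measurableT (md _) (fun x _ => d0 _ x))//.
rewrite -(ge0_integralD mu measurableT (p2 _) (m2 _) (p2 _) (m2 _)).
apply: ge0_le_integral => //.
- exact: emeasurable_funD.
- by move=> x _; rewrite -!EFinM -EFinD lee_fin dotrV_sub_le.
Qed.

Lemma probability1_subset mu (A B : set V) : measurable A -> measurable B ->
  A `<=` B -> mu A = 1 -> mu B = 1.
Proof.
move=> mA mB AB mA1; apply/eqP; rewrite eq_le probability_le1//= -mA1.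
by apply: le_measure; rewrite ?inE.
Qed.

Lemma cube_probability_cvg nu : (fun j => fine (nu (cube j.+1%:R))) @ \oo --> (1 : R)%R.
Proof.
have cup : \bigcup_j cube j.+1%:R = [set: V].
  rewrite -subTset => x _; exists (Num.truncn (enorm x)) => // i.
  have := coord_le_enorm x i; rewrite ler_norml => /andP[h1 h2].
  by have := truncnS_gt (enorm x); move=> h; apply/andP; split; lra.
have mc j : measurable (cube j.+1%:R : set V) by exact: measurable_cube.
have : nu (cube j.+1%:R) @[j --> \oo] --> nu (\bigcup_j cube j.+1%:R).
  apply: nondecreasing_cvg_mu => //; first by rewrite cup.
  move=> i j ij; apply/subsetPset => x h t; have /andP[h1 h2] := h t.
  have : (i.+1%:R <= j.+1%:R :> R)%R by rewrite ler_nat ltnS.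
  by move=> h'; apply/andP; split; lra.
rewrite cup probability_setT; exact: fine_cvg.
Qed.

Lemma global_minimizer_exists : (0 < n)%N ->
  (exists mu, mu (cube 1) = 1 /\ mutual W mu mu < +oo) ->
  exists mu0 r, mu0 (cube r) = 1 /\ forall nu, mutual W mu0 mu0 <= mutual W nu nu.
Proof.
move=> n0 [mu1 [mu11 mu1oo]].
have mc r : measurable (cube r : set V) by exact: measurable_cube.
have /fineK fI1 : mutual W mu1 mu1 \is a fin_num by rewrite ge0_fin_numE ?mutual_ge0.
set I1 := fine _ in fI1; have I10 : (0 <= I1)%R by rewrite fine_ge0// mutual_ge0.
(* The bound from [minimizer_concentrated]. It is the same for all cubes because [mu1], living on
   the unit cube, competes on each of them. *)
pose D := (4 * ((I1 + 1 + C) / k))%R.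
have D0 : (0 <= D)%R by rewrite mulr_ge0// divr_ge0// ?addr_ge0// ltW.
(* Any radius with r0^2 >= D holds the translated minimizers; r0 >= 1 keeps [mu1] admissible. *)
pose r0 := (1 + D)%R; have r01 : (1 <= r0)%R by rewrite lerDl.
have cubeS (r s : R) : (r <= s)%R -> cube r `<=` (cube s : set V).
  by move=> rs x h i; have /andP[h1 h2] := h i; apply/andP; split; lra.
have cube1 (r : R) : (1 <= r)%R -> mu1 (cube r) = 1.
  by move=> r1; apply: (@probability1_subset mu1 (cube 1)) => //; exact: cubeS.
have step (r : R) : (1 <= r)%R -> exists mu, mu (cube r0) = 1 /\
    forall nu, nu (cube r) = 1 -> mutual W mu mu <= mutual W nu nu.
  move=> r1; have r_gt0 : (0 < r)%R by lra.
  have [|mu [mur hmin]] := cube_minimizer n0 r_gt0; first by exists mu1; rewrite cube1.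
  have I1le : mutual W mu mu <= I1%:E by rewrite fI1; apply: hmin; exact: cube1.
  have [z hz] := minimizer_concentrated (mc r) mur hmin I1le.
  have mX : measurable_fun setT (fun y : V => y - z)%R by exact: measurable_funB_rV.
  have [mu' [mu'E _]] := probability_map mu mX.
  exists mu'; split; last first.
    move=> nu nur; rewrite (mutual_isometry mW W0 mX (fun A _ => mu'E A)); first exact: hmin.
    by move=> x y; rewrite opprB addrA subrK.
  rewrite mu'E; apply: (probability1_subset _ _ _ hz).
  - have -> : [set y : V | (dotrV (y - z) (y - z) <= D)%R] =
        setT `&` [set y | (dotrV (y - z) (y - z))%:E <= D%:E] by rewrite setTI.
    by apply: emeasurable_fun_infty_c => //; exact: measurable_dist2.
  - by rewrite -[X in measurable X]setTI; apply: mX => //.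
  - move=> y /= hy i; have := coord_le_enorm (y - z)%R i; rewrite -ler_norml => h.
    apply: (le_trans h); rewrite -(ler_pXn2r (n := 2))// ?nnegrE ?enorm_ge0//; last by lra.
    rewrite enorm_sqr; apply: (le_trans hy); rewrite -/D /r0; nra.
have r00 : (0 < r0)%R by lra.
have [|mu0 [mu0r hmin0]] := cube_minimizer n0 r00; first by exists mu1; rewrite cube1.
exists mu0, r0; split => // nu.
(* The translate of a minimizer on a larger cube lives on the cube of half-side r0, where [mu0] does
   at least as well. *)
have {step}hmin (r : R) P : (1 <= r)%R -> P (cube r) = 1 -> mutual W mu0 mu0 <= mutual W P P.
  move=> r1 Pr; have [mu [mur h]] := step r r1.
  exact: (le_trans (hmin0 _ mur) (h _ Pr)).
have [->|/eqP nuoo] := eqVneq (mutual W nu nu) +oo; first by rewrite leey.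
have /fineK fJ : mutual W nu nu \is a fin_num.
  by rewrite ge0_fin_numE ?mutual_ge0// ltey; apply/eqP.
have /fineK fI : mutual W mu0 mu0 \is a fin_num.
  by rewrite ge0_fin_numE ?mutual_ge0// (le_lt_trans _ mu1oo)// (hmin 1%R).
set J := fine _ in fJ; set I := fine _ in fI.
have J0 : (0 <= J)%R by rewrite fine_ge0// mutual_ge0.
rewrite -fI -fJ lee_fin.
pose a j := fine (nu (cube j.+1%:R)).
(* Conditioned on a cube of mass a, nu has at most a^(-2) times its energy, and it competes on that
   cube. The masses a tend to 1. *)
have aI j : (I * a j ^+ 2 <= J)%R.
  have := measure_ge0 nu (cube j.+1%:R); rewrite le_eqVlt => /predU1P[h|h].
    by rewrite /a -h/= expr0n/= mulr0.
  have fa : nu (cube j.+1%:R) = (a j)%:E by rewrite fineK// fin_num_measure.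
  have a0 : (0 < a j)%R by rewrite -lte_fin -fa.
  have [P [PA PI]] := probability_restr (mc _) h.
  have c0 : (0 <= (a j)^-1)%R by rewrite invr_ge0 ltW.
  have P1 : P (cube j.+1%:R) = 1.
    by rewrite PA setIid fa -EFinM mulVf// gt_eqF.
  have j1 : (1 <= j.+1%:R :> R)%R by rewrite ler1n.
  have := le_trans (hmin _ _ j1 P1) (mutual_restr_le mW W0 (mc _) c0 PI).
  rewrite -fI -fJ -EFinM lee_fin exprVn mulrC ler_pdivlMr// exprn_gt0//.
have aC : (fun j => I * a j ^+ 2)%R @ \oo --> (I * 1 ^+ 2)%R.
  apply: cvgMr; under eq_fun do rewrite expr2; rewrite expr2.
  by apply: cvgM; exact: cube_probability_cvg.
rewrite expr1n mulr1 in aC; rewrite -(cvg_lim _ aC)//.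
by apply: limr_le; [apply/cvg_ex; exists I|exact: nearW].
Qed.

End global_minimizer.

(** * Affine images, supports and Wasserstein distance along segments *)

Section affine_images.
Context {R : realType} {n : nat}.
Local Notation V := 'rV[R]_n.
Implicit Types mu nu : probability V R.

Lemma integral_image mu nu (X : V -> V) : measurable_fun setT X ->
  (forall g : V -> \bar R, measurable_fun setT g -> (forall x, 0 <= g x)%E ->
     (\int[nu]_x g x = \int[mu]_x g (X x))%E) ->
  forall g : V -> R, measurable_fun setT g ->
  (\int[nu]_x (g x)%:E = \int[mu]_x (g (X x))%:E)%E.
Proof.
move=> mX h g mg; rewrite [LHS]integralE [RHS]integralE.
have mgE : measurable_fun setT (fun x => (g x)%:E) by exact/measurable_EFinP.
congr (_ - _)%E.
- rewrite h; [by apply: eq_integral => x _; rewrite !funeposE|exact: measurable_funepos|].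
  by move=> x; exact: funepos_ge0.
- rewrite h; [by apply: eq_integral => x _; rewrite !funenegE|exact: measurable_funeneg|].
  by move=> x; exact: funeneg_ge0.
Qed.

Lemma finite_second_moment_image mu nu (X : V -> V) (a b : R) (c : V) :
  measurable_fun setT X -> 0 <= a ->
  (forall g : V -> \bar R, measurable_fun setT g -> (forall x, 0 <= g x)%E ->
     (\int[nu]_x g x = \int[mu]_x g (X x))%E) ->
  (forall x, dotrV (X x) (X x) <= a * dotrV (x - c) (x - c) + b) ->
  finite_second_moment mu -> finite_second_moment nu.
Proof.
move=> mX a0 h Xle mu2; rewrite /finite_second_moment.
have men : measurable_fun setT (fun x : V => (enorm x ^+ 2)%:E).
  by apply/measurable_EFinP; apply: measurable_funX; exact: measurable_enorm.
rewrite h//; last by move=> x; rewrite lee_fin sqr_ge0.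
pose f (x : V) := dotrV x x + dotrV (- 2 *: c) x + dotrV c c.
have fE x : f x = dotrV (x - c) (x - c) by rewrite /f -dotrVBB.
have mf : measurable_fun setT (fun x : V => (dotrV (x - c) (x - c))%:E).
  exact: measurable_dist2.
have m1 : measurable_fun setT (fun x => (enorm (X x) ^+ 2)%:E) by exact: (measurableT_comp men).
have m2 : measurable_fun setT (fun x : V => (a%:E * (dotrV (x - c) (x - c))%:E)%E).
  exact: measurable_funeM.
have m3 : measurable_fun setT (fun x : V => (a%:E * (dotrV (x - c) (x - c))%:E + `|b|%:E)%E).
  exact: emeasurable_funD.
have d0 (x : V) : (0 <= (dotrV (x - c) (x - c))%:E)%E by rewrite lee_fin dotrV_ge0.
have p2 (x : V) : (0 <= a%:E * (dotrV (x - c) (x - c))%:E)%E by exact: mule_ge0.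
have le x : ((enorm (X x) ^+ 2)%:E <= a%:E * (dotrV (x - c) (x - c))%:E + `|b|%:E)%E.
  by rewrite -EFinM -EFinD lee_fin enorm_sqr (le_trans (Xle x))// lerD2l ler_norm.
apply: (@le_lt_trans _ _ (\int[mu]_x (a%:E * (dotrV (x - c) (x - c))%:E + `|b|%:E))%E).
  by apply: ge0_le_integral => // x _; rewrite ?lee_fin ?sqr_ge0.
rewrite ge0_integralD// integral_cst// [X in (_ + _ * X)%E]probability_setT mule1.
rewrite ge0_integralZl//; under eq_integral do rewrite -fE.
by rewrite integral_quadratic// -EFinM -EFinD ltry.
Qed.

Lemma center_of_mass_image mu nu (X : V -> V) (Q : 'M[R]_n) (b : V) :
  measurable_fun setT X ->
  (forall g : V -> \bar R, measurable_fun setT g -> (forall x, 0 <= g x)%E ->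
     (\int[nu]_x g x = \int[mu]_x g (X x))%E) ->
  (forall x, X x = x *m Q + b) -> finite_second_moment mu ->
  center_of_mass nu = center_of_mass mu *m Q + b.
Proof.
move=> mX h XE mu2; apply/rowP => i; rewrite mxE /Rintegral.
rewrite (integral_image mX h)//; last exact: measurable_coord_rV.
pose c : V := \row_j Q j i.
have cE (x : V) : (x *m Q + b) 0 i = dotrV c x + b 0 i.
  by rewrite mxE mxE; congr (_ + _); apply: eq_bigr => j _; rewrite mxE mulrC.
under eq_integral do rewrite XE cE.
by rewrite integral_affine//= cE.
Qed.

End affine_images.

Section support.
Context {R : realType} {n : nat}.
Local Notation V := 'rV[R]_n.

Lemma compact_cube (r : R) : compact (cube r : set V).
Proof.
rewrite cubeE; apply: (@rV_compact _ n (fun=> `[(- r)%R, r]%classic)) => _.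
exact: segment_compact.
Qed.

(** The support is closed by its definition, and the complement of the compact cube is an open null
    set. *)
Lemma compact_measure_support (mu : probability V R) (r : R) :
  mu (cube r) = 1%E -> compact (measure_support mu).
Proof.
move=> mur; apply: subclosed_compact (@compact_cube r) _.
  move=> x hx A oA Ax; have [y [hy Ay]] := hx A (open_nbhs_nbhs (conj oA Ax)).
  exact: hy.
move=> x hx; apply: contrapT => nx.
have oC : open (~` (cube r : set V)).
  by apply: closed_openC; apply: compact_closed (@compact_cube r); exact: norm_hausdorff.
have := hx _ oC nx; rewrite probability_setC ?mur ?subee ?ltxx//.
exact: measurable_cube.
Qed.

End support.

Section wasserstein.
Context {R : realType} {n : nat}.
Local Notation V := 'rV[R]_n.
Implicit Types mu nu : probability V R.
Local Open Scope ereal_scope.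

(* The coupling leaves the mass 1 - l in place and sends the mass l of mu to nu
   by the product coupling. *)
Lemma wasserstein2_mix mu nu (P : probability V R) (l : R) : (0 <= l <= 1)%R ->
  (forall A, P A = (1 - l)%:E * mu A + l%:E * nu A) ->
  finite_second_moment mu -> finite_second_moment nu ->
  wasserstein2 mu P <= (Num.sqrt (l * dist2 mu nu))%:E.
Proof.
move=> l01 PE mu2 nu2; have /andP[l0 l1] := l01.
have mdiag : measurable_fun setT (fun x : V => (x, x)) by exact: measurable_fun_pair.
have [D [DE DI]] := probability_map mu mdiag.
have [Q [QE QI]] := probability_mix D (probability_prod mu nu) l01.
have pE A B : measurable A -> measurable B ->
    probability_prod mu nu (A `*` B) = mu A * nu B.
  by move=> mA mB; exact: product_measure1E.
have diagE A B : (fun x : V => (x, x)) @^-1` (A `*` B) = A `&` B by [].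
have cQ : coupling mu P Q.
  split=> A mA; rewrite QE DE pE// diagE ?setIT ?setTI probability_setT ?mule1 ?mul1e.
    by rewrite -muleDl ?fin_num_measure// -EFinD subrK mul1e.
  by rewrite PE.
have md : measurable_fun setT (fun z : V * V => (enorm (z.1 - z.2)%R ^+ 2)%:E).
  apply/measurable_EFinP; apply: measurable_funX.
  exact: (measurableT_comp measurable_enorm measurable_subrV).
have d0 (z : V * V) : 0 <= (enorm (z.1 - z.2)%R ^+ 2)%:E by rewrite lee_fin sqr_ge0.
have cost : \int[Q]_z (enorm (z.1 - z.2)%R ^+ 2)%:E = (l * dist2 mu nu)%:E.
  rewrite QI// DI// (eq_integral (cst 0)) => [|x _]; last first.
    by rewrite /= enorm_sqr subrr /dotrV big1// => i _; rewrite mxE mul0r.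
  rewrite integral0 mule0 add0e EFinM -integral_dist2//; congr (_ * _).
  rewrite [LHS](fubini_tonelli1 (m1 := mu) (m2 := nu))//.
  apply: eq_integral => x _; apply: eq_integral => y _ /=.
  by rewrite enorm_sqr -dotrVN opprB.
have c0 : (0 <= l * dist2 mu nu)%R by rewrite -lee_fin -cost integral_ge0.
have inf0 : 0 <= ereal_inf [set \int[P0]_z (enorm (z.1 - z.2)%R ^+ 2)%:E | P0 in coupling mu P].
  by apply: le_ereal_inf_tmp => _ [Q' _ <-]; exact: integral_ge0.
rewrite -powR12_sqrt// -poweR_EFin; apply: gt0_ler_poweR.
- by rewrite invr_ge0.
- by rewrite in_itv/= inf0 leey.
- by rewrite in_itv/= lee_fin c0 leey.
- by apply: ereal_inf_lbound; exists Q.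
Qed.

Lemma dist2_ge0 mu nu : finite_second_moment mu -> finite_second_moment nu ->
  (0 <= dist2 mu nu)%R.
Proof.
move=> mu2 nu2; rewrite -lee_fin -integral_dist2//.
by apply: integral_ge0 => y _; apply: integral_ge0 => x _; rewrite lee_fin dotrV_ge0.
Qed.

End wasserstein.

(** * Uniqueness, local minimizers and symmetry *)

Section confined_kernel.
Context {R : realType} {n : nat}.
Local Notation V := 'rV[R]_n.
Implicit Types mu nu P : probability V R.
Context (W : V -> \bar R) (mW : measurable_fun setT W).
Local Open Scope ereal_scope.
Context (W0 : forall x, 0 <= W x).
Context (Wrot : forall (Q : 'M[R]_n) x, (Q *m Q^T = 1%:M)%R -> W (x *m Q)%R = W x).
Context (Wmix : gauss_mixture W).

Lemma kernel_even x : W (- x)%R = W x.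
Proof.
have -> : (- x = x *m (- 1%:M))%R by rewrite mulmxN mulmx1.
by apply: Wrot; rewrite linearN/= mulmxN mulNmx opprK trmx1 mulmx1.
Qed.

Let Weven := kernel_even.

Lemma mutual_strict_convexity mu nu : finite_second_moment mu -> finite_second_moment nu ->
  center_of_mass mu = center_of_mass nu ->
  exists D : \bar R, [/\ 0 <= D,
    2%:E * mutual W mu nu + D = mutual W mu mu + mutual W nu nu &
    D = 0 -> forall S, measurable S -> mu S = nu S].
Proof.
move=> mu2 nu2 cm; have [w [p [q [A [B [[mw mp mq] [w0 d0 WE]]]]]]] := Wmix.
exact: (mutual_sum mw mp mq w0 d0 WE W0 mW mu2 nu2 cm).
Qed.

Lemma translate_exists mu (a : V) : finite_second_moment mu ->
  exists nu, [/\ forall A, nu A = mu ((fun x => x + a)%R @^-1` A),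
    finite_second_moment nu, center_of_mass nu = (center_of_mass mu + a)%R &
    mutual W nu nu = mutual W mu mu].
Proof.
move=> mu2; have mX : measurable_fun setT (fun x : V => x + a)%R by exact: measurable_funD_rV.
have [nu [nuE nuI]] := probability_map mu mX; exists nu; split => //.
- apply: (@finite_second_moment_image _ _ mu nu _ 1 0 (- a)%R mX ler01 nuI) => // x.
  by rewrite opprK mul1r addr0.
- rewrite (@center_of_mass_image _ _ mu nu _ 1%:M a mX nuI) ?mulmx1// => x.
  by rewrite mulmx1.
- apply: (mutual_isometry mW W0 mX (fun A _ => nuE A)) => x y.
  by rewrite opprD addrACA subrr addr0.
Qed.

Section minimal.
Context (mu0 : probability V R).
Context (mu02 : finite_second_moment mu0).
Context (mu0_min : forall nu, mutual W mu0 mu0 <= mutual W nu nu).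
Context (mu0_fin : mutual W mu0 mu0 < +oo).

(** The first variation at [mu0] bounds the mutual energy of mu and [mu0] from below by the minimum;
    the convexity identity then forces D = 0. *)
Lemma minimizer_unique mu : finite_second_moment mu ->
  center_of_mass mu = center_of_mass mu0 -> mutual W mu mu <= mutual W mu0 mu0 ->
  forall S, measurable S -> mu S = mu0 S.
Proof.
move=> mu2 cm le; have [D [D0 DE]] := mutual_strict_convexity mu2 mu02 cm; apply.
have E : mutual W mu mu = mutual W mu0 mu0 by apply/eqP; rewrite eq_le le mu0_min.
have le1 : mutual W mu0 mu0 <= mutual W mu mu0.
  apply: first_variation => //; last by rewrite E.
have /fineK fI : mutual W mu0 mu0 \is a fin_num by rewrite ge0_fin_numE ?mutual_ge0.
move: DE; rewrite E -fI -EFinD => DE.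
have : 2%:E * (fine (mutual W mu0 mu0))%:E + D <= (fine (mutual W mu0 mu0) + fine (mutual W mu0 mu0))%:E.
  by rewrite -DE fI leeD2r// lee_wpmul2l// lee_fin.
have -> : (fine (mutual W mu0 mu0) + fine (mutual W mu0 mu0) = 2 * fine (mutual W mu0 mu0))%R.
  by rewrite mulr_natl mulr2n.
rewrite EFinM -[leRHS]adde0 leeD2lE//= => D0'.
by apply/eqP; rewrite eq_le D0 D0'.
Qed.

Lemma minimizer_translate mu : finite_second_moment mu ->
  mutual W mu mu <= mutual W mu0 mu0 -> is_translate mu0 mu.
Proof.
move=> mu2 le; pose a := (center_of_mass mu0 - center_of_mass mu)%R.
have [nu [nuE nu2 nuc nuW]] := translate_exists a mu2.
exists (- a)%R => A mA.
have mA' : measurable ((fun x : V => x - a)%R @^-1` A).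
  rewrite -[X in measurable X]setTI.
  by apply: (measurable_funB_rV (f := id) (g := cst a)).
rewrite /pushforward -(@minimizer_unique nu)//.
- rewrite nuE; congr (mu _); apply/seteqP; split => x /=; by rewrite addrK.
- by rewrite nuc /a addrCA subrr addr0.
- by rewrite nuW.
Qed.

(** Translating [mu0] to the center of mass of mu makes the energy convex on the segment from mu to
    the translate. A short step along it stays in the d_2-ball and cannot lower the energy, so
    convexity excludes a lower endpoint. *)
Lemma local_minimizer_minimal mu : finite_second_moment mu ->
  d2_local_minimizer W mu -> mutual W mu mu <= mutual W mu0 mu0.
Proof.
move=> mu2 [Efin [e e0 hloc]].
have h2 : (0 <= 2^-1 :> R)%R by rewrite invr_ge0.
have muoo : mutual W mu mu < +oo.
  move: Efin; rewrite /energy -/(mutual W mu mu) !ltey; apply: contra => /eqP ->.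
  by rewrite gt0_muley// lte_fin invr_gt0.
pose a := (center_of_mass mu - center_of_mass mu0)%R.
have [nu [nuE nu2 nuc nuW]] := translate_exists a mu02.
have cm : center_of_mass mu = center_of_mass nu by rewrite nuc /a addrCA subrr addr0.
have [D [D0 DE _]] := mutual_strict_convexity mu2 nu2 cm.
have d0 := dist2_ge0 mu2 nu2.
(* Chosen so that l times [dist2 mu nu] is below e^2; the added e^2 keeps the denominator positive
   when the distance vanishes. *)
pose l := (e ^+ 2 / (dist2 mu nu + e ^+ 2))%R.
have e20 : (0 < e ^+ 2)%R by rewrite exprn_gt0.
have de0 : (0 < dist2 mu nu + e ^+ 2)%R by rewrite ltr_wpDl.
have l0 : (0 < l)%R by rewrite divr_gt0.
have l1 : (l <= 1)%R by rewrite ler_pdivrMr// mul1r lerDr.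
have ld : (l * dist2 mu nu < e ^+ 2)%R.
  by rewrite /l mulrAC ltr_pdivrMr// ltr_pM2l// ltrDl.
have l01 : (0 <= l <= 1)%R by rewrite (ltW l0).
have [P [PE PI]] := probability_mix mu nu l01.
have Pe : wasserstein2 mu P < e%:E.
  apply: le_lt_trans (wasserstein2_mix l01 PE mu2 nu2) _.
  rewrite lte_fin -(ltr_pXn2r (n := 2))// ?nnegrE ?sqrtr_ge0 ?(ltW e0)//.
  by rewrite sqr_sqrtr// mulr_ge0// ltW.
have := hloc P Pe; rewrite /energy -/(mutual W mu mu) -/(mutual W P P).
rewrite lee_pmul2l//.
rewrite (mutual_mix mW W0 Weven l01 PI) (mutualC mW W0 Weven nu mu).
have /fineK fmu : mutual W mu mu \is a fin_num by rewrite ge0_fin_numE ?mutual_ge0.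
have /fineK fnu : mutual W nu nu \is a fin_num.
  by rewrite nuW ge0_fin_numE ?mutual_ge0.
rewrite -nuW -fmu -fnu => h; rewrite -fmu -fnu in DE.
have Mle : 2%:E * mutual W mu nu <= (fine (mutual W mu mu) + fine (mutual W nu nu))%:E.
  by rewrite [leRHS]EFinD -DE leeDl.
have /fineK fM : mutual W mu nu \is a fin_num.
  rewrite ge0_fin_numE ?mutual_ge0// ltey; apply/eqP => h'.
  by move: Mle; rewrite h' gt0_muley// lee_fin.
rewrite -fM -EFinM lee_fin in Mle; move: h; rewrite -fM -!EFinM -!EFinD !lee_fin.
move: Mle; set x := fine (mutual W mu mu); set y := fine (mutual W nu nu).
move: x y (fine _) => x y z Mle h.
have ll : (0 <= l * (1 - l))%R by rewrite mulr_ge0 ?subr_ge0// ltW.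
(* Inserting 2 z <= x + y into x <= (1 - l)^2 x + 2 l (1 - l) z + l^2 y gives x <= (1 - l) x + l y,
   that is l x <= l y. *)
have := ler_wpM2l ll Mle => h3; rewrite -(ler_pM2l l0); nra.
Qed.

(** An orthogonal map about the center of mass preserves this center and the energy, so uniqueness
    identifies the image with [mu0]. *)
Lemma minimizer_radial : radially_symmetric_about (center_of_mass mu0) mu0.
Proof.
move=> Q QQ A mA; set m := center_of_mass mu0.
pose X (x : V) := (m + (x - m) *m Q)%R.
have XE x : X x = (x *m Q + (m - m *m Q))%R by rewrite /X mulmxBl addrCA.
have mX : measurable_fun setT X.
  apply: measurable_funD_rV => //; apply: measurable_fun_mulmx.
  by apply: measurable_funB_rV.
have [nu [nuE nuI]] := probability_map mu0 mX.
rewrite /pushforward -nuE; apply: minimizer_unique => //.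
(* The constants come from |m + v|^2 <= 2 |m|^2 + 2 |v|^2 with v the image of x - m, which has the
   same length. *)
- apply: (@finite_second_moment_image _ _ mu0 nu X 2 (2 * dotrV m m)%R m mX (ler0n _ 2) nuI) => // x.
  have := dotrV_sub_le 0 m (- ((x - m) *m Q))%R.
  by rewrite opprK sub0r add0r dotrVN dotrV_mulmx// => h; rewrite [leRHS]addrC.
- by rewrite (center_of_mass_image mX nuI XE)// addrCA subrr addr0.
- rewrite (mutual_isometry mW W0 mX (fun A _ => nuE A))// => x y.
  by rewrite /X opprD addrACA subrr add0r -mulmxBl opprB addrA subrK Wrot.
Qed.

End minimal.

End confined_kernel.

Section existence.
Context {R : realType} {n : nat}.
Local Notation V := 'rV[R]_n.
Local Open Scope ereal_scope.

Definition has_unique_radial_minimizer (W : V -> \bar R) :=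
  exists mu0 : probability V R,
    [/\ finite_second_moment mu0,
        d2_local_minimizer W mu0 /\
        (forall mu : probability V R, finite_second_moment mu ->
           d2_local_minimizer W mu -> is_translate mu0 mu),
        global_minimizer_P2 W mu0 /\
        (forall mu : probability V R, finite_second_moment mu ->
           global_minimizer_P2 W mu -> is_translate mu0 mu),
        compact (measure_support mu0)
      & radially_symmetric_about (center_of_mass mu0) mu0].

Theorem confined_energy_minimizer (W : V -> \bar R) (k C : R) :
  (0 < n)%N -> measurable_fun setT W -> (forall x, 0 <= W x) ->
  (forall (Q : 'M[R]_n) x, (Q *m Q^T = 1%:M)%R -> W (x *m Q)%R = W x) ->
  (forall (x_ : nat -> V) (x : V),
    (forall i, (fun j => x_ j 0%R i) @ \oo --> x 0%R i) -> W x <= limn_einf (W \o x_)) ->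
  (0 < k)%R -> (0 <= C)%R -> (forall z, (k * dotrV z z)%:E <= W z + C%:E) ->
  gauss_mixture W ->
  (exists mu : probability V R, mu (cube 1) = 1 /\ mutual W mu mu < +oo) ->
  has_unique_radial_minimizer W.
Proof.
move=> n0 mW W0 Wrot Wlsc k0 C0 Wcoer Wmix fin1.
have Weven := kernel_even Wrot.
have [mu0 [r [mu0r min0]]] := global_minimizer_exists mW W0 Weven Wlsc k0 C0 Wcoer n0 fin1.
have mu02 := finite_second_moment_cube mu0r.
have fin0 : mutual W mu0 mu0 < +oo.
  by have [mu1 [_ mu1oo]] := fin1; apply: le_lt_trans mu1oo.
have h2 : 0 <= (2^-1 : R)%:E by rewrite lee_fin invr_ge0.
have Emin (nu : probability V R) : energy W mu0 <= energy W nu by apply: lee_wpmul2l => //; exact: min0.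
exists mu0; split => //.
- split; first split.
  + by rewrite /energy -/(mutual W mu0 mu0) lte_mul_pinfty.
  + by exists 1%R.
  + move=> mu mu2 hmu; apply: (minimizer_translate mW W0 Wrot Wmix) => //.
    exact: (local_minimizer_minimal mW W0 Wrot Wmix).
- split=> // mu mu2 hmu; apply: (minimizer_translate mW W0 Wrot Wmix) => //.
  by have := hmu mu0 mu02; rewrite /energy lee_pmul2l.
- exact: compact_measure_support mu0r.
- exact: (minimizer_radial mW W0 Wrot Wmix).
Qed.

End existence.

(** * Riesz and Newtonian kernels *)

Section mixture_regularity.
Context {R : realType} {n : nat}.
Local Notation V := 'rV[R]_n.
Local Notation leb1 := (@lebesgue_measure R).
Context (W : V -> \bar R).
Local Open Scope ereal_scope.

Lemma gauss_mixture_rot : gauss_mixture W ->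
  forall (Q : 'M[R]_n) x, (Q *m Q^T = 1%:M)%R -> W (x *m Q)%R = W x.
Proof.
move=> [w [p [q [A [B [_ [_ _ WE]]]]]]] Q x QQ.
by rewrite !WE dotrV_mulmx.
Qed.

Lemma gauss_mixture_measurable : gauss_mixture W -> measurable_fun setT W.
Proof.
move=> [w [p [q [A [B [[mw mp mq] [w0 d0 WE]]]]]]].
have mrho : measurable_fun setT (fun t : V * R => dotrV t.1 t.1).
  exact: (measurableT_comp measurable_dotrV measurable_fst).
have m2 (f : R -> R) : measurable_fun setT f -> measurable_fun setT (fun t : V * R => f t.2).
  by move=> mf; exact: (measurableT_comp mf measurable_snd).
have md : measurable_fun setT (fun t : V * R => (mix_dens w p q t.2 (dotrV t.1 t.1))%:E).
  apply/measurable_EFinP; apply: measurable_funD; last exact: m2.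
  apply: measurable_funD; apply: measurable_funM => //; try exact: m2.
  apply: measurableT_comp => //; apply: measurableT_comp => //.
  by apply: measurable_funM => //; apply: m2; exact: measurable_expR.
rewrite (_ : W = fun z => \int[leb1]_u (mix_dens w p q u (dotrV z z))%:E +
                      (A * dotrV z z + B)%:E); last exact/funext.
apply: emeasurable_funD.
  apply: (measurable_fun_fubini_tonelli_F (m2 := leb1) (fun t : V * R =>
    (mix_dens w p q t.2 (dotrV t.1 t.1))%:E) md).
  by move=> t; rewrite lee_fin d0// dotrV_ge0.
apply/measurable_EFinP; apply: measurable_funD => //.
by apply: measurable_funM => //; exact: measurable_dotrV.
Qed.

Lemma le_limn_einf (u v : nat -> \bar R) : (\forall k \near \oo, u k <= v k) ->
  limn_einf u <= limn_einf v.
Proof.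
move=> [N _ uv]; rewrite !limn_einf_lim; apply: lee_lim; try exact: is_cvg_einfs.
exists N => // k Nk; apply: le_ereal_inf_tmp => _ [m km <-].
apply: (le_trans _ (uv m (leq_trans Nk km))).
by apply: ereal_inf_lbound; exists m.
Qed.

(** For each u the density is continuous in z, so Fatou's lemma in u handles the mixture; the affine
    part converges, at the cost of an arbitrary e > 0. *)
Lemma gauss_mixture_lsc : gauss_mixture W ->
  forall (x_ : nat -> V) (x : V),
    (forall i, (fun k => x_ k 0%R i) @ \oo --> x 0%R i) -> W x <= limn_einf (W \o x_).
Proof.
move=> [w [p [q [A [B [[mw mp mq] [w0 d0 WE]]]]]]] x_ x xcvg.
pose rho k := dotrV (x_ k) (x_ k); pose r := dotrV x x.
have rho0 k : (0 <= rho k)%R by exact: dotrV_ge0.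
have rhoC : rho @ \oo --> r.
  rewrite /rho /r /dotrV; apply: cvg_big => [|i _]; first exact: add_continuous.
  by apply: cvgM; exact: xcvg.
have dC u : (fun k => (mix_dens w p q u (rho k))%:E) @ \oo --> (mix_dens w p q u r)%:E.
  apply: cvg_EFin; first exact: nearW.
  apply: cvgD; last exact: cvg_cst.
  apply: cvgD; last by apply: cvgMr.
  apply: cvgMr; apply: (@continuous_cvg _ _ _ _ _ _ expR); first exact: continuous_expR.
  by apply: cvgN; exact: cvgMr.
have bC : (fun k => A * rho k + B)%R @ \oo --> (A * r + B)%R.
  by apply: cvgD; [exact: cvgMr|exact: cvg_cst].
have md t : measurable_fun setT (fun u : R => (mix_dens w p q u t)%:E).
  apply/measurable_EFinP; apply: measurable_funD => //; apply: measurable_funD.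
    apply: measurable_funM => //; apply: measurableT_comp => //.
    by apply: measurableT_comp => //; apply: measurable_funM.
  by apply: measurable_funM.
pose J k := \int[leb1]_u (mix_dens w p q u (rho k))%:E.
have Jle : \int[leb1]_u (mix_dens w p q u r)%:E <= limn_einf J.
  rewrite (_ : \int[leb1]_u (mix_dens w p q u r)%:E =
      \int[leb1]_u limn_einf (fun k => (mix_dens w p q u (rho k))%:E)).
    apply: fatou => //.
    - by move=> k; exact: md.
    - by move=> k u _; rewrite lee_fin d0.
  apply: eq_integral => u _; rewrite is_cvg_limn_einfE; last by apply/cvg_ex; eexists; exact: dC.
  by apply/esym/cvg_lim => //; exact: dC.
apply/lee_addgt0Pr => e e0.
rewrite WE -/r addeC [leRHS]addeC; apply: (le_trans (leeD2l _ Jle)).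
rewrite -!limn_einf_shift//; apply: le_limn_einf.
have /cvgrPdist_lt/(_ _ e0) := bC; apply: filterS => k hk /=.
rewrite WE -/(rho k) -/(J k) (addeCA e%:E) (addeC (A * r + B)%:E); apply: leeD2l.
rewrite -EFinD lee_fin.
by move: hk; rewrite ltr_norml => /andP[h1 h2]; lra.
Qed.

End mixture_regularity.

Section kernel_energy.
Context {R : realType} {n : nat}.
Local Notation V := 'rV[R]_n.
Local Notation leb := (lebesgue_rV R n).
Local Open Scope ereal_scope.

Implicit Types (f g : V -> \bar R) (mu nu : probability V R).

Lemma le_mutual f g mu nu : measurable_fun setT f -> measurable_fun setT g ->
  (forall z, 0 <= f z) -> (forall z, f z <= g z) -> mutual f mu nu <= mutual g mu nu.
Proof.
move=> mf mg f0 fg; have g0 z : 0 <= g z := le_trans (f0 z) (fg z).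
have mp := measurable_potential.
apply: ge0_le_integral => //.
- by move=> y _; exact: integral_ge0.
- exact: (measurable_potential mf).
- exact: (measurable_potential mg).
move=> y _; apply: ge0_le_integral => //.
- exact: measurable_interaction.
- exact: measurable_interaction.
Qed.

Lemma mutualD f g mu nu : measurable_fun setT f -> measurable_fun setT g ->
  (forall z, 0 <= f z) -> (forall z, 0 <= g z) ->
  mutual (fun z => f z + g z) mu nu = mutual f mu nu + mutual g mu nu.
Proof.
move=> mf mg f0 g0; rewrite -ge0_integralD//.
- apply: eq_integral => y _; rewrite ge0_integralD//; exact: measurable_interaction.
- by move=> y _; exact: integral_ge0.
- exact: (measurable_potential mf).
- by move=> y _; exact: integral_ge0.
- exact: (measurable_potential mg).
Qed.

Lemma mutualZ (k : R) f mu nu : (0 <= k)%R -> measurable_fun setT f ->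
  (forall z, 0 <= f z) -> mutual (fun z => k%:E * f z) mu nu = k%:E * mutual f mu nu.
Proof.
move=> k0 mf f0; rewrite -ge0_integralZl//.
- apply: eq_integral => y _; rewrite ge0_integralZl//; exact: measurable_interaction.
- exact: (measurable_potential mf).
- by move=> y _; exact: integral_ge0.
Qed.

(** An upper bound on W, rather than an equality, is assumed so that the logarithm, dominated by a
    power, is covered too. *)
Lemma finite_energy (W : V -> \bar R) (K c a : R) :
  measurable_fun setT W -> (forall x, 0 <= W x) ->
  (0 <= K)%R -> (0 <= c)%R -> (0 < a < n%:R / 2)%R ->
  (forall z, W z <= (K * dotrV z z)%:E + c%:E * power_kernel a z) ->
  exists mu : probability V R, mu (cube 1) = 1 /\ mutual W mu mu < +oo.
Proof.
move=> mW W0 K0 c0 /andP[a0 an] Wle.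
have [mu [mu1 hmu]] := @unit_cube_probability R n.
exists mu; split => //.
have mu2 := finite_second_moment_cube mu1.
have pk := power_kernel_energy a0 an hmu.
have mP : measurable_fun setT (power_kernel a : V -> \bar R) by exact: measurable_power_kernel.
have mrho : measurable_fun setT (fun z : V => (dotrV z z)%:E).
  by apply/measurable_EFinP; exact: measurable_dotrV.
have rho0 (z : V) : 0 <= (dotrV z z)%:E by rewrite lee_fin dotrV_ge0.
have pk0 := @power_kernel_ge0 R n a.
apply: (@le_lt_trans _ _ (mutual (fun z => K%:E * (dotrV z z)%:E + c%:E * power_kernel a z) mu mu)).
  apply: le_mutual => //.
  by apply: emeasurable_funD; exact: measurable_funeM.
have K0' (z : V) : 0 <= K%:E * (dotrV z z)%:E by apply: mule_ge0; [rewrite lee_fin|exact: rho0].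
have c0' (z : V) : 0 <= c%:E * power_kernel a z by apply: mule_ge0; [rewrite lee_fin|exact: pk0].
rewrite mutualD//; [|exact: measurable_funeM|exact: measurable_funeM].
rewrite !mutualZ// [X in _ * X + _]integral_dist2// -EFinM lte_add_pinfty ?ltry//.
by rewrite lte_mul_pinfty.
Qed.

Lemma lebesgue_cube (r : R) : (0 <= r)%R -> leb (cube r) = ((r + r) ^+ n)%:E.
Proof.
move=> r0; rewrite cubeE (lebesgue_rV_box (A := fun=> `[(- r)%R, r]%classic))//.
rewrite (eq_bigr (fun=> (r + r)%:E)) => [|i _]; last first.
  rewrite /= lebesgue_measure_itv/= lte_fin; case: ltP => h.
    by rewrite opprK EFinD.
  by have -> : r = 0%R; [lra|rewrite addr0].
by rewrite prodEFin prodr_const card_ord.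
Qed.

(** [fine] would send an infinite volume to 0, so finiteness is proved along with positivity, by
    enclosing the ball between two cubes. *)
Lemma unit_ball_volume_gt0 : (0 < unit_ball_volume R n)%R.
Proof.
have mB : measurable [set x : V | (enorm x < 1)%R].
  have -> : [set x : V | (enorm x < 1)%R] = setT `&` [set x | (enorm x)%:E < 1] by rewrite setTI.
  by apply: emeasurable_fun_infty_o => //; apply/measurable_EFinP; exact: measurable_enorm.
have mc (r : R) : measurable (cube r : set V) by exact: measurable_cube.
rewrite /unit_ball_volume fine_gt0//; apply/andP; split.
  (* The cube of half-side 1 / (n + 1) lies in the ball because n / (n + 1)^2 < 1. *)
  pose r : R := (n.+1%:R^-1)%R; have r0 : (0 < r)%R by rewrite invr_gt0.
  apply: (@lt_le_trans _ _ (leb (cube r))).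
    by rewrite lebesgue_cube ?(ltW r0)// lte_fin exprn_gt0// addr_gt0.
  apply: le_measure; rewrite ?inE// => x hx /=.
  rewrite -(ltr_pXn2r (n := 2))// ?nnegrE ?enorm_ge0// expr1n enorm_sqr.
  apply: (@le_lt_trans _ _ (\sum_(i < n) r ^+ 2)%R).
    by apply: ler_sum => i _; have /andP[h1 h2] := hx i; nra.
  rewrite sumr_const card_ord -mulr_natl.
  rewrite /r exprVn ltr_pdivrMr ?exprn_gt0// mul1r -natrX ltr_nat.
  by rewrite expnS expn1; nia.
apply: (@le_lt_trans _ _ (leb (cube 1))); last by rewrite lebesgue_cube// ltry.
apply: le_measure; rewrite ?inE// => x /= hx i.
by rewrite -ler_norml (le_trans (coord_le_enorm x i))// ltW.
Qed.

End kernel_energy.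

Section fundamental_solutions.
Context {R : realType} {n : nat}.
Local Notation V := 'rV[R]_n.
Local Open Scope ereal_scope.

Lemma scaled_power_kernelE (c a : R) (z : V) : (0 < c)%R -> (0 < a)%R ->
  (c / gamma_cst a)%:E * power_kernel a z =
  if z == 0%R then +oo else (c * enorm z `^ (- (2 * a)))%:E.
Proof.
move=> c0 a0; have g0 : (0 < gamma_cst a :> R)%R by exact: gamma_cst_gt0.
rewrite power_kernelE//; case: ifPn => [_|_].
  by rewrite gt0_muley// lte_fin divr_gt0.
by rewrite -EFinM mulrA divfK// gt_eqF.
Qed.

Lemma riesz_power_kernel (c s : R) (z : V) : (0 < c)%R -> (2 * s < n%:R)%R ->
  riesz c s z = (c / gamma_cst ((n%:R - 2 * s) / 2))%:E * power_kernel ((n%:R - 2 * s) / 2) z.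
Proof.
move=> c0 sn; rewrite scaled_power_kernelE//; last by rewrite divr_gt0// subr_gt0.
by rewrite mulrCA divff ?pnatr_eq0// mulr1.
Qed.

Lemma newtonian_power_kernel (z : V) : (2 < n)%N ->
  let c := ((n%:R * (n%:R - 2) * unit_ball_volume R n)^-1)%R in
  newtonian z = (c / gamma_cst ((n%:R - 2) / 2))%:E * power_kernel ((n%:R - 2) / 2) z.
Proof.
move=> n2 c; have n2R : (2 < n%:R :> R)%R by rewrite ltr_nat.
have v0 := @unit_ball_volume_gt0 R n.
rewrite scaled_power_kernelE; last 2 first.
- by rewrite invr_gt0 !mulr_gt0// ?subr_gt0//; lra.
- by rewrite divr_gt0// subr_gt0.
rewrite /newtonian; case: ifPn => // _.
by rewrite gtn_eqF// [(2 * _)%R]mulrCA divff ?pnatr_eq0// mulr1 opprB.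
Qed.

Lemma newtonian_log (z : V) : n = 2%N ->
  newtonian z = if z == 0%R then +oo else (- ((4 * pi)^-1 * ln (dotrV z z)))%:E.
Proof.
move=> /eqP n2; rewrite /newtonian n2; case: ifPn => // z0; congr EFin.
have r0 : (0 < dotrV z z)%R by rewrite lt_neqAle dotrV_ge0 eq_sym dotrV_eq0 z0.
have e0 : (0 < enorm z)%R by rewrite sqrtr_gt0.
have p0 : (pi != 0 :> R)%R by rewrite gt_eqF ?pi_gt0.
rewrite -enorm_sqr lnXn// lnV ?posrE// -mulr_natl.
move: pi p0 => p p0; field.
exact: p0.
Qed.

End fundamental_solutions.

Section confined_kernels.
Context {R : realType} {n : nat}.
Local Notation V := 'rV[R]_n.
Local Open Scope ereal_scope.

Lemma power_kernel_minimizer (K k a : R) (W : V -> \bar R) : (0 < n)%N ->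
  (0 < K)%R -> (0 < k)%R -> (0 < a < n%:R / 2)%R -> (forall x, 0 <= W x) ->
  (forall z, W z = (K * dotrV z z)%:E + k%:E * power_kernel a z) ->
  has_unique_radial_minimizer W.
Proof.
move=> n0 K0 k0 a0n W0 WE; have /andP[a0 _] := a0n.
have Wmix := gauss_mixture_power k0 a0 WE.
have mW := gauss_mixture_measurable Wmix.
apply: (confined_energy_minimizer n0 mW W0 (gauss_mixture_rot Wmix) (gauss_mixture_lsc Wmix) K0 (lexx 0%R)).
- by move=> z; rewrite adde0 WE leeDl// mule_ge0 ?power_kernel_ge0// lee_fin ltW.
- exact: Wmix.
- apply: (finite_energy mW W0 (ltW K0) (ltW k0) a0n) => z.
  by rewrite WE.
Qed.

Lemma log_kernel_minimizer (K k : R) (W : V -> \bar R) : (1 < n)%N ->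
  (0 < K)%R -> (0 < k)%R -> (forall x, 0 <= W x) ->
  (forall z, W z = (K * dotrV z z)%:E +
    (if z == 0%R then +oo else (- (k * ln (dotrV z z)))%:E)) ->
  has_unique_radial_minimizer W.
Proof.
move=> n1 K0 k0 W0 WE; have n0 := ltnW n1.
have Wmix := gauss_mixture_log k0 WE.
have mW := gauss_mixture_measurable Wmix.
have K20 : (0 < K / 2)%R by rewrite divr_gt0.
have ln_le (t : R) : (0 < t)%R -> (ln t <= t)%R.
  by move=> t0; have := @le_ln1Dx R (t - 1); rewrite subrKC; lra.
(* From ln t <= t at t = rho / b one gets k ln rho <= K rho / 2 + k ln b: half of the confinement
   absorbs the logarithm. *)
pose b := (2 * k / K)%R; have b0 : (0 < b)%R by rewrite divr_gt0// mulr_gt0.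
have rho0 (z : V) : z != 0%R -> (0 < dotrV z z)%R.
  by move=> z0; rewrite lt_neqAle dotrV_ge0 eq_sym dotrV_eq0 z0.
apply: (confined_energy_minimizer n0 mW W0 (gauss_mixture_rot Wmix) (gauss_mixture_lsc Wmix) K20 (normr_ge0 (k * ln b)%R)).
- move=> z; rewrite WE; case: ifPn => [_|/rho0 r0]; first by rewrite addey// leey.
  rewrite -!EFinD lee_fin.
  have := ln_le (dotrV z z / b)%R (divr_gt0 r0 b0).
  rewrite ln_div ?posrE// => h.
  have h2 : (k * (ln (dotrV z z) - ln b) <= k * (dotrV z z / b))%R by rewrite ler_pM2l.
  have e : (k * (dotrV z z / b) = K / 2 * dotrV z z)%R.
    by rewrite /b; field; rewrite ?gt_eqF.
  by have := ler_norm (k * ln b)%R; lra.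
- exact: Wmix.
have g0 : (0 < gamma_cst 2^-1 :> R)%R by exact: gamma_cst_gt0.
have c0 : (0 < 2 * k :> R)%R by rewrite mulr_gt0.
have h0 : (0 < 2^-1 :> R)%R by rewrite invr_gt0.
(* Near the origin - k ln |z|^2 = 2 k ln (1 / |z|) is at most 2 k / |z|, the power with a = 1/2; a <
   n / 2 holds since n > 1. *)
apply: (@finite_energy _ _ W K (2 * k / gamma_cst 2^-1)%R 2^-1%R mW W0 (ltW K0)).
- by rewrite divr_ge0 ?ltW.
- by rewrite h0 ltr_pdivlMr// mulVf// ltr1n.
move=> z; rewrite scaled_power_kernelE// WE; apply: leeD => //.
case: ifPn => // /rho0 r0; rewrite lee_fin mulfV//.
have e0 : (0 < enorm z)%R by rewrite sqrtr_gt0.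
rewrite powR_inv1 ?(ltW e0)// -enorm_sqr lnXn// -mulr_natl.
have := ln_le (enorm z)^-1%R; rewrite invr_gt0 lnV ?posrE// => /(_ e0) h.
have := ler_wpM2l (ltW k0) h; nra.
Qed.

End confined_kernels.

Theorem theorem3p12 (R : realType) (N : nat) (K : R) (U W : 'rV[R]_N -> \bar R)
    (hN : (2 <= N)%N) (hK : 0 < K)
    (hU : U = @newtonian R N \/
          exists2 s : R, 0 < s < 1 & is_riesz_fundamental_solution s U)
    (hW : W = quadratic_plus K U)
    (W_ge0 : forall x : 'rV[R]_N, (0 <= W x)%E) :
  exists mu0 : probability 'rV[R]_N R,
    [/\ finite_second_moment mu0,
        d2_local_minimizer W mu0 /\
        (forall mu : probability 'rV[R]_N R, finite_second_moment mu ->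
           d2_local_minimizer W mu -> is_translate mu0 mu),
        global_minimizer_P2 W mu0 /\
        (forall mu : probability 'rV[R]_N R, finite_second_moment mu ->
           global_minimizer_P2 W mu -> is_translate mu0 mu),
        compact (measure_support mu0)
      & radially_symmetric_about (center_of_mass mu0) mu0].
Proof.
have n0 : (0 < N)%N by exact: leq_trans hN.
have N2 : 2 <= N%:R :> R by rewrite ler_nat.
have WE z : W z = ((K * dotrV z z)%:E + U z)%E by rewrite hW /quadratic_plus enorm_sqr.
case: hU => [UE|[s /andP[s0 s1] [c c0 [UE _]]]].
- have [N2E|N3] := eqVneq N 2%N.
    have k0 : 0 < (4 * pi)^-1 :> R by rewrite invr_gt0 mulr_gt0// pi_gt0.
    apply: (log_kernel_minimizer hN hK k0 W_ge0) => z.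
    by rewrite WE UE newtonian_log.
  have {}N3 : (2 < N)%N by rewrite ltn_neqAle eq_sym N3.
  have N3R : 2 < N%:R :> R by rewrite ltr_nat.
  have k0 : 0 < (N%:R * (N%:R - 2) * unit_ball_volume R N)^-1 / gamma_cst ((N%:R - 2) / 2) :> R.
    rewrite divr_gt0 ?invr_gt0 ?gamma_cst_gt0 ?mulr_gt0 ?unit_ball_volume_gt0 ?subr_gt0//; lra.
  have a0 : 0 < (N%:R - 2 : R) / 2 < N%:R / 2 by apply/andP; split; lra.
  apply: (power_kernel_minimizer n0 hK k0 a0 W_ge0) => z.
  by rewrite WE UE newtonian_power_kernel.
(* As s < 1 and N >= 2, the exponent N - 2 s is positive; s > 0 makes it less than N. *)
- have a0 : 0 < (N%:R - 2 * s) / 2 < N%:R / 2 by apply/andP; split; lra.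
  have k0 : 0 < c / gamma_cst ((N%:R - 2 * s) / 2) :> R.
    by rewrite divr_gt0 ?gamma_cst_gt0//; lra.
  apply: (power_kernel_minimizer n0 hK k0 a0 W_ge0) => z.
  by rewrite WE UE riesz_power_kernel//; lra.
Qed.
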